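(* Let $\mathbb{K}$ be a commutative field, $n$ a positive integer, and $V$ a linear subspace of $\operatorname{M}_n(\mathbb{K})$ with $\operatorname{codim} V<n-1$. Let $f : V \to \operatorname{M}_n(\mathbb{K})$ be an injective linear map such that for all $M \in V$, $f(M) \in \operatorname{GL}_n(\mathbb{K})$ if and only if $M \in \operatorname{GL}_n(\mathbb{K})$. Then $f$ extends to a Frobenius automorphism of $\operatorname{M}_n(\mathbb{K})$, unless $n=3$, $\operatorname{codim} V=1$ and $\mathbb{K} \simeq \mathbb{F}_2$ (i.e. the conclusion is asserted whenever these three conditions do not all hold).
   Context: $\operatorname{M}_n(\mathbb{K})$ is the space of $n\times n$ matrices over $\mathbb{K}$, $\operatorname{GL}_n(\mathbb{K})$ its set of invertible elements, and $\operatorname{codim} V$ denotes the codimension of $V$ in $\operatorname{M}_n(\mathbb{K})$. A Frobenius automorphism of $\operatorname{M}_n(\mathbb{K})$ is a map of the form $M\mapsto PMQ$ or of the form $M \mapsto PM^TQ$ for some $P,Q\in\operatorname{GL}_n(\mathbb{K})$. *)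

(* Defs.v *)
From mathcomp Require Import all_boot all_order all_algebra.

Set Implicit Arguments.
Unset Strict Implicit.
Unset Printing Implicit Defensive.

Import GRing.Theory.
Local Open Scope ring_scope.

(* The truncated subtraction is exact, since \dim V <= \dim {:vT}. *)
Definition codim (K : fieldType) (vT : vectType K) (V : {vspace vT}) : nat :=
  (\dim {:vT} - \dim V)%N.

Definition Frobenius_automorphism (K : fieldType) (n : nat)
    (u : 'M[K]_n -> 'M[K]_n) : Prop :=
  exists P Q : 'M[K]_n,
    [/\ P \in unitmx, Q \in unitmx &
        (forall M, u M = P *m M *m Q) \/ (forall M, u M = P *m M^T *m Q)].

Definition field_isomorphic (K L : fieldType) : Prop :=
  exists phi : {rmorphism K -> L}, bijective phi.

(* Main.v *)
Require Import Defs.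
From HB Require Import structures.
From mathcomp Require Import all_boot all_order all_algebra.
From mathcomp Require Import zify ring.
From Stdlib Require Import Classical ClassicalEpsilon.

(** Let V' be the image of V. For a column x, let V_x be the space of the M in V
    with M x = 0. It consists of singular matrices and has codimension at most n
    in V, so its image under f is a space of singular matrices of dimension at
    least n^2 - 2n + 2. The heart of the proof is the classification of such
    spaces ([singular_compression]): for n >= 4, and for n = 3 when K has an
    element other than 0 and 1, a linear space W of singular n x n matrices with
    dim W >= n^2 - 2n + 2 satisfies M v = 0 for all M in W and some column v <> 0,
    or y M = 0 for all M in W and some row y <> 0, or is a special space
    {M | B M A = 0} with A and B of ranks p, q >= 2, p + q = n + 1, and p = 2 or
    q = 2. When V is the whole space the dimension is at least n^2 - n, and one of
    the first two cases holds for every n >= 2 and every field.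

    The classification rests on two facts on affine spaces M0 + U of singular
    m x m matrices: dim U <= m^2 - m ([singular_affine_dim]), and in case of
    equality all elements of M0 + U share a nonzero right or left kernel vector
    ([singular_affine_max] for m >= 3, [singular_affine_max2] for m = 2 when K has
    more than two elements). Affine spaces arise from linear ones by compression:
    if M0 x <> 0, then deleting the directions x at the source and M0 x at the
    target turns the elements of W that kill x into the direction of an affine
    space of singular matrices ([compress_vector]). If W contains no rank-one
    matrix, this loses no dimension and the equality case applies for every vector
    M0 x ([no_rank_one3], [no_rank_one_kernel]). If W contains a rank-one matrix
    x z, then deleting x at the target and z at the source leaves a space of
    singular matrices ([compress_affine]); the rank-one matrix can be chosen so
    that the result is still large ([large_compress]), and induction on n applies,
    orders 3 and 4 being treated apart.

    The classification, applied to f and then to its inverse, shows that the image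
    of V_x is the set of the N in V' with N y = 0, or with y N = 0, or with
    B N A = 0 ([classify]). Testing three vectors with x1 + x2 + x3 = 0 on
    rank-one matrices of V' shows that the kind of the image does not depend on x
    ([uniform_type]); the test matrices exist because V and V' have codimension at
    most n - 2. Counting dimensions excludes the case in which f, its inverse, and
    the inverse of its transpose are all special ([all_spectype_false]). So, up to
    inverting and transposing, the image of V_x is always the set of the N with
    N y_x = 0. The line of y_x depends on that of x compatibly with sums, and the
    vectors y_x can be normalised by means of two matrices w h1 and w h2 of V so
    that y_x = Y x for a matrix Y ([coltype_matrix_coord]); no field automorphism
    appears because f is linear. Then M |-> f(M) Y kills x whenever M does, and
    such a map is a left multiplication ([local_linear]), that is, f(M) Y = P M. *)

Set Implicit Arguments.
Unset Strict Implicit.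
Unset Printing Implicit Defensive.

Import GRing.Theory.
Local Open Scope ring_scope.

(** * Linear maps on spaces of matrices *)

(** Replaces the dimensions of the context by plain natural-number variables, so
    that the arithmetic tactics do not have to look inside them. *)
Ltac abstract_dims :=
  repeat match goal with
  | H : context [@dimv ?a ?b ?c] |- _ => revert H
  end;
  repeat match goal with
  | |- context [@dimv ?a ?b ?c] =>
      let d := fresh "d" in set d := (@dimv a b c : nat); clearbody d
  end; intros.
Ltac dlia := abstract_dims; lia.
Ltac dnia := abstract_dims; nia.

Section Basics.
Variable K : fieldType.

(** The linear map M |-> B M A between spaces of matrices. *)
Definition lmul p' p q q' (B : 'M[K]_(p', p)) (A : 'M[K]_(q, q')) :
    'Hom('M[K]_(p, q), 'M[K]_(p', q')) :=
  linfun (mulmx B \o mulmxr A).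

Lemma lmulE p' p q q' (B : 'M[K]_(p', p)) (A : 'M[K]_(q, q')) M :
  lmul B A M = B *m M *m A.
Proof. by rewrite lfunE /= mulmxA. Qed.

Lemma memv_lker_lmul p' p q q' (B : 'M[K]_(p', p)) (A : 'M[K]_(q, q')) M :
  (M \in lker (lmul B A)) = (B *m M *m A == 0).
Proof. by rewrite memv_ker lmulE. Qed.

Lemma dim_fullM m n : \dim {:'M[K]_(m, n)} = (m * n)%N.
Proof. by rewrite dimvf dim_matrix. Qed.

Lemma unitmx_of_ker n (M : 'M[K]_n) :
  (forall w : 'cV_n, M *m w = 0 -> w = 0) -> M \in unitmx.
Proof.
move=> inj; rewrite -unitmx_tr -row_free_unit -kermx_eq0; apply/eqP.
apply/row_matrixP=> i; rewrite row0; apply: trmx_inj; rewrite trmx0.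
by apply: inj; rewrite -[M in M *m _]trmxK -trmx_mul -row_mul mulmx_ker row0 trmx0.
Qed.

Lemma ker_of_nonunit n (M : 'M[K]_n) :
  M \notin unitmx -> exists2 w : 'cV_n, w != 0 & M *m w = 0.
Proof.
rewrite -unitmx_tr -row_free_unit -kermx_eq0 => /rowV0Pn[v].
rewrite sub_kermx => /eqP vM v0; exists v^T; first by rewrite trmx_eq0.
by rewrite -[M in M *m _]trmxK -trmx_mul vM trmx0.
Qed.

Lemma unitmx_ker0 n (M : 'M[K]_n) (w : 'cV_n) :
  M \in unitmx -> M *m w = 0 -> w = 0.
Proof. by move=> uM Mw; rewrite -(mulKmx uM w) Mw mulmx0. Qed.

Lemma nonunit_of_ker n (M : 'M[K]_n) (w : 'cV_n) :
  w != 0 -> M *m w = 0 -> M \notin unitmx.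
Proof.
move=> w0 Mw; apply/negP => /unitmx_ker0 /(_ Mw) e.
by rewrite e eqxx in w0.
Qed.

(** A matrix X with independent rows extends to an invertible matrix col_mx X Y,
    whose inverse is row_mx X' Y'. *)
Lemma split_rows a b (X : 'M[K]_(a, a + b)) : row_free X ->
  exists Y : 'M[K]_(b, a + b), exists X' : 'M[K]_(a + b, a),
  exists Y' : 'M[K]_(a + b, b),
  [/\ X *m X' = 1%:M, X *m Y' = 0, Y *m X' = 0, Y *m Y' = 1%:M
    & X' *m X + Y' *m Y = 1%:M].
Proof.
move=> freeX.
have rkX : \rank X = a by apply/eqP.
pose P := col_ebase X; pose Q := row_ebase X.
have defX : X = P *m usubmx Q.
  have := mulmx_ebase X; rewrite -/P -/Q rkX pid_mx_row -mulmxA => <-.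
  congr (_ *m _).
  by rewrite -[in LHS](vsubmxK Q) mul_row_col mul1mx mul0mx addr0.
pose U := col_mx X (dsubmx Q).
have uU : U \in unitmx.
  have -> : U = block_mx P 0 0 1%:M *m Q.
    by rewrite -[in RHS](vsubmxK Q) mul_block_col !mul0mx mul1mx addr0 add0r -defX.
  rewrite unitmx_mul row_ebase_unit andbT unitmxE det_ublock det1 mulr1 -unitmxE.
  exact: col_ebase_unit.
pose V := invmx U.
have UV : U *m V = 1%:M by rewrite mulmxV.
have VU : V *m U = 1%:M by rewrite mulVmx.
exists (dsubmx Q), (lsubmx V), (rsubmx V).
move: UV; rewrite -{1}(hsubmxK V) mul_col_row scalar_mx_block => /eq_block_mx[-> -> -> ->].
by split; rewrite // -mul_row_col hsubmxK -/U VU scalar_mx_block.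
Qed.

(** A matrix A with independent columns extends to an invertible matrix
    row_mx A C, whose inverse is col_mx A' B. *)
Lemma split_cols a b (A : 'M[K]_(a + b, a)) : row_free A^T ->
  exists C : 'M[K]_(a + b, b), exists A' : 'M[K]_(a, a + b),
  exists B : 'M[K]_(b, a + b),
  [/\ A' *m A = 1%:M, A' *m C = 0, B *m A = 0, B *m C = 1%:M
    & A *m A' + C *m B = 1%:M].
Proof.
move=> /split_rows[Y [X' [Y' [e1 e2 e3 e4 e5]]]].
exists Y^T, X'^T, Y'^T; split; apply: trmx_inj;
  by rewrite ?raddfD /= ?trmx_mul ?trmxK ?trmx1 ?trmx0.
Qed.

Lemma row_free_cV n (x : 'cV[K]_n) : row_free x^T = (x != 0).
Proof. by rewrite /row_free rank_rV trmx_eq0; case: (x == 0). Qed.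

Lemma row_free_rV n (x : 'rV[K]_n) : row_free x = (x != 0).
Proof. by rewrite /row_free rank_rV; case: (x == 0). Qed.

Lemma dim_lker_lb (aT rT : vectType K) (f : 'Hom(aT, rT)) (U : {vspace aT}) :
  (\dim U <= \dim (U :&: lker f) + \dim {:rT})%N.
Proof. by rewrite -[X in (X <= _)%N](limg_ker_dim f U) leq_add2l dimvS // subvf. Qed.

Lemma dim_limg_ub (aT rT : vectType K) (f : 'Hom(aT, rT)) (U : {vspace aT}) :
  (\dim (f @: U) <= \dim U)%N.
Proof. by rewrite -(limg_ker_dim f U) leq_addl. Qed.

Lemma dim_param (aT rT : vectType K) (f : 'Hom(aT, rT)) (U : {vspace rT}) :
  (forall v, v \in U -> exists t, v = f t) -> (\dim U <= \dim {:aT})%N.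
Proof.
move=> H; apply: leq_trans (dim_limg_ub f fullv); apply/dimvS/subvP => v /H[t ->].
by rewrite memv_img // memvf.
Qed.

Lemma dim_inj (aT rT : vectType K) (f : 'Hom(aT, rT)) (U : {vspace aT}) :
  (forall v, v \in U -> f v = 0 -> v = 0) -> \dim (f @: U) = \dim U.
Proof.
move=> inj; apply: limg_dim_eq; apply/eqP; rewrite -subv0; apply/subvP => v.
by rewrite memv_cap memv_ker memv0 => /andP[vU /eqP /inj ->].
Qed.

Lemma vspace_nz (vT : vectType K) (U : {vspace vT}) :
  (0 < \dim U)%N -> exists2 v, v \in U & v != 0.
Proof.
by rewrite lt0n dimv_eq0 -vpick0 => h; exists (vpick U); rewrite ?memv_pick.
Qed.

(** Two subspaces whose dimensions sum up to more than that of the whole space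
    have a common nonzero vector. *)
Lemma meet_nz (vT : vectType K) (U V : {vspace vT}) :
  (\dim {:vT} < \dim U + \dim V)%N -> exists v, [/\ v != 0, v \in U & v \in V].
Proof.
move=> lt; have := dimv_sum_cap U V.
have le : (\dim (U + V) <= \dim {:vT})%N by rewrite dimvS // subvf.
move=> e; have : (0 < \dim (U :&: V))%N by lia.
by case/vspace_nz => v; rewrite memv_cap => /andP[]; exists v.
Qed.

Lemma meet_img (aT rT : vectType K) (f : 'Hom(aT, rT)) (X : {vspace aT}) (V : {vspace rT}) :
  (forall t, t \in X -> f t = 0 -> t = 0) ->
  (\dim {:rT} < \dim X + \dim V)%N ->
  exists t, [/\ t != 0, t \in X & f t \in V].
Proof.
move=> inj; rewrite -(dim_inj inj) => /meet_nz[v [v0 /memv_imgP[t tX e] vV]].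
by exists t; split; rewrite -?e //; apply: contraNneq v0 => t0; rewrite e t0 linear0.
Qed.

Lemma mul_col_scal n (x : 'cV[K]_n) (s : 'M[K]_1) : x *m s = s 0 0 *: x.
Proof. by rewrite {1}[s]mx11_scalar mul_mx_scalar. Qed.

Lemma mul_scal_row n (x : 'rV[K]_n) (s : 'M[K]_1) : s *m x = s 0 0 *: x.
Proof. by rewrite {1}[s]mx11_scalar mul_scalar_mx. Qed.

Lemma mul_colrow_eq0 m n (x : 'cV[K]_m) (z : 'rV[K]_n) :
  x *m z = 0 -> x = 0 \/ z = 0.
Proof.
move=> e; case: (eqVneq z 0) => [|z0]; [by right | left].
by apply/eqP; rewrite -(@mulmx_free_eq0 _ _ _ _ x z) ?e // row_free_rV.
Qed.

Lemma neq0_col_ex n (x : 'cV[K]_n) : x != 0 -> exists z : 'rV[K]_n, z *m x = 1%:M.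
Proof.
rewrite -row_free_cV => /row_freeP[B e]; exists B^T; apply: trmx_inj.
by rewrite trmx_mul trmxK trmx1.
Qed.

Lemma neq0_row_ex n (x : 'rV[K]_n) : x != 0 -> exists z : 'cV[K]_n, x *m z = 1%:M.
Proof. by rewrite -row_free_rV => /row_freeP[B e]; exists B. Qed.

Lemma neq0_of_mulr1 n (y : 'rV[K]_n) (q : 'cV[K]_n) : y *m q = 1%:M -> q != 0.
Proof.
move=> yq; apply: contraNneq (matrix_nonzero1 K 0) => q0.
by move: yq; rewrite q0 mulmx0 => /esym/eqP.
Qed.

Lemma neq0_of_mul1r n (y : 'rV[K]_n) (q : 'cV[K]_n) : y *m q = 1%:M -> y != 0.
Proof.
move=> yq; apply: contraNneq (matrix_nonzero1 K 0) => y0.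
by move: yq; rewrite y0 mul0mx => /esym/eqP.
Qed.

Lemma delta_col_neq0 n (i : 'I_n) : delta_mx i 0 != 0 :> 'cV[K]_n.
Proof. by apply/eqP => /matrixP/(_ i 0)/eqP; rewrite !mxE !eqxx oner_eq0. Qed.

Lemma wide_kernel m n (A : 'M[K]_(m, n)) : (m < n)%N -> exists2 t : 'cV_n, t != 0 & A *m t = 0.
Proof.
move=> mn; have := dim_lker_lb (lmul A (1%:M : 'M_1)) fullv.
rewrite capfv !dim_fullM !muln1 => h.
have [t] : exists2 t, t \in lker (lmul A (1%:M : 'M_1)) & t != 0 by apply: vspace_nz; dlia.
by rewrite memv_lker_lmul mulmx1 => /eqP At t0; exists t.
Qed.

Lemma tall_kernel m n (A : 'M[K]_(m, n)) : (n < m)%N -> exists2 h : 'rV_m, h != 0 & h *m A = 0.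
Proof.
move=> /(wide_kernel A^T)[t t0 e]; exists t^T; rewrite ?trmx_eq0 //.
by apply: trmx_inj; rewrite trmx_mul trmxK e trmx0.
Qed.

End Basics.

(** * Affine spaces of singular matrices *)

Section SingularAffine.
Variable K : fieldType.

(** The affine space M0 + U consists of singular matrices. *)
Definition singular_affine n (M0 : 'M[K]_n) (U : {vspace 'M[K]_n}) : Prop :=
  forall u, u \in U -> M0 + u \notin unitmx.

Lemma split_col m (x : 'cV[K]_m.+1) : x != 0 ->
  exists C : 'M[K]_(m.+1, m), exists x' : 'rV[K]_m.+1, exists L : 'M[K]_(m, m.+1),
  [/\ x' *m x = 1%:M, x' *m C = 0, L *m x = 0, L *m C = 1%:M
    & x *m x' + C *m L = 1%:M].
Proof. by rewrite -row_free_cV => /(@split_cols K 1 m). Qed.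

Lemma split_row m (z : 'rV[K]_m.+1) : z != 0 ->
  exists D : 'M[K]_(m, m.+1), exists z' : 'cV[K]_m.+1, exists R : 'M[K]_(m.+1, m),
  [/\ z *m z' = 1%:M, z *m R = 0, D *m z' = 0, D *m R = 1%:M
    & z' *m z + R *m D = 1%:M].
Proof. by rewrite -row_free_rV => /(@split_rows K 1 m). Qed.

(** The kernel of L is contained in the line of x. *)
Definition ker_line m n (L : 'M[K]_(m, n)) (x : 'cV[K]_n) :=
  forall p (w : 'M_(n, p)), L *m w = 0 -> exists z, w = x *m z.

(** If M and M + x z are singular, then so is M restricted to the kernel of z and
    taken modulo x. *)
Lemma compress_rank1 n m (x : 'cV[K]_n) (z : 'rV[K]_n) (L : 'M[K]_(m, n)) (R : 'M[K]_(n, m)) M :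
  x != 0 -> L *m x = 0 -> (forall w : 'cV_n, z *m w = 0 -> exists t, w = R *m t) ->
  M \notin unitmx -> M + x *m z \notin unitmx -> L *m M *m R \notin unitmx.
Proof.
move=> x0 Lx zR /ker_of_nonunit[w w0 Mw] /ker_of_nonunit[w' w'0 Mw'].
apply/negP => uN.
have LM (v : 'cV_n) : L *m M *m v = 0 -> z *m v = 0 -> v = 0.
  by move=> LMv /zR[t et]; rewrite et mulmxA in LMv; rewrite et (unitmx_ker0 uN LMv) mulmx0.
have LMw : L *m M *m w = 0 by rewrite -mulmxA Mw mulmx0.
have LMw' : L *m M *m w' = 0.
  have : L *m ((M + x *m z) *m w') = 0 by rewrite Mw' mulmx0.
  by rewrite mulmxDl mulmxDr -!mulmxA (mulmxA L x) Lx mul0mx addr0 mulmxA.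
have zw0 : (z *m w) 0 0 != 0.
  by apply: contra w0 => /eqP e; apply/eqP/LM => //; rewrite [z *m w]mx11_scalar e raddf0.
have zw'0 : (z *m w') 0 0 != 0.
  by apply: contra w'0 => /eqP e; apply/eqP/LM => //; rewrite [z *m w']mx11_scalar e raddf0.
set s := (z *m w) 0 0 in zw0; set t := (z *m w') 0 0 in zw'0.
have e : t *: w - s *: w' = 0.
  apply: LM; rewrite !mulmxBr -!scalemxAr ?LMw ?LMw' ?scaler0 ?subr0 //.
  by rewrite [z *m w]mx11_scalar [z *m w']mx11_scalar -/s -/t !scale_scalar_mx mulrC subrr.
have {e} e : w' = (t / s) *: w.
  by move/subr0_eq: e => e; rewrite mulrC -scalerA e scalerA mulVf // scale1r.
have : (M + x *m z) *m w = 0.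
  apply/eqP; rewrite -(inj_eq (scalerI (a := t / s) _)) ?mulf_neq0 ?invr_eq0 // scaler0.
  by rewrite scalemxAr -e Mw'.
rewrite mulmxDl Mw add0r -mulmxA mul_col_scal -/s => /eqP.
by rewrite scaler_eq0 (negPf zw0) (negPf x0).
Qed.

(** The matrices x r with a given column x. *)
Definition left_line m n (x : 'cV[K]_m) : {vspace 'M[K]_(m, n)} :=
  limg (lmul x (1%:M : 'M[K]_n)).

(** The matrices q z with a given row z. *)
Definition right_line m n (z : 'rV[K]_n) : {vspace 'M[K]_(m, n)} :=
  limg (lmul (1%:M : 'M[K]_m) z).

Lemma left_lineP m n (x : 'cV[K]_m) (M : 'M[K]_(m, n)) :
  reflect (exists r : 'rV_n, M = x *m r) (M \in left_line n x).
Proof.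
apply: (iffP memv_imgP) => [[r _ ->]|[r ->]]; exists r; rewrite ?memvf //;
  by rewrite lmulE mulmx1.
Qed.

Lemma right_lineP m n (z : 'rV[K]_n) (M : 'M[K]_(m, n)) :
  reflect (exists q : 'cV_m, M = q *m z) (M \in right_line m z).
Proof.
apply: (iffP memv_imgP) => [[r _ ->]|[r ->]]; exists r; rewrite ?memvf //;
  by rewrite lmulE mul1mx.
Qed.

(** The matrices x r + q z, that is, those whose restriction to the kernel of z
    has its image in the line of x. *)
Definition cross n (x : 'cV[K]_n) (z : 'rV[K]_n) := (left_line n x + right_line n z)%VS.

Lemma mem_left_cross n (x : 'cV[K]_n) (z : 'rV[K]_n) r : x *m r \in cross x z.
Proof. by apply: (subvP (addvSl _ _)); apply/left_lineP; exists r. Qed.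

Lemma mem_right_cross n (x : 'cV[K]_n) (z : 'rV[K]_n) q : q *m z \in cross x z.
Proof. by apply: (subvP (addvSr _ _)); apply/right_lineP; exists q. Qed.

Lemma dim_left_line m n (x : 'cV[K]_m) : x != 0 -> \dim (left_line n x) = n.
Proof.
move=> x0; rewrite /left_line dim_inj ?dim_fullM ?mul1n // => r _.
by rewrite lmulE mulmx1 => /mul_colrow_eq0[] // /eqP; rewrite (negPf x0).
Qed.

Lemma dim_right_line m n (z : 'rV[K]_n) : z != 0 -> \dim (right_line m z) = m.
Proof.
move=> z0; rewrite /right_line dim_inj ?dim_fullM ?muln1 // => q _.
by rewrite lmulE mul1mx => /mul_colrow_eq0[] // /eqP; rewrite (negPf z0).
Qed.

Lemma lker_cross m (x : 'cV[K]_m.+1) (z : 'rV[K]_m.+1)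
   (C : 'M[K]_(m.+1, m)) (x' : 'rV[K]_m.+1) (L : 'M[K]_(m, m.+1))
   (D : 'M[K]_(m, m.+1)) (z' : 'cV[K]_m.+1) (R : 'M[K]_(m.+1, m)) :
   L *m x = 0 -> x *m x' + C *m L = 1%:M ->
   z *m R = 0 -> z' *m z + R *m D = 1%:M ->
   lker (lmul L R) = cross x z.
Proof.
move=> Lx e1 zR e2; apply/vspaceP => M; rewrite memv_lker_lmul; apply/eqP/memv_addP.
  move=> LMR; exists (x *m (x' *m M)); first by apply/left_lineP; exists (x' *m M).
  exists ((C *m L *m M *m z') *m z); first by apply/right_lineP; exists (C *m L *m M *m z').
  have -> : C *m L *m M *m z' *m z = C *m L *m M.
    rewrite -[RHS]mulmx1 -e2 mulmxDr !mulmxA.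
    have -> : C *m L *m M *m R = 0 by rewrite -!mulmxA (mulmxA L) LMR mulmx0.
    by rewrite mul0mx addr0.
  by rewrite mulmxA -mulmxDl e1 mul1mx.
case=> _ /left_lineP[r ->] [_ /right_lineP[q ->] ->].
by rewrite mulmxDr mulmxDl mulmxA Lx !mul0mx add0r -!mulmxA zR !mulmx0.
Qed.

Lemma dim_cross m (x : 'cV[K]_m.+1) (z : 'rV[K]_m.+1) : x != 0 -> z != 0 ->
  \dim (cross x z) = m.*2.+1.
Proof.
move=> x0 z0.
have [C [x' [L [_ _ Lx _ e1]]]] := split_col x0.
have [D [z' [R [_ zR _ _ e2]]]] := split_row z0.
have lb := dim_lker_lb (lmul L R) fullv.
rewrite capfv (lker_cross Lx e1 zR e2) !dim_fullM in lb.
have := dimv_sum_cap (left_line m.+1 x) (right_line m.+1 z); rewrite dim_left_line // dim_right_line //.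
have : (0 < \dim (left_line m.+1 x :&: right_line m.+1 z))%N.
  rewrite lt0n dimv_eq0; apply/eqP => e0.
  have : x *m z \in (left_line m.+1 x :&: right_line m.+1 z)%VS.
    by rewrite memv_cap; apply/andP; split; [apply/left_lineP; exists z | apply/right_lineP; exists x].
  rewrite e0 memv0 => /eqP /mul_colrow_eq0[] /eqP; [by rewrite (negPf x0) | by rewrite (negPf z0)].
rewrite -/(cross x z); dlia.
Qed.

(** Compression of a singular affine space along a rank-one matrix x z of its
    direction: L has kernel the line of x, the left kernel of R is the line of z,
    and the compressed space is again singular. The dimension lost is that of the
    intersection of U with the cross of x and z. *)
Lemma compress_affine m (M0 : 'M[K]_m.+1) U x z : singular_affine M0 U ->
  x != 0 -> z != 0 -> x *m z \in U ->
  exists L : 'M[K]_(m, m.+1), exists R : 'M[K]_(m.+1, m),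
  [/\ ker_line L x,
      forall p (w : 'M_(p, m.+1)), w *m R = 0 -> exists q, w = q *m z,
      row_free L /\ row_free R^T,
      singular_affine (L *m M0 *m R) (lmul L R @: U)%VS &
      \dim U = (\dim (lmul L R @: U) + \dim (U :&: cross x z))%N].
Proof.
move=> sing x0 z0 xzU.
have [C [x' [L [_ _ Lx LC e1]]]] := split_col x0.
have [D [z' [R [_ zR _ DR e2]]]] := split_row z0.
exists L, R; split=> //.
- move=> p w Lw; exists (x' *m w).
  by rewrite mulmxA -[LHS]mul1mx -e1 mulmxDl -(mulmxA C) Lw mulmx0 addr0.
- move=> p w wR; exists (w *m z').
  by rewrite -mulmxA -[LHS]mulmx1 -e2 mulmxDr (mulmxA w R) wR mul0mx addr0.
- by split; apply/row_freeP; [exists C | exists D^T; rewrite -trmx_mul DR trmx1].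
- move=> _ /memv_imgP[u uU ->]; rewrite lmulE -mulmxDl -mulmxDr.
  apply: (compress_rank1 x0 Lx (z := z)); last by rewrite -addrA sing // memvD.
    move=> w zw; exists (D *m w); rewrite mulmxA -[LHS]mul1mx -e2 mulmxDl.
    by rewrite -(mulmxA z') zw mulmx0 add0r.
  exact: sing.
- by rewrite -(lker_cross Lx e1 zR e2) -(limg_ker_dim (lmul L R) U) addnC.
Qed.

(** Dieudonne: an affine space of singular m x m matrices has dimension at most
    m^2 - m. *)
Lemma singular_affine_dim m (M0 : 'M[K]_m) U : singular_affine M0 U -> (\dim U + m <= m * m)%N.
Proof.
elim: m M0 U => [|m IH] M0 U sing.
  by have := dimvS (subvf U); rewrite dim_fullM addn0.
rewrite leqNgt; apply/negP => large.
have [|nfull] := boolP (fullv <= U)%VS.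
  move=> /subvP/(_ _ (memvf (1%:M - M0))) /sing.
  by rewrite addrC subrK unitmx1.
(* For any z the cross of e_i and z is not contained in U, as it contains
   delta_mx i j; some e_i z with z <> 0 is in U by dimension. *)
have [i [j nij]] : exists i, exists j, delta_mx i j \notin U.
  suff /existsP[i /existsP[j nij]] : [exists i, exists j, delta_mx i j \notin U] by exists i, j.
  rewrite -[X in is_true X]negbK negb_exists; apply: contra nfull => /forallP h.
  apply/subvP => M _; rewrite (matrix_sum_delta M); apply: memv_suml => i _.
  apply: memv_suml => j _; apply: memvZ.
  by have := h i; rewrite negb_exists => /forallP/(_ j); rewrite negbK.
pose e : 'cV[K]_m.+1 := delta_mx i 0.
have ei0 : e != 0.
  by apply: delta_col_neq0.
have [z [z0 _ zU]] : exists t, [/\ t != 0, t \in {:'rV[K]_m.+1}%VS &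
     lmul e (1%:M : 'M_m.+1) t \in U].
  apply: meet_img; last by rewrite !dim_fullM; dnia.
  move=> t _; rewrite lmulE mulmx1 => /mul_colrow_eq0[] // /eqP; rewrite (negPf ei0) //.
rewrite lmulE mulmx1 in zU.
have [L [R [_ _ _ sing' dU]]] := compress_affine sing ei0 z0 zU.
have := IH _ _ sing'.
have : (\dim (U :&: cross e z) < \dim (cross e z))%N.
  rewrite ltn_neqAle (dimv_leqif_sup (capvSr _ _)) dimvS ?capvSr // andbT.
  apply/negP => /subvP/(_ (delta_mx i j)).
  have -> : delta_mx i j = e *m delta_mx 0 j.
    by rewrite mul_delta_mx.
  by rewrite mem_left_cross memv_cap mul_delta_mx (negPf nij) => /(_ isT).
rewrite dim_cross // => h1 h2; dnia.
Qed.

End SingularAffine.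

(** * Rank-one matrices spreading through a space *)

Section Spreading.
Variable K : fieldType.

(** The space of the transposes of the matrices of W. *)
Definition trV m n (W : {vspace 'M[K]_(m, n)}) : {vspace 'M[K]_(n, m)} :=
  (linfun (@trmx K m n) @: W)%VS.

Lemma mem_trV m n (W : {vspace 'M[K]_(m, n)}) M : (M \in trV W) = (M^T \in W).
Proof.
apply/memv_imgP/idP => [[w wW ->]|h]; first by rewrite lfunE /= trmxK.
by exists M^T; rewrite // lfunE /= trmxK.
Qed.

Lemma dim_trV m n (W : {vspace 'M[K]_(m, n)}) : \dim (trV W) = \dim W.
Proof. by apply: dim_inj => v _; rewrite lfunE /= => /eqP; rewrite trmx_eq0 => /eqP. Qed.

Lemma singular_affine_tr n (M0 : 'M[K]_n) U :
  singular_affine M0 U -> singular_affine M0^T (trV U).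
Proof.
move=> sing u; rewrite mem_trV => /sing; rewrite -(unitmx_tr (_ + _)).
by rewrite raddfD /= trmxK.
Qed.

Lemma singular_affine_shift n (M0 u : 'M[K]_n) (U : {vspace 'M[K]_n}) :
  u \in U -> singular_affine M0 U -> singular_affine (M0 + u) U.
Proof. by move=> uU sing v vU; rewrite -addrA sing // memvD. Qed.

(** The matrices that annihilate the column x. *)
Definition annv m n (x : 'cV[K]_n) : {vspace 'M[K]_(m, n)} := lker (lmul 1%:M x).
Lemma mem_annv m n (x : 'cV[K]_n) (M : 'M[K]_(m, n)) : (M \in annv m x) = (M *m x == 0).
Proof. by rewrite memv_lker_lmul mul1mx. Qed.

Lemma eq0_of_mull m n (w : 'M[K]_(m, n)) : (forall z : 'rV_m, z *m w = 0) -> w = 0.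
Proof.
by move=> h; apply/row_matrixP => i; rewrite rowE h row0.
Qed.

Lemma eq0_of_mulr m n (w : 'M[K]_(m, n)) : (forall z : 'cV_n, w *m z = 0) -> w = 0.
Proof.
move=> h; apply: trmx_inj; rewrite trmx0; apply: eq0_of_mull => z.
by apply: trmx_inj; rewrite trmx_mul trmxK trmx0 h.
Qed.

(** Compression at a vector x with M0 x <> 0: L has kernel the line of M0 x, and
    the columns of R span a complement of x. For u in U with u x = 0, the matrix
    M0 + u sends x to M0 x, so it is singular only if L (M0 + u) R is. *)
Lemma compress_vector m (M0 : 'M[K]_m.+1) (U : {vspace 'M[K]_m.+1}) x : singular_affine M0 U -> x != 0 -> M0 *m x != 0 ->
  exists L : 'M[K]_(m, m.+1), exists R : 'M[K]_(m.+1, m),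
  [/\ row_free L /\ row_free R^T, L *m (M0 *m x) = 0,
      ker_line L (M0 *m x),
      (forall w : 'cV_m.+1, exists s, exists t, w = s *: x + R *m t) /\
      (forall s t, s *: x + R *m t = 0 -> s = 0 /\ t = 0) &
      singular_affine (L *m M0 *m R) (lmul L R @: (U :&: annv _ x))%VS].
Proof.
move=> sing x0; set e := M0 *m x => e0.
have [C [e' [L [_ _ Le LC e1]]]] := split_col e0.
have [R [x' [D [x'x x'R Dx DR e2]]]] := split_col x0.
exists L, R; split=> //.
- by split; apply/row_freeP; [exists C | exists D^T; rewrite -trmx_mul DR trmx1].
- move=> p w Lw; exists (e' *m w).
  by rewrite mulmxA -[LHS]mul1mx -e1 mulmxDl -(mulmxA C) Lw mulmx0 addr0.
- split=> [w|s t h].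
    exists ((x' *m w) 0 0), (D *m w).
    by rewrite -mul_col_scal !mulmxA -mulmxDl e2 mul1mx.
  split.
    have := congr1 (mulmx x') h; rewrite mulmx0 mulmxDr -scalemxAr x'x mulmxA x'R mul0mx addr0.
    by move/matrixP/(_ 0 0); rewrite !mxE eqxx mulr1.
  have := congr1 (mulmx D) h.
  by rewrite mulmx0 mulmxDr -scalemxAr Dx scaler0 add0r mulmxA DR mul1mx.
move=> _ /memv_imgP[u + ->]; rewrite memv_cap mem_annv => /andP[uU /eqP ux].
rewrite lmulE -mulmxDl -mulmxDr; apply: contra (sing u uU) => uN.
have Mx : (M0 + u) *m x = e by rewrite mulmxDl ux addr0.
apply: unitmx_of_ker => w.
set t := D *m w; set s := x' *m w.
have -> : w = x *m s + R *m t by rewrite !mulmxA -mulmxDl e2 mul1mx.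
rewrite mulmxDr (mulmxA _ x s) (mulmxA _ R t) Mx; move: s t => s t Mw.
have t0 : t = 0.
  apply: (unitmx_ker0 uN); have := congr1 (mulmx L) Mw.
  by rewrite mulmx0 mulmxDr (mulmxA L e) Le mul0mx add0r 2!mulmxA.
move: Mw; rewrite t0 !mulmx0 !addr0 => /mul_colrow_eq0[/eqP|->]; first by rewrite (negPf e0).
by rewrite mulmx0.
Qed.

(** The kernel of the compression at x, among the matrices that annihilate x,
    consists of rank-one matrices. *)
Lemma compress_vector_ker m k (x e : 'cV[K]_m.+1) (L : 'M[K]_(k, m.+1)) (R : 'M[K]_(m.+1, m)) (M : 'M[K]_m.+1) :
  ker_line L e ->
  (forall w : 'cV_m.+1, exists s, exists t, w = s *: x + R *m t) ->
  M *m x = 0 -> L *m M *m R = 0 -> exists z : 'rV_m.+1, M = e *m z.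
Proof.
move=> LP dec Mx LMR; apply: LP; apply: eq0_of_mulr => v; have [s [t ->]] := dec v.
by rewrite mulmxDr -scalemxAr -(mulmxA L M x) Mx mulmx0 scaler0 add0r mulmxA LMR mul0mx.
Qed.

Lemma dim_image_vector m n (W : {vspace 'M[K]_(m, n)}) (v : 'cV[K]_n) (E : {vspace 'cV[K]_m}) :
  (forall M, M \in W -> M *m v \in E) -> (\dim W <= \dim (W :&: annv m v) + \dim E)%N.
Proof.
move=> h; rewrite -(limg_ker_dim (lmul (1%:M : 'M_m) v) W) -/(annv m v) leq_add2l.
by apply/dimvS/subvP => _ /memv_imgP[M MW ->]; rewrite lmulE mul1mx h.
Qed.

(** Without rank-one matrix in U, the compression at a vector x is injective on the
    elements of U that annihilate x. *)
Lemma dim_compress_vector m k (U : {vspace 'M[K]_m.+1}) (x e : 'cV[K]_m.+1)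
    (L : 'M[K]_(k, m.+1)) (R : 'M[K]_(m.+1, m)) :
  (forall (v : 'cV_m.+1) (z : 'rV_m.+1), v *m z \in U -> v *m z = 0) ->
  ker_line L e ->
  (forall w : 'cV_m.+1, exists s, exists t, w = s *: x + R *m t) ->
  \dim (lmul L R @: (U :&: annv m.+1 x)) = \dim (U :&: annv m.+1 x).
Proof.
move=> rkF LP dec; apply: dim_inj => w /memv_capP[wU].
rewrite mem_annv => /eqP wx; rewrite lmulE => LwR.
by have [z e'] := compress_vector_ker LP dec wx LwR; rewrite e'; apply: rkF; rewrite -e'.
Qed.

Lemma rank_one_or_none m n (W : {vspace 'M[K]_(m, n)}) :
  (exists x : 'cV_m, exists z : 'rV_n, [/\ x != 0, z != 0 & x *m z \in W]) \/
  (forall (x : 'cV_m) (z : 'rV_n), x *m z \in W -> x *m z = 0).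
Proof.
have [h|nex] := classic (exists x : 'cV_m, exists z : 'rV_n, [/\ x != 0, z != 0 & x *m z \in W]).
  by left.
right=> x z h.
case: (eqVneq x 0) => [->|x0]; first by rewrite mul0mx.
case: (eqVneq z 0) => [->|z0]; first by rewrite mulmx0.
by case: nex; exists x, z.
Qed.

Lemma codim1_sub (vT : vectType K) (U A Y : {vspace vT}) :
  (Y <= A)%VS -> (\dim A <= (\dim (U :&: A)).+1)%N -> (\dim Y <= (\dim (U :&: Y)).+1)%N.
Proof.
move=> YA h; have := dimv_sum_cap (U :&: A) Y.
have -> : (U :&: A :&: Y = U :&: Y)%VS by rewrite -capvA (capv_idPr YA).
have : (\dim (U :&: A + Y) <= \dim A)%N by rewrite dimvS // subv_add capvSr.
dlia.
Qed.

Lemma codim1_combination (vT : vectType K) (U A : {vspace vT}) (C1 C2 : vT) :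
  (\dim A <= (\dim (U :&: A)).+1)%N -> C1 \in A -> C2 \in A ->
  exists s t, (s != 0) || (t != 0) /\ s *: C1 + t *: C2 \in U.
Proof.
move=> h A1 A2; have [C1U|C1U] := boolP (C1 \in U).
  by exists 1, 0; rewrite oner_eq0 scale1r scale0r addr0.
have defA : A = ((U :&: A) + <[C1]>)%VS.
  apply/eqP; rewrite eq_sym eqEdim subv_add capvSr -memvE A1 /=.
  rewrite dimv_disjoint_sum ?dim_vline.
    by case: eqP C1U => [->|_ _]; rewrite ?mem0v // addn1.
  apply/eqP; rewrite -subv0; apply/subvP => v; rewrite memv_cap => /andP[].
  rewrite memv_cap => /andP[vU _] /vlineP[k ek]; rewrite memv0 ek.
  case: (eqVneq k 0) => [->|k0]; first by rewrite scale0r.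
  by move: vU; rewrite ek rpredZeq (negPf k0) (negPf C1U).
move: A2; rewrite defA => /memv_addP[u]; rewrite memv_cap => /andP[uU _] [_ /vlineP[k ->] ->].
exists (- k), 1; rewrite oner_eq0 orbT scale1r scaleNr addrCA addNr addr0; by split.
Qed.

Lemma neq0_other (T : nzRingType) (s t : T) : (s != 0) || (t != 0) -> s = 0 -> t != 0.
Proof. by move=> + s0; rewrite s0 eqxx. Qed.

Lemma vline_sym (vT : vectType K) (x y : vT) : x != 0 -> x \in <[y]>%VS -> y \in <[x]>%VS.
Proof.
move=> x0 /vlineP[c e]; apply/vlineP; exists c^-1.
rewrite e scalerA mulVf ?scale1r //; apply: contraNneq x0 => c0.
by rewrite e c0 scale0r.
Qed.

Lemma vline_dim_out (vT : vectType K) (A : {vspace vT}) (x : vT) :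
  (1 < \dim A)%N -> exists2 y, y \in A & y \notin <[x]>%VS.
Proof.
move=> dA; apply/subvPn; apply: contraL dA => /dimvS; rewrite dim_vline -leqNgt => h.
by apply: leq_trans h _; case: (x != 0).
Qed.

(** For n >= 3, if U contains a rank-one matrix and every cross of a rank-one
    matrix of U meets U in codimension at most one, then the rank-one matrices of
    U take every possible image, or every possible kernel. *)
Lemma rank_one_spread n (U : {vspace 'M[K]_n}) :
  (2 < n)%N ->
  (forall x z, x != 0 -> z != 0 -> x *m z \in U ->
     (\dim (cross x z) <= (\dim (U :&: cross x z)).+1)%N) ->
  (exists x : 'cV_n, exists z : 'rV_n, [/\ x != 0, z != 0 & x *m z \in U]) ->
  (forall x : 'cV_n, x != 0 -> exists2 z : 'rV_n, z != 0 & x *m z \in U) \/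
  (forall z : 'rV_n, z != 0 -> exists2 x : 'cV_n, x != 0 & x *m z \in U).
Proof.
move=> n2 thin [x1 [z [x10 z0 xzU]]].
apply: NNPP => nor; have [nA nB] := not_or_and _ _ nor.
have [q0 nq] := not_all_ex_not _ _ nA; have [q00 q0P] := imply_to_and _ _ nq.
have [r0 nr] := not_all_ex_not _ _ nB; have [r00 r0P] := imply_to_and _ _ nr.
(* q0 is the image, and r0 the row, of no rank-one matrix of U. *)
have q0F (w : 'rV_n) : q0 *m w \in U -> w = 0.
  by move=> h; apply/eqP/negPn/negP => w0; apply: q0P; exists w.
have r0F (w : 'cV_n) : w *m r0 \in U -> w = 0.
  by move=> h; apply/eqP/negPn/negP => w0; apply: r0P; exists w.
have [x2 x2zU x2x1] : exists2 x2 : 'cV_n, x2 *m z \in U & x2 \notin <[x1]>%VS.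
  have h : (right_line n z <= cross x1 z)%VS by apply: addvSr.
  have := codim1_sub h (thin _ _ x10 z0 xzU); rewrite dim_right_line // => hd.
  have := @vline_dim_out _ (U :&: right_line n z) (x1 *m z); case; first by dlia.
  move=> y /memv_capP[yU /right_lineP[x2 e]] h2; rewrite e in yU h2.
  exists x2 => //; apply: contra h2 => /vlineP[k ->].
  by rewrite -scalemxAl memvZ ?memv_line.
have x20 : x2 != 0 by apply: contraNneq x2x1 => ->; rewrite mem0v.
(* U contains a combination of x r0 and q0 z, with both coefficients nonzero. *)
have key x : x != 0 -> x *m z \in U -> exists s t, [/\ s != 0, t != 0 &
     s *: (x *m r0) + t *: (q0 *m z) \in U].
  move=> x0 xU.
  have [s [t [nz st]]] := codim1_combination (thin _ _ x0 z0 xU) (mem_left_cross x z r0) (mem_right_cross x z q0).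
  exists s, t; split=> //; apply/negP => /eqP e.
    have t0 := neq0_other nz e; move: st; rewrite e scale0r add0r rpredZeq (negPf t0) /=.
    by move/q0F/eqP; rewrite (negPf z0).
  have s0 : s != 0 by move: nz; rewrite e eqxx orbF.
  move: st; rewrite e scale0r addr0 rpredZeq (negPf s0) /=.
  by move/r0F/eqP; rewrite (negPf x0).
have [s1 [t1 [s10 t10 h1]]] := key _ x10 xzU.
have [s2 [t2 [s20 t20 h2]]] := key _ x20 x2zU.
have : (t2 * s1) *: x1 - (t1 * s2) *: x2 = 0.
  apply: r0F; rewrite mulmxBl -!scalemxAl -!scalerA.
  have -> : t2 *: (s1 *: (x1 *m r0)) - t1 *: (s2 *: (x2 *m r0)) =
     t2 *: (s1 *: (x1 *m r0) + t1 *: (q0 *m z)) - t1 *: (s2 *: (x2 *m r0) + t2 *: (q0 *m z)).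
    by rewrite !scalerDr !scalerA (mulrC t1 t2) opprD addrACA subrr addr0.
  by rewrite memvB // memvZ.
move/subr0_eq => e; case/negP: x2x1; apply/vlineP; exists ((t1 * s2)^-1 * (t2 * s1)).
by rewrite -scalerA e scalerA mulVf ?scale1r // mulf_neq0.
Qed.

Lemma col_parallel n (v w : 'cV[K]_n) :
  (forall z : 'rV_n, z *m v = 0 -> z *m w = 0) -> exists c, w = c *: v.
Proof.
move=> h; case: (eqVneq v 0) => [v0|/neq0_col_ex[v' v'v]].
  by exists 0; rewrite scale0r; apply: eq0_of_mull => z; apply: h; rewrite v0 mulmx0.
exists ((v' *m w) 0 0); rewrite -mul_col_scal.
apply/subr0_eq/eq0_of_mull => z; rewrite mulmxBr !mulmxA -mulmxBl.
by apply: h; rewrite mulmxBl -!mulmxA v'v mulmx1 subrr.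
Qed.

(** A subspace of codimension at most one contains the kernel of some nonzero
    linear form. *)
Lemma hyperplane_functional m (Z : {vspace 'rV[K]_m.+1}) : (m <= \dim Z)%N ->
  exists2 v : 'cV_m.+1, v != 0 & forall z, z *m v = 0 -> z \in Z.
Proof.
move=> dZ; have [|] := boolP (fullv <= Z)%VS.
  move=> /subvP full; exists (delta_mx 0 0); last by move=> z _; apply/full/memvf.
  by apply: delta_col_neq0.
case/subvPn => r _ rZ.
have r0 : r != 0 by apply: contraNneq rZ => ->; rewrite mem0v.
have rZ0 : (<[r]> :&: Z = 0)%VS.
  apply/eqP; rewrite -subv0; apply/subvP => v /memv_capP[/vlineP[k ->]].
  by rewrite rpredZeq (negPf rZ) orbF memv0 => /eqP ->; rewrite scale0r.
have full : (<[r]> + Z)%VS = fullv.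
  apply/eqP; rewrite eqEdim subvf dimv_disjoint_sum // dim_vline r0 dim_fullM mul1n.
  by rewrite add1n ltnS.
pose phi := daddv_pi <[r]> Z.
have [w rw] := neq0_row_ex r0.
have phiE z : z *m (lin1_mx phi *m w) = phi z *m w by rewrite mulmxA mul_rV_lin1.
exists (lin1_mx phi *m w).
  apply/eqP => e; have := phiE r; rewrite e mulmx0 daddv_pi_id ?memv_line // rw.
  by move/matrixP/(_ 0 0)/eqP; rewrite !mxE eqxx eq_sym oner_eq0.
move=> z; rewrite phiE => phiz.
have /vlineP[k ek] : phi z \in <[r]>%VS by apply: memv_pi.
have k0 : k = 0.
  move: phiz; rewrite ek -scalemxAl rw => /matrixP/(_ 0 0); rewrite !mxE eqxx.
  by rewrite mulr1.
have /daddv_pi_add := rZ0; move=> /(_ z); rewrite full memvf => /(_ isT).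
by rewrite -/phi ek k0 scale0r add0r => <-; apply: memv_pi.
Qed.

(** Invertible matrices act transitively on the nonzero columns. *)
Lemma unitmx_transitive m (v w : 'cV[K]_m.+1) : v != 0 -> w != 0 ->
  exists2 N : 'M[K]_m.+1, N \in unitmx & N *m v = w.
Proof.
move=> v0 w0.
have [C [v' [L [v'v v'C Lv LC e1]]]] := split_col v0.
have [D [w' [R [w'w w'D Rw RD e2]]]] := split_col w0.
exists (w *m v' + D *m L); last by rewrite mulmxDl -!mulmxA v'v Lv mulmx1 mulmx0 addr0.
apply: unitmx_of_ker => z; rewrite mulmxDl -!mulmxA => Nz.
have a : v' *m z = 0.
  have := congr1 (mulmx w') Nz.
  by rewrite mulmx0 mulmxDr (mulmxA w') w'w mul1mx (mulmxA w') w'D mul0mx addr0.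
have b : L *m z = 0.
  have := congr1 (mulmx R) Nz.
  by rewrite mulmx0 mulmxDr (mulmxA R) Rw mul0mx (mulmxA R) RD mul1mx add0r.
by rewrite -[z]mul1mx -e1 mulmxDl -!mulmxA a b !mulmx0 addr0.
Qed.

End Spreading.

(** * Affine spaces of singular matrices of maximal dimension *)

Section MaximalAffine.
Variable K : fieldType.

(** When U has the maximal dimension allowed by the dimension bound, its
    intersection with the cross of one of its rank-one matrices is large, since
    the compression obeys the bound as well. *)
Lemma thin_cross m (M0 : 'M[K]_m.+1) (U : {vspace 'M[K]_m.+1}) x z :
  singular_affine M0 U -> (m.+1 * m.+1 <= \dim U + m.+1)%N ->
  x != 0 -> z != 0 -> x *m z \in U ->
  (\dim (cross x z) <= (\dim (U :&: cross x z)).+1)%N.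
Proof.
move=> sing dU x0 z0 xzU.
have [L [R [_ _ _ sing' e]]] := compress_affine sing x0 z0 xzU.
have := singular_affine_dim sing'; rewrite dim_cross // => h; dnia.
Qed.

Lemma thin_hyperplane m (U : {vspace 'M[K]_m.+1}) (x : 'cV_m.+1) (z : 'rV_m.+1) :
  x != 0 -> (\dim (cross x z) <= (\dim (U :&: cross x z)).+1)%N ->
  exists v : 'cV_m.+1, v != 0 /\ forall z : 'rV_m.+1, z *m v = 0 -> x *m z \in U.
Proof.
move=> x0 thin.
have := codim1_sub (addvSl _ _ : (left_line m.+1 x <= cross x z)%VS) thin.
rewrite dim_left_line // => d1.
pose phi := lmul x (1%:M : 'M[K]_m.+1).
have d2 : (m <= \dim (phi @^-1: U))%N.
  have e : (U :&: left_line m.+1 x <= phi @: (phi @^-1: U))%VS.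
    apply/subvP => y /memv_capP[yU /left_lineP[r e]]; rewrite e; rewrite e in yU.
    have -> : x *m r = phi r by rewrite lmulE mulmx1.
    by rewrite memv_img // -memv_preim lmulE mulmx1.
  have := dimvS e; have := dim_limg_ub phi (phi @^-1: U); dlia.
have [v v0 vP] := hyperplane_functional d2; exists v; split=> // r /vP.
by rewrite -memv_preim lmulE mulmx1.
Qed.

(** The matrices whose i-th row is orthogonal to v i, for every i. *)
Lemma row_kernel m n (v : 'I_m -> 'cV[K]_n) (U : {vspace 'M[K]_(m, n)}) :
  (forall i (z : 'rV_n), z *m v i = 0 -> delta_mx i 0 *m z \in U) ->
  exists W : {vspace 'M[K]_(m, n)},
  [/\ forall M, M \in W <-> forall i, row i M *m v i = 0, (W <= U)%VS & (m * n <= \dim W + m)%N].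
Proof.
move=> vP; pose e_ (i : 'I_m) : 'cV[K]_m := delta_mx i 0.
pose phi : 'Hom('M[K]_(m, n), 'cV[K]_m) := \sum_i lmul (e_ i *m delta_mx 0 i) (v i).
have phiE M : phi M = \col_i (row i M *m v i) 0 0.
  apply/colP => k; rewrite /phi sum_lfunE summxE (bigD1 k) //= big1 => [|j jk].
    by rewrite addr0 lmulE -mulmxA -mulmxA (mulmxA (delta_mx 0 k)) -rowE mul_col_scal !mxE !eqxx mulr1.
  rewrite lmulE -mulmxA -mulmxA (mulmxA (delta_mx 0 j)) -rowE mul_col_scal !mxE.
  by rewrite eq_sym (negPf jk) mulr0.
have kerP M : M \in lker phi <-> forall i, row i M *m v i = 0.
  rewrite memv_ker phiE; split=> [/eqP/colP h i|h].
    have := h i; rewrite !mxE => e.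
    by rewrite [row i M *m _]mx11_scalar !mxE e raddf0.
  by apply/eqP/colP => i; rewrite mxE h !mxE.
exists (lker phi); split=> //.
  apply/subvP => M /kerP h; have -> : M = \sum_i e_ i *m row i M.
    apply/row_matrixP => k; rewrite linear_sum (bigD1 k) //= big1 => [|j jk].
      rewrite addr0 row_mul; apply/rowP => l; rewrite !mxE (bigD1 0) //= big1 ?addr0 => [|j].
        by rewrite !mxE !eqxx mul1r.
      by rewrite ord1.
    rewrite row_mul; apply/rowP => l; rewrite !mxE big1 // => o _.
    by rewrite !mxE eq_sym (negPf jk) mul0r.
  by apply: memv_suml => i _; apply: vP; exact: h.
by have := dim_lker_lb phi fullv; rewrite capfv !dim_fullM muln1.
Qed.

(** For each basis vector e_i, the rows z with e_i z in U contain a hyperplane;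
    hence U has codimension at most the number of rows. *)
Lemma spread_dim m (U : {vspace 'M[K]_m.+1}) :
  (forall x z, x != 0 -> z != 0 -> x *m z \in U ->
     (\dim (cross x z) <= (\dim (U :&: cross x z)).+1)%N) ->
  (forall x : 'cV_m.+1, x != 0 -> exists2 z : 'rV_m.+1, z != 0 & x *m z \in U) ->
  (m.+1 * m.+1 <= \dim U + m.+1)%N.
Proof.
move=> thin spread.
have e0 i : delta_mx i 0 != 0 :> 'cV[K]_m.+1.
  by apply: delta_col_neq0.
have hyp i : exists v : 'cV_m.+1, v != 0 /\ forall z : 'rV_m.+1, z *m v = 0 -> (delta_mx i 0 : 'cV_m.+1) *m z \in U.
  by have [z z0 xzU] := spread _ (e0 i); apply: (thin_hyperplane (e0 i) (thin _ _ (e0 i) z0 xzU)).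
have [v vP] := fin_all_exists hyp.
have [W [_ sub dW]] := row_kernel (fun i => proj2 (vP i)).
by have := dimvS sub; dlia.
Qed.

(** Equality case when every nonzero column is the image of a rank-one matrix of
    U: then U is the set of the matrices that annihilate some column v, and
    M0 v = 0. For each x, the rows z with x z in U contain a hyperplane, and
    additivity in x forces this hyperplane to be independent of x. *)
Lemma spread_kernel m (M0 : 'M[K]_m.+1) (U : {vspace 'M[K]_m.+1}) :
  singular_affine M0 U -> (m.+1 * m.+1 <= \dim U + m.+1)%N ->
  (forall x : 'cV_m.+1, x != 0 -> exists2 z : 'rV_m.+1, z != 0 & x *m z \in U) ->
  exists2 v : 'cV_m.+1, v != 0 & forall u, u \in U -> (M0 + u) *m v = 0.
Proof.
move=> sing dU spread.
have hyp (x : 'cV_m.+1) : x != 0 -> exists v : 'cV_m.+1, v != 0 /\ forall z : 'rV_m.+1, z *m v = 0 -> x *m z \in U.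
  by move=> x0; have [z z0 xzU] := spread x x0; apply: (thin_hyperplane x0 (thin_cross sing dU x0 z0 xzU)).
pose e_ (i : 'I_m.+1) : 'cV[K]_m.+1 := delta_mx i 0.
have e0 i : e_ i != 0 by apply: delta_col_neq0.
have [v vP] := fin_all_exists (fun i => hyp (e_ i) (e0 i)).
have [W [WP subU dW]] := row_kernel (fun i => proj2 (vP i)).
have {dW} eW : W = U by apply/eqP; rewrite eqEdim subU /=; have := singular_affine_dim sing; dlia.
have UP M : M \in U <-> forall i, row i M *m v i = 0 by rewrite -eW.
have prop i : exists c, v i = c *: v ord0.
  case: (eqVneq i ord0) => [->|i0]; first by exists 1; rewrite scale1r.
  have x0 : e_ ord0 + e_ i != 0.
    apply/eqP => /matrixP/(_ ord0 0)/eqP; rewrite !mxE !eqxx [ord0 == i]eq_sym (negPf i0) addr0.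
    by rewrite oner_eq0.
  have [w [w0 wP]] := hyp _ x0.
  (* Comparing the hyperplanes attached to e_0, e_i and e_0 + e_i. *)
  have rows (z : 'rV_m.+1) : z *m w = 0 -> z *m v ord0 = 0 /\ z *m v i = 0.
    move/wP/UP => h.
    have rE j : row j ((e_ ord0 + e_ i) *m z) = ((ord0 == j)%:R + (i == j)%:R) *: z.
      rewrite row_mul; apply/rowP => l; rewrite !mxE (bigD1 0) //= big1 ?addr0 => [|k].
        by rewrite !mxE !eqxx !andbT ![_ == j]eq_sym.
      by rewrite ord1.
    split; [have := h ord0 | have := h i]; rewrite rE eqxx.
      by rewrite (negPf i0) addr0 scale1r.
    by rewrite eq_sym (negPf i0) add0r scale1r.
  have [c1 e1] : exists c, v ord0 = c *: w by apply: col_parallel => z /rows[].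
  have [c2 e2] : exists c, v i = c *: w by apply: col_parallel => z /rows[].
  have c10 : c1 != 0 by have [+ _] := vP ord0; apply: contraNneq => c10; rewrite e1 c10 scale0r.
  by exists (c2 / c1); rewrite e1 scalerA divfK.
exists (v ord0); first by have [] := vP ord0.
have Uv u : (u *m v ord0 = 0) -> u \in U.
  move=> uv; apply/UP => i; have [c e] := prop i.
  by rewrite e -scalemxAr -row_mul uv row0 scaler0.
have vU u : u \in U -> u *m v ord0 = 0.
  move/UP => h; apply/row_matrixP => i; rewrite row_mul row0.
  have [c e] := prop i; have := h i; rewrite e -scalemxAr => /eqP.
  rewrite scaler_eq0 => /orP[/eqP c0|/eqP //].
  by have [] := vP i; rewrite e c0 scale0r eqxx.
move=> u uU; rewrite mulmxDl (vU u uU) addr0; apply/eqP/negPn/negP => w0.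
(* If u v = 0 for all u in U but M0 v <> 0, an invertible N with N v = M0 v lies in M0 + U. *)
have [N uN eN] := unitmx_transitive (proj1 (vP ord0)) w0.
have /sing : N - M0 \in U by apply: Uv; rewrite mulmxBl eN subrr.
by rewrite addrC subrK uN.
Qed.

(** Equality case of the dimension bound, for matrices of order at least three:
    all the elements of the affine space have a common right or left kernel vector. *)
Lemma singular_affine_max m (M0 : 'M[K]_m.+1) (U : {vspace 'M[K]_m.+1}) : (2 <= m)%N ->
  singular_affine M0 U -> (m.+1 * m.+1 <= \dim U + m.+1)%N ->
  (exists2 v : 'cV_m.+1, v != 0 & forall u, u \in U -> (M0 + u) *m v = 0) \/
  (exists2 y : 'rV_m.+1, y != 0 & forall u, u \in U -> y *m (M0 + u) = 0).
Proof.
move=> m2 sing dU.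
have [ex1|rk1F] := rank_one_or_none U.
  have m2' : (2 < m.+1)%N by [].
  case: (rank_one_spread m2' _ ex1) => [x z x0 z0 xzU|spr|spr].
  - exact: thin_cross sing dU x0 z0 xzU.
  - by left; apply: spread_kernel.
  - right; have sing' := singular_affine_tr sing.
    have dU' : (m.+1 * m.+1 <= \dim (trV U) + m.+1)%N by rewrite dim_trV.
    have [x x0|v v0 vP] := spread_kernel sing' dU'.
      have [w w0 wU] := spr x^T ltac:(by rewrite trmx_eq0); exists w^T; rewrite ?trmx_eq0 //.
      by rewrite mem_trV trmx_mul trmxK.
    exists v^T; rewrite ?trmx_eq0 // => u uU; apply: trmx_inj.
    rewrite trmx_mul trmxK trmx0 raddfD /=; apply: vP.
    by rewrite mem_trV trmxK.
(* Without rank-one matrix in U the compression at a vector is injective, and the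
   dimension bound in order m is exceeded. *)
exfalso.
have [u uU u0] : exists2 u, u \in U & M0 + u != 0.
  have [v vU v0] : exists2 v, v \in U & v != 0 by apply: vspace_nz; dnia.
  case: (eqVneq M0 0) => [->|M00]; first by exists v; rewrite ?add0r.
  by exists 0; rewrite ?mem0v ?addr0.
have [x ux] : exists x : 'cV_m.+1, (M0 + u) *m x != 0.
  apply: NNPP => h; case/eqP: u0; apply: trmx_inj; rewrite trmx0; apply: eq0_of_mull => z.
  apply: trmx_inj; rewrite trmx_mul trmxK trmx0; apply/eqP/negPn/negP => e.
  by apply: h; exists z^T.
have x0 : x != 0 by apply: contraNneq ux => ->; rewrite mulmx0.
have [L [R [_ _ LP [dec _] sing']]] := compress_vector (singular_affine_shift uU sing) x0 ux.
have := singular_affine_dim sing'; rewrite (dim_compress_vector rk1F LP dec).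
have := dim_lker_lb (lmul 1%:M x : 'Hom('M[K]_m.+1, 'cV_m.+1)) U.
rewrite dim_fullM muln1 -/(annv m.+1 x); dnia.
Qed.

End MaximalAffine.

(** * Spaces of rank-one matrices; matrices of order two *)

Section RankOne.
Variable K : fieldType.

(** M has rank at most one. *)
Definition rk1 m n (M : 'M[K]_(m, n)) := exists a : 'cV[K]_m, exists r : 'rV[K]_n, M = a *m r.

(** A linear form separating w from the line of v. *)
Lemma col_sep n (v w : 'cV[K]_n) : ~ (exists c, w = c *: v) ->
  exists2 z : 'rV_n, z *m v = 0 & z *m w = 1%:M.
Proof.
move=> h; apply: NNPP => k; apply: h; apply: col_parallel => z zv.
apply/eqP/negPn/negP => zw; apply: k.
have zw0 : (z *m w) 0 0 != 0.
  by apply: contra zw => /eqP e; rewrite [z *m w]mx11_scalar e raddf0.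
exists (((z *m w) 0 0)^-1 *: z); rewrite -scalemxAl ?zv ?scaler0 //.
by rewrite {2}[z *m w]mx11_scalar scale_scalar_mx mulVf.
Qed.

(** If a r + c s has rank at most one, then the two columns or the two rows are
    proportional; the middle cases are those where a proportionality is degenerate. *)
Lemma rk1_sum m n (a c : 'cV[K]_m) (r s : 'rV[K]_n) : rk1 (a *m r + c *m s) ->
  [\/ exists k, c = k *: a, a = 0, s = 0 | exists k, r = k *: s].
Proof.
case=> d [t e].
have [?|nca] := classic (exists k, c = k *: a); first by constructor 1.
have [z za zc] := col_sep nca.
have es : s = (z *m d) 0 0 *: t.
  have := congr1 (mulmx z) e.
  by rewrite mulmxDr !mulmxA za zc mul0mx add0r mul1mx mul_scal_row.
case: (eqVneq s 0) => [s0|s0]; first by constructor 3.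
case: (eqVneq a 0) => [a0|a0]; first by constructor 2.
constructor 4.
set k := (z *m d) 0 0 in es.
have k0 : k != 0 by apply: contraNneq s0 => k0; rewrite es k0 scale0r.
have et : t = k^-1 *: s by rewrite es scalerA mulVf ?scale1r.
have [a' a'a] := neq0_col_ex a0.
exists ((a' *m (k^-1 *: d - c)) 0 0).
rewrite -mul_scal_row -mulmxA mulmxBl -scalemxAl scalemxAr -et.
by rewrite -e addrK mulmxA a'a mul1mx.
Qed.

(** The matrices of a space of matrices of rank at most one have a common image
    line or a common kernel hyperplane. *)
Lemma rk1_space m n (W : {vspace 'M[K]_(m, n)}) : (forall M, M \in W -> rk1 M) ->
  (exists a : 'cV_m, forall M, M \in W -> exists r, M = a *m r) \/
  (exists b : 'rV_n, forall M, M \in W -> exists c, M = c *m b).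
Proof.
move=> rk.
have [W0|] := classic (forall M, M \in W -> M = 0).
  by left; exists 0 => M /W0 ->; exists 0; rewrite mul0mx.
move=> h; have [M1 h1] := not_all_ex_not _ _ h; have [M1W M10] := imply_to_and _ _ h1.
have [a [r e1]] := rk _ M1W.
have a0 : a != 0 by apply/eqP => a0; apply: M10; rewrite e1 a0 mul0mx.
have r0 : r != 0 by apply/eqP => r0; apply: M10; rewrite e1 r0 mulmx0.
have [|] := classic (forall M, M \in W -> exists r, M = a *m r); first by left; exists a.
move=> {}h; have [M2 h2] := not_all_ex_not _ _ h; have [M2W M20] := imply_to_and _ _ h2.
have [c [s e2]] := rk _ M2W.
have nca : ~ exists k, c = k *: a.
  by case=> k ek; apply: M20; exists (k *: s); rewrite e2 ek -scalemxAl scalemxAr.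
have s0 : s <> 0 by move=> s0; apply: M20; exists 0; rewrite e2 s0 !mulmx0.
have [k ek] : exists k, r = k *: s.
  have s12 : rk1 (a *m r + c *m s) by rewrite -e1 -e2; apply/rk/memvD.
  by case: (rk1_sum s12) => // a00; rewrite a00 eqxx in a0.
right; exists s.
have {}M1W : a *m r \in W by rewrite -e1.
have {}M2W : c *m s \in W by rewrite -e2.
have k0 : k != 0 by apply: contraNneq r0 => k0; rewrite ek k0 scale0r.
move=> M MW; have [d [t e]] := rk _ MW.
case: (eqVneq d 0) => [d0|d0]; first by exists 0; rewrite e d0 !mul0mx.
case: (eqVneq t 0) => [t0|t0]; first by exists 0; rewrite e t0 mul0mx mulmx0.
have par (k' : K) : s = k' *: t -> exists c, M = c *m s.
  move=> es; have k'0 : k' != 0 by apply/eqP => k'0; apply: s0; rewrite es k'0 scale0r.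
  by exists (k'^-1 *: d); rewrite e es -scalemxAl -scalemxAr scalerA mulVf ?scale1r.
have s1 : rk1 (a *m r + d *m t) by rewrite -e; apply/rk/memvD.
have s2 : rk1 (c *m s + d *m t) by rewrite -e; apply/rk/memvD.
case: (rk1_sum s2) => [[k2 e2']|c0|t0'|[k2 e2']]; last by apply: par e2'.
- case: (rk1_sum s1) => [[k3 e3]|a0'|t0'|[k3 e3]].
  + case: nca; exists (k2^-1 * k3); rewrite -scalerA -e3 e2' scalerA mulVf ?scale1r //.
    by apply: contraNneq d0 => k20; rewrite e2' k20 scale0r.
  + by rewrite a0' eqxx in a0.
  + by rewrite t0' eqxx in t0.
  + by apply: (par (k^-1 * k3)); rewrite -scalerA -e3 ek scalerA mulVf ?scale1r.
- by case: nca; exists 0; rewrite c0 scale0r.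
- by rewrite t0' eqxx in t0.
Qed.

Lemma det2 (M : 'M[K]_2) :
  \det M = M ord0 ord0 * M ord_max ord_max - M ord0 ord_max * M ord_max ord0.
Proof.
rewrite (expand_det_row _ ord0) !big_ord_recl big_ord0 addr0 /cofactor !det_mx11 !mxE.
rewrite /= expr0 expr1 mul1r mulN1r mulrN; congr (_ * _ - _ * _).
- by congr (M _ _); apply: val_inj.
- by congr (M _ _); apply: val_inj.
- by congr (M _ _); apply: val_inj.
Qed.

Lemma rk1_of_ker m (M : 'M[K]_(m, 2)) (w : 'cV_2) : w != 0 -> M *m w = 0 -> rk1 M.
Proof.
move=> w0 Mw; have [C [w' [L [_ _ _ _ e]]]] := split_col w0.
exists (M *m C), L; rewrite -[M in LHS]mulmx1 -e mulmxDr mulmxA Mw mul0mx add0r.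
by rewrite mulmxA.
Qed.

Lemma nonunit_rk1 (M : 'M[K]_2) : M \notin unitmx -> rk1 M.
Proof. by case/ker_of_nonunit => w; apply: rk1_of_ker. Qed.

(** A linear space of singular 2 x 2 matrices has a common right or left kernel
    vector, over any field. *)
Lemma singular2 (W : {vspace 'M[K]_2}) : (forall M, M \in W -> M \notin unitmx) ->
  (exists2 v : 'cV_2, v != 0 & forall M, M \in W -> M *m v = 0) \/
  (exists2 y : 'rV_2, y != 0 & forall M, M \in W -> y *m M = 0).
Proof.
move=> sing; case: (rk1_space (fun M MW => nonunit_rk1 (sing M MW))) => [[a aP]|[b bP]].
  right; have [y y0 ya] := tall_kernel a (isT : 1 < 2)%N; exists y => // M /aP[r ->].
  by rewrite mulmxA ya mul0mx.
left; have [y y0 yb] := wide_kernel b (isT : 1 < 2)%N; exists y => // M /bP[r ->].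
by rewrite -mulmxA yb mulmx0.
Qed.

Lemma unit2 (M : 'M[K]_2) : (M \in unitmx) = (\det M != 0).
Proof. by rewrite unitmxE unitfE. Qed.

(** In order two the conclusion holds without a dimension hypothesis, but fails
    over the field with two elements. With a third element a, the determinant,
    which has degree two on each line of the affine space, vanishes on the linear
    span of this space. *)
Lemma singular_affine_max2 (M0 : 'M[K]_2) (U : {vspace 'M[K]_2}) (a : K) : a != 0 -> a != 1 ->
  singular_affine M0 U ->
  (exists2 v : 'cV_2, v != 0 & forall u, u \in U -> (M0 + u) *m v = 0) \/
  (exists2 y : 'rV_2, y != 0 & forall u, u \in U -> y *m (M0 + u) = 0).
Proof.
move=> a0 a1 sing.
have d0 u : u \in U -> \det (M0 + u) = 0.
  by move/sing; rewrite unit2 negbK => /eqP.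
have dM : \det M0 = 0 by rewrite -(d0 0) ?mem0v ?addr0.
(* The values of the determinant at M0, M0 + u and M0 + a u determine its three
   coefficients on the line through M0. *)
have span s u : u \in U -> \det (s *: M0 + u) = 0.
  move=> uU.
  have h1 := d0 u uU; have h2 := d0 (a *: u) (memvZ a uU).
  move: dM h1 h2; rewrite !det2 !mxE.
  set x := M0 _ _; set y := M0 _ _; set z := M0 _ _; set t := M0 _ _.
  set x' := u _ _; set y' := u _ _; set z' := u _ _; set t' := u _ _.
  move=> e0 e1 e2.
  have q0 : x' * y' - z' * t' = 0.
    apply: (mulfI (_ : a * (a - 1) != 0)); first by rewrite mulf_neq0 // subr_eq0.
    rewrite mulr0 -[RHS](_ : 0 - a * 0 + (a - 1) * 0 = 0); last by ring.
    by rewrite -{1}e2 -{1}e1 -e0; ring.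
  have b0 : x * y' + x' * y - z * t' - z' * t = 0.
    rewrite -[RHS](_ : 0 - 0 - 0 = 0); last by ring.
    by rewrite -{1}e1 -{1}e0 -{1}q0; ring.
  have -> : (s * x + x') * (s * y + y') - (s * z + z') * (s * t + t') =
     s ^+ 2 * (x * y - z * t) + s * (x * y' + x' * y - z * t' - z' * t) + (x' * y' - z' * t') by ring.
  by rewrite e0 b0 q0 !mulr0 !addr0.
have sing' M : M \in (<[M0]> + U)%VS -> M \notin unitmx.
  by case/memv_addP => _ /vlineP[s ->] [u uU ->]; rewrite unit2 span // eqxx.
have mem u : u \in U -> M0 + u \in (<[M0]> + U)%VS.
  by move=> uU; rewrite memv_add ?memv_line.
by case: (singular2 sing') => [[v v0 h]|[v v0 h]]; [left|right]; exists v => // u /mem/h.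
Qed.

End RankOne.

(** * Singular linear spaces; the case of order three *)

Section Order3.
Variable K : fieldType.

(** W consists of singular matrices. *)
Definition singular_space n (W : {vspace 'M[K]_n}) := forall M, M \in W -> M \notin unitmx.

(** The matrices of W annihilate a common nonzero column. *)
Definition has_kernel n (W : {vspace 'M[K]_n}) :=
  exists2 v : 'cV_n, v != 0 & forall M, M \in W -> M *m v = 0.

(** The matrices of W send some nonzero column v into a common line, possibly to
    zero. *)
Definition has_line n (W : {vspace 'M[K]_n}) :=
  exists v : 'cV_n, exists e : 'cV_n, v != 0 /\ forall M, M \in W -> exists a, M *m v = a *: e.

Lemma has_kernel_line n (W : {vspace 'M[K]_n}) : has_kernel W -> has_line W.
Proof.
by case=> v v0 h; exists v, 0; split=> // M /h ->; exists 0; rewrite scale0r.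
Qed.

Lemma trVK m n (W : {vspace 'M[K]_(m, n)}) : trV (trV W) = W.
Proof. by apply/vspaceP => M; rewrite !mem_trV trmxK. Qed.

Lemma singular_space_tr n (W : {vspace 'M[K]_n}) : singular_space W -> singular_space (trV W).
Proof. by move=> sing M; rewrite mem_trV => /sing; rewrite unitmx_tr. Qed.

Lemma singular_space_affine n (W : {vspace 'M[K]_n}) M0 :
  singular_space W -> M0 \in W -> singular_affine M0 W.
Proof. by move=> sing M0W u uW; apply/sing/memvD. Qed.

Lemma singular_affine0 n (W : {vspace 'M[K]_n}) : singular_affine 0 W -> singular_space W.
Proof. by move=> sing M /sing; rewrite add0r. Qed.

Lemma free_left m n p (B : 'M[K]_(n, p)) (y : 'M[K]_(m, n)) : row_free B -> y *m B = 0 -> y = 0.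
Proof. by move=> fB e; apply/eqP; rewrite -(mulmx_free_eq0 _ fB) e. Qed.

Lemma free_right m n p (B : 'M[K]_(n, p)) (y : 'M[K]_(p, m)) : row_free B^T -> B *m y = 0 -> y = 0.
Proof.
move=> fB e; apply: trmx_inj; rewrite trmx0; apply: (free_left fB).
by rewrite -trmx_mul e trmx0.
Qed.

(** A common left kernel vector of W is a common right kernel vector of the
    transposed space. *)
Lemma has_kernel_trV n (W : {vspace 'M[K]_n}) :
  (exists2 y : 'rV_n, y != 0 & forall M, M \in W -> y *m M = 0) -> has_kernel (trV W).
Proof.
case=> y y0 h; exists y^T; rewrite ?trmx_eq0 // => M; rewrite mem_trV => /h e.
by apply: trmx_inj; rewrite trmx_mul trmxK trmx0.
Qed.

Section Lift.
Variables (k : nat) (W : {vspace 'M[K]_k.+1}) (x : 'cV[K]_k.+1) (z : 'rV[K]_k.+1).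
Variables (L : 'M[K]_(k, k.+1)) (R : 'M[K]_(k.+1, k)).
Hypothesis LP : ker_line L x.
Hypothesis RP : forall p (w : 'M_(p, k.+1)), w *m R = 0 -> exists q, w = q *m z.
Hypothesis fL : row_free L.
Hypothesis fR : row_free R^T.

Lemma lift_mem M : M \in W -> L *m M *m R \in (lmul L R @: W)%VS.
Proof. by move=> MW; rewrite -lmulE memv_img. Qed.

(** A kernel vector of the compression along x z lifts to a vector with images in
    the line of x. *)
Lemma lift_kernel : has_kernel (lmul L R @: W) -> has_line W.
Proof.
case=> v v0 h; exists (R *m v), x; split=> [|M MW].
  by apply: contraNneq v0 => /(free_right fR) ->.
have [r ->] : exists r, M *m (R *m v) = x *m r.
  by apply: LP; rewrite !mulmxA; apply: h; apply: lift_mem.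
by exists (r 0 0); rewrite mul_col_scal.
Qed.

Lemma lift_kernel_tr : has_kernel (trV (lmul L R @: W)) -> has_line (trV W).
Proof.
case=> y y0 h; exists (y^T *m L)^T, z^T; split=> [|M].
  by rewrite trmx_eq0; apply: contraNneq y0 => /(free_left fL) /eqP; rewrite trmx_eq0 => /eqP ->.
rewrite mem_trV => MW.
have [q e] : exists q, y^T *m L *m M^T = q *m z.
  apply: RP; apply: trmx_inj; rewrite trmx0 -(mulmxA y^T L) -(mulmxA y^T) trmx_mul trmxK.
  by apply: h; rewrite mem_trV trmxK; apply: lift_mem.
by exists (q 0 0); apply: trmx_inj; rewrite trmx_mul trmxK e linearZ /= trmxK mul_scal_row.
Qed.

(** A vector sent into a line by the compression along x z lifts to a vector sent
    into a plane. *)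
Lemma lift_line : has_line (lmul L R @: W) ->
  exists2 u : 'cV_k.+1, u != 0 & exists e1 e2, forall M, M \in W -> exists c d, M *m u = c *: e1 + d *: e2.
Proof.
case=> v [e [v0 h]]; exists (R *m v).
  by apply: contraNneq v0 => /(free_right fR) ->.
have /row_freeP[C LC] := fL.
exists x, (C *m e) => M MW; have [a ea] := h _ (lift_mem MW).
have [r er] : exists r, M *m (R *m v) - a *: (C *m e) = x *m r.
  by apply: LP; rewrite mulmxBr !mulmxA ea -scalemxAr mulmxA LC mul1mx subrr.
exists (r 0 0), a; rewrite -mul_col_scal -er subrK //.
Qed.

Lemma lift_line_tr : has_line (trV (lmul L R @: W)) ->
  exists2 u : 'cV_k.+1, u != 0 & exists e1 e2, forall M, M \in trV W -> exists c d, M *m u = c *: e1 + d *: e2.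
Proof.
case=> y [e [y0 h]]; exists (y^T *m L)^T.
  by rewrite trmx_eq0; apply: contraNneq y0 => /(free_left fL) /eqP; rewrite trmx_eq0 => /eqP ->.
have /row_freeP[D RD] := fR.
exists z^T, (e^T *m D^T)^T => M; rewrite mem_trV => MW.
have [a ea] := h (L *m M^T *m R)^T ltac:(by rewrite mem_trV trmxK; apply: lift_mem).
have [q eq] : exists q, y^T *m L *m M^T - a *: (e^T *m D^T) = q *m z.
  apply: RP; rewrite mulmxBl -scalemxAl -(mulmxA e^T).
  have -> : D^T *m R = 1%:M by apply: trmx_inj; rewrite trmx_mul trmxK trmx1.
  rewrite mulmx1; apply: trmx_inj; rewrite trmx0 raddfB /= linearZ /= trmxK.
  by rewrite -(mulmxA y^T L) -(mulmxA y^T) trmx_mul trmxK ea subrr.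
exists (q 0 0), a; apply: trmx_inj.
by rewrite trmx_mul trmxK raddfD /= !linearZ /= !trmxK -mul_scal_row -eq subrK.
Qed.

End Lift.

(** A rank-one matrix of W compresses W to a space of singular 2 x 2 matrices,
    whose common kernel lifts to a vector with images in a line. *)
Lemma rank_one_line3 (W : {vspace 'M[K]_3}) (x : 'cV_3) (z : 'rV_3) : singular_space W ->
  x != 0 -> z != 0 -> x *m z \in W -> has_line W \/ has_line (trV W).
Proof.
move=> sing x0 z0 xzW.
have [L [R [LP RP [fL fR] sing' _]]] := compress_affine (singular_space_affine sing (mem0v W)) x0 z0 xzW.
rewrite mulmx0 mul0mx in sing'.
case: (singular2 (singular_affine0 sing')) => [h|/has_kernel_trV h]; [left|right].
  exact: lift_kernel LP fR h.
exact: lift_kernel_tr RP fL h.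
Qed.

(** The determinant of order two is a quadratic form; when it vanishes at N0,
    N0 + N, N0 + N' and N0 + N + N', its polar form vanishes at N, N'. *)
Lemma det2_additive (N0 N N' : 'M[K]_2) : \det N0 = 0 -> \det (N0 + N) = 0 ->
  \det (N0 + N') = 0 -> \det (N0 + (N + N')) = 0 -> \det (N + N') = \det N + \det N'.
Proof.
move=> e0 e1 e2 e3.
have : \det (N0 + (N + N')) - \det (N0 + N) - \det (N0 + N') + \det N0 = \det (N + N') - \det N - \det N'.
  by rewrite !det2 !mxE; ring.
rewrite e0 e1 e2 e3 !subr0 add0r => /esym/eqP; rewrite subr_eq add0r subr_eq => /eqP ->.
by rewrite addrC.
Qed.

(** For order three and no rank-one matrix in W. The compression of W at x has
    dimension two for every target line e. Over a field with more than two
    elements the equality case of order two applies to a well chosen e; over the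
    field with two elements, one uses instead that the determinant is additive on
    the compressed spaces. *)
Lemma no_rank_one3 (W : {vspace 'M[K]_3}) : singular_space W -> (5 <= \dim W)%N ->
  (forall (x : 'cV_3) (z : 'rV_3), x *m z \in W -> x *m z = 0) -> has_line W.
Proof.
move=> sing dW rkF; apply: NNPP => nline.
pose x : 'cV[K]_3 := delta_mx 0 0.
have x0 : x != 0 by apply: delta_col_neq0.
have ex0 : exists M, M \in W /\ M *m x != 0.
  apply: NNPP => h; apply: nline; exists x, 0; split=> // M MW; exists 0; rewrite scale0r.
  by apply/eqP/negPn/negP => e; apply: h; exists M.
pose Wx := (W :&: annv 3 x)%VS.
have WxP M : M \in Wx -> M \in W /\ M *m x = 0 by case/memv_capP => ?; rewrite mem_annv => /eqP.
have [M0 [M0W M0x]] := ex0.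
have dWx : \dim Wx = 2%N /\ (lmul 1%:M x @: W)%VS = fullv.
  have [L [R [_ _ LP [dec _] sing']]] := @compress_vector K 2 M0 W x (singular_space_affine sing M0W) x0 M0x.
  have := singular_affine_dim sing'; rewrite (dim_compress_vector rkF LP dec) => h1.
  have h2 := limg_ker_dim (lmul 1%:M x : 'Hom('M[K]_3, 'cV[K]_3)) W.
  rewrite -/(annv 3 x) -/Wx in h2.
  have h3 := dimvS (subvf (lmul 1%:M x @: W)%VS); rewrite dim_fullM in h3.
  split; first by dlia.
  by apply/eqP; rewrite eqEdim subvf dim_fullM; dlia.
have [dWx2 full] := dWx.
have data (e : 'cV_3) : e != 0 -> exists L : 'M_(2, 3), exists R : 'M_(3, 2), exists N0,
   [/\ L *m e = 0 /\ row_free L,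
      ker_line L e,
      (forall w : 'cV_3, exists s, exists t, w = s *: x + R *m t),
      (forall s t, s *: x + R *m t = 0 -> s = 0 /\ t = 0) &
      singular_affine N0 (lmul L R @: Wx)%VS].
  move=> e0; have : e \in (lmul 1%:M x @: W)%VS by rewrite full memvf.
  case/memv_imgP => M MW; rewrite lmulE mul1mx => eM.
  have Mx0 : M *m x != 0 by rewrite -eM.
  have [L [R [[fL _] Le LP [dec inj] sing']]] := @compress_vector K 2 M W x (singular_space_affine sing MW) x0 Mx0.
  by exists L, R, (L *m M *m R); rewrite eM; split.
(* A nonzero element of Wx has rank two, so its kernel is the line of x. *)
have kx M w : M \in Wx -> M != 0 -> M *m w = 0 -> w \in <[x]>%VS.
  move=> /WxP[MW Mx] M00 Mw; have [C [x' [L [_ _ Lx LC e]]]] := split_col x0.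
  have eM : M = M *m C *m L by rewrite -[LHS]mulmx1 -e mulmxDr mulmxA Mx mul0mx add0r mulmxA.
  have [Lw|Lw] := eqVneq (L *m w) 0.
    apply/vlineP; exists ((x' *m w) 0 0).
    by rewrite -mul_col_scal mulmxA -[LHS]mul1mx -e mulmxDl -(mulmxA C) Lw mulmx0 addr0.
  have [|a [r er]] := rk1_of_ker (M := M *m C) Lw; first by rewrite mulmxA -eM.
  case/eqP: M00; rewrite eM er -mulmxA; apply: rkF.
  by rewrite mulmxA -er -eM.
have nonunit_ex (L : 'M_(2, 3)) (R : 'M_(3, 2)) (e : 'cV_3) M (t : 'cV_2) : t != 0 -> L *m M *m R *m t = 0 ->
   ker_line L e ->
   (forall s t, s *: x + R *m t = 0 -> s = 0 /\ t = 0) ->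
   exists k, M *m (R *m t) = k *: e /\ R *m t \notin <[x]>%VS.
  move=> t0 Nt LP inj; have [z ez] : exists z, M *m (R *m t) = e *m z.
    by apply: LP; rewrite !mulmxA.
  exists (z 0 0); rewrite ez mul_col_scal; split=> //.
  apply/negP => /vlineP[c ec]; case/eqP: t0.
  by have [] := inj (- c) t; rewrite // ec scaleNr addNr.
have is_unit M (y : 'rV_3) (e : 'cV_3) (L : 'M_(2, 3)) (R : 'M_(3, 2)) : M \in Wx -> M != 0 -> y *m M = 0 -> y *m e = 1%:M ->
   ker_line L e ->
   (forall s t, s *: x + R *m t = 0 -> s = 0 /\ t = 0) ->
   L *m M *m R \in unitmx.
  move=> MW M00 yM ye LP inj; apply/negPn/negP => /ker_of_nonunit[t t0 Nt].
  have [k [ek nx]] := nonunit_ex _ _ _ _ _ t0 Nt LP inj.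
  have k0 : k = 0.
    have := congr1 (mulmx y) ek; rewrite (mulmxA y M) yM mul0mx -scalemxAr ye.
    by move/matrixP/(_ 0 0); rewrite !mxE eqxx mulr1.
  by case/negP: nx; apply: (kx M) => //; rewrite ek k0 scale0r.
have [M MW M00] : exists2 M, M \in Wx & M != 0 by apply: vspace_nz; rewrite dWx2.
have [[a [a0 a1]]|K2] := classic (exists a : K, a != 0 /\ a != 1).
  (* Choose e outside the image of M: then the compression of M is invertible,
     against the common kernel vector. *)
  have [w w0 Mw] : exists2 w : 'cV_3, w != 0 & M^T *m w = 0.
    by apply: ker_of_nonunit; rewrite unitmx_tr; apply: sing; case: (WxP _ MW).
  have [e ye] : exists e, w^T *m e = 1%:M by apply: neq0_row_ex; rewrite trmx_eq0.
  have e0 : e != 0 := neq0_of_mulr1 ye.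
  have [L [R [N0 [_ LP dec inj sing']]]] := data e e0.
  have yM : w^T *m M = 0 by apply: trmx_inj; rewrite trmx_mul trmxK Mw trmx0.
  have uN := is_unit _ _ _ _ _ MW M00 yM ye LP inj.
  have NW : L *m M *m R \in (lmul L R @: Wx)%VS by rewrite -lmulE memv_img.
  case: (singular_affine_max2 a0 a1 sing') => [[v v0 h]|[v v0 h]].
    have := h _ NW; have := h _ (mem0v _); rewrite addr0 mulmxDl => ->; rewrite add0r => e1.
    by case/eqP: v0; apply: unitmx_ker0 uN e1.
  have := h _ NW; have := h _ (mem0v _); rewrite addr0 mulmxDr => ->; rewrite add0r => e1.
  by case/eqP: v0; rewrite -(mulmxK uN v) e1 mul0mx.
have F2 (a : K) : a != 0 -> a = 1.
  by move=> a0; apply/eqP/negPn/negP => a1; apply: K2; exists a.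
have [M' M'W M'M] : exists2 y, y \in Wx & y \notin <[M]>%VS by apply: vline_dim_out; rewrite dWx2.
have M'00 : M' != 0 by apply: contraNneq M'M => ->; rewrite mem0v.
have comb k1 k2 : k2 != 0 -> k1 *: M + k2 *: M' != 0.
  move=> k20; apply: contra M'M; rewrite addrC addr_eq0 => /eqP e; apply/vlineP.
  by exists (- (k2^-1 * k1)); rewrite scaleNr -scalerA -scalerN -e scalerA mulVf ?scale1r.
have MM'0 : M + M' != 0 by have := comb 1 1 (oner_neq0 _); rewrite !scale1r.
have [C [x' [Lx [_ _ Lx0 LC _]]]] := split_col x0.
have [t t0 et] := wide_kernel (row_mx (M *m C) (M' *m C)) (isT : (3 < 2 + 2)%N).
rewrite -(vsubmxK t) mul_row_col in et; set s1 := usubmx t in et; set s2 := dsubmx t in et.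
have CK M1 (s : 'cV_2) : M1 \in Wx -> M1 != 0 -> M1 *m C *m s = 0 -> s = 0.
  move=> h1 h2; rewrite -mulmxA => /(kx _ _ h1 h2)/vlineP[c ec].
  by rewrite -[s]mul1mx -LC -mulmxA ec -scalemxAr Lx0 scaler0.
(* The images of M and M' are planes of a space of dimension three; e is a nonzero
   common vector of the two. *)
pose e := M *m C *m s1.
have e0 : e != 0.
  apply/eqP => e0; case/eqP: t0; rewrite -(vsubmxK t) -/s1 -/s2.
  rewrite (CK M s1) //; move: et; rewrite -/e e0 add0r => /(CK M' _ M'W M'00) ->.
  by rewrite col_mx0.
have [L [R [N0 [[Le fL] LP dec inj sing']]]] := data e e0.
(* The determinant is additive on each compressed space. *)
have addN (L1 : 'M_(2, 3)) (R1 : 'M_(3, 2)) N1 : singular_affine N1 (lmul L1 R1 @: Wx)%VS ->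
    \det (L1 *m (M + M') *m R1) = \det (L1 *m M *m R1) + \det (L1 *m M' *m R1).
  move=> sg; have d0 Q : Q \in Wx -> \det (N1 + L1 *m Q *m R1) = 0.
    move=> QW; have := sg _ (memv_img (lmul L1 R1) QW); by rewrite lmulE unit2 negbK => /eqP.
  rewrite mulmxDr mulmxDl; apply: (@det2_additive N1); rewrite -?mulmxDl -?mulmxDr ?d0 ?memvD //.
  by have := d0 0 (mem0v _); rewrite mulmx0 mul0mx addr0.
have sgN Q (s : 'cV_2) k : Q \in Wx -> Q *m (C *m s) = k *: e -> k != 0 -> L *m Q *m R \notin unitmx.
  move=> QW eQ k0; have [c [u eu]] := dec (C *m s).
  have Qx : Q *m x = 0 by case: (WxP _ QW).
  have eQ' : Q *m (R *m u) = k *: e.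
    by rewrite -eQ eu mulmxDr -scalemxAr Qx scaler0 add0r.
  apply: (@nonunit_of_ker _ _ _ u).
    apply/eqP => u0; move: eQ'; rewrite u0 !mulmx0 => /esym/eqP.
    by rewrite scaler_eq0 (negPf k0) (negPf e0).
  by rewrite -!mulmxA eQ' -scalemxAr Le scaler0.
have sN : L *m M *m R \notin unitmx.
  by apply: (sgN _ s1 1) => //; rewrite ?oner_neq0 // scale1r mulmxA.
have sN' : L *m M' *m R \notin unitmx.
  apply: (sgN _ s2 (-1)) => //; rewrite ?oppr_eq0 ?oner_neq0 // scaleN1r mulmxA.
  by move/eqP: et; rewrite addrC addr_eq0 => /eqP.
have sNN' : L *m M *m R + L *m M' *m R \notin unitmx.
  rewrite -mulmxDl -mulmxDr unit2 negbK (addN _ _ _ sing').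
  by move: sN sN'; rewrite !unit2 !negbK => /eqP -> /eqP ->; rewrite addr0.
have [a [r ea]] := nonunit_rk1 sN; have [c [s ec]] := nonunit_rk1 sN'.
have LMR0 Q : Q \in Wx -> L *m Q *m R = 0 -> Q = 0.
  move=> /WxP[QW Qx] LQR.
  by have [z ez] := compress_vector_ker LP dec Qx LQR; rewrite ez; apply: rkF; rewrite -ez.
have := nonunit_rk1 sNN'; rewrite ea ec => /rk1_sum[[k ek]|a00|s00|[k ek]].
- have [y y0 ya] := tall_kernel a (isT : 1 < 2)%N.
  have yk Q b u : Q \in Wx -> L *m Q *m R = (b *: a) *m u -> y *m L *m Q = 0.
    move=> /WxP[QW Qx] eQ; apply: eq0_of_mulr => v; have [c' [t' ->]] := dec v.
    rewrite mulmxDr -scalemxAr -(mulmxA _ Q x) Qx mulmx0 scaler0 add0r.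
    by rewrite !mulmxA -(mulmxA y L) -(mulmxA y (L *m Q)) eQ -scalemxAl -scalemxAr mulmxA ya mul0mx scaler0 mul0mx.
  have yM : y *m L *m M = 0 by apply: (yk M 1 r); rewrite // scale1r.
  have yM' : y *m L *m M' = 0 by apply: (yk M' k s); rewrite // -ek.
  have yL0 : y *m L != 0 by apply: contraNneq y0 => /(free_left fL) ->.
  have [f yf] := neq0_row_ex yL0.
  have f0 : f != 0 := neq0_of_mulr1 yf.
  have [L1 [R1 [N1 [_ LP1 dec1 inj1 sing1]]]] := data f f0.
  have u1 := is_unit _ _ _ _ _ MW M00 yM yf LP1 inj1.
  have u2 := is_unit _ _ _ _ _ M'W M'00 yM' yf LP1 inj1.
  have u3 : L1 *m (M + M') *m R1 \in unitmx.
    apply: (is_unit _ _ _ _ _ (memvD MW M'W) MM'0 _ yf LP1 inj1).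
    by rewrite mulmxDr yM yM' addr0.
  move: u1 u2 u3; rewrite !unit2 => /F2 u1 /F2 u2 /F2.
  by rewrite (addN _ _ _ sing1) u1 u2 -[RHS]addr0 => /addrI/eqP; rewrite oner_eq0.
- by case/eqP: M00; apply: LMR0; rewrite // ea a00 mul0mx.
- by case/eqP: M'00; apply: LMR0; rewrite // ec s00 mulmx0.
have [u u0 su] := wide_kernel s (isT : 1 < 2)%N.
have [k1 [e1 nx1]] := nonunit_ex L R e M u u0 ltac:(by rewrite ea ek -mulmxA -scalemxAl su scaler0 mulmx0) LP inj.
have [k2 [e2 _]] := nonunit_ex L R e M' u u0 ltac:(by rewrite ec -mulmxA su mulmx0) LP inj.
have k10 : k1 != 0.
  by apply: contraNneq nx1 => k10; apply: (kx M) => //; rewrite e1 k10 scale0r.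
case/negP: nx1; apply: (kx (k2 *: M + (- k1) *: M')).
- by rewrite memvD ?memvZ.
- by rewrite comb // oppr_eq0.
- by rewrite mulmxDl -!scalemxAl e1 e2 !scalerA -scalerDl mulNr mulrC subrr scale0r.
Qed.

Lemma line3 (W : {vspace 'M[K]_3}) : singular_space W -> (5 <= \dim W)%N ->
  has_line W \/ has_line (trV W).
Proof.
move=> sing dW.
have [[x [z [x0 z0 h]]]|nex] := rank_one_or_none W; first exact: rank_one_line3 h.
by left; apply: no_rank_one3.
Qed.

End Order3.

(** * Singular spaces without rank-one matrices *)

Section NoRankOne.
Variable K : fieldType.

(** The map M |-> B M A is onto when B and A have full rank. *)
Lemma dim_lker_lmul m n p q (B : 'M[K]_(q, m)) (A : 'M[K]_(n, p)) :
  row_free B -> row_free A^T -> (\dim (lker (lmul B A)) + q * p = m * n)%N.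
Proof.
case/row_freeP => B' BB' /row_freeP[A' AA'].
have := limg_ker_dim (lmul B A) fullv; rewrite capfv dim_fullM.
suff -> : limg (lmul B A) = fullv by rewrite dim_fullM.
apply/eqP; rewrite eqEsubv subvf /=; apply/subvP => N _.
have -> : N = lmul B A (B' *m N *m A'^T).
  rewrite lmulE !mulmxA BB' mul1mx -mulmxA.
  have -> : A'^T *m A = 1%:M by apply: trmx_inj; rewrite trmx_mul trmxK trmx1.
  by rewrite mulmx1.
by rewrite memv_img // memvf.
Qed.

(** Special spaces: the compression spaces {M | B M A = 0} with A and B of ranks
    p, q >= 2, p + q = n + 1, and one of the two ranks equal to 2. The last
    condition selects those of the largest dimension, n^2 - 2n + 2. *)
Definition special n (W : {vspace 'M[K]_n}) :=
  exists p q (A : 'M[K]_(n, p)) (B : 'M[K]_(q, n)),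
  [/\ row_free A^T /\ row_free B, (1 < p)%N, (1 < q)%N, (p + q = n.+1)%N /\ (p = 2%N \/ q = 2%N) &
      W = lker (lmul B A)].

Lemma special_tr n (W : {vspace 'M[K]_n}) : special W -> special (trV W).
Proof.
case=> p [q [A [B [[fA fB] p1 q1 [pq pq2] eW]]]].
exists q, p, B^T, A^T; split=> //; rewrite ?trmxK ?(addnC q) //; first by case: pq2; auto.
apply/vspaceP => M; rewrite mem_trV eW !memv_lker_lmul.
by rewrite -trmx_eq0 !trmx_mul trmxK !mulmxA.
Qed.

Lemma free_row_mx n (x y : 'cV[K]_n) : x != 0 -> y \notin <[x]>%VS -> row_free (row_mx x y)^T.
Proof.
move=> x0 yx; rewrite tr_row_mx -kermx_eq0; apply/eqP/row_matrixP => i; rewrite row0.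
set z := row i _; have : z *m col_mx x^T y^T = 0 by rewrite -row_mul mulmx_ker row0.
rewrite -(hsubmxK z) mul_row_col; set s := lsubmx z; set t := rsubmx z => e.
have {}e : s 0 0 *: x + t 0 0 *: y = 0.
  by apply: trmx_inj; rewrite trmx0 raddfD /= !linearZ /= -!mul_scal_row.
have t0 : t 0 0 = 0.
  apply/eqP/negPn/negP => t0; case/negP: yx; apply/vlineP; exists (- ((t 0 0)^-1 * s 0 0)).
  rewrite scaleNr -scalerA -scalerN; apply: (scalerI t0); rewrite scalerA mulfV // scale1r.
  by apply/eqP; rewrite -addr_eq0 addrC; apply/eqP.
have s0 : s 0 0 = 0.
  by move: e; rewrite t0 scale0r addr0 => /eqP; rewrite scaler_eq0 (negPf x0) orbF => /eqP.
by rewrite [s]mx11_scalar [t]mx11_scalar s0 t0 !raddf0 row_mx0.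
Qed.

(** The equality case of the dimension bound in order m: a singular affine space
    of dimension at least m^2 - m has a common right or left kernel vector. *)
Definition affine_kernel_property m := forall (N0 : 'M[K]_m) (U : {vspace 'M[K]_m}),
  singular_affine N0 U -> (m * m <= \dim U + m)%N ->
  (exists2 v : 'cV_m, v != 0 & forall u, u \in U -> (N0 + u) *m v = 0) \/
  (exists2 y : 'rV_m, y != 0 & forall u, u \in U -> y *m (N0 + u) = 0).

(** A large space of singular matrices of order at least four without rank-one
    matrix has a common kernel vector. *)
Lemma no_rank_one_kernel k (W : {vspace 'M[K]_k.+2}) : (2 <= k)%N ->
  singular_space W -> (k.+2 * k.+2 + 2 <= \dim W + k.+2.*2)%N ->
  (forall (x : 'cV_k.+2) (z : 'rV_k.+2), x *m z \in W -> x *m z = 0) -> has_kernel W.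
Proof.
move=> k2 sing large rkF; apply: NNPP => nker.
have k3 : (1 + 1 < k.+2)%N by rewrite addn1 !ltnS ltnW.
pose x : 'cV[K]_k.+2 := delta_mx 0 0.
have x0 : x != 0 by apply: delta_col_neq0.
have [M0 [M0W M0x]] : exists M, M \in W /\ M *m x != 0.
  apply: NNPP => h; apply: nker; exists x => // M MW.
  by apply/eqP/negPn/negP => e; apply: h; exists M.
pose Wx := (W :&: annv k.+2 x)%VS.
have WxP M : M \in Wx -> M \in W /\ M *m x = 0 by case/memv_capP => ?; rewrite mem_annv => /eqP.
have [dWx full] : (k.+1 * k <= \dim Wx)%N /\ (lmul 1%:M x @: W)%VS = fullv.
  have [L [R [_ _ LP [dec _] sing']]] := compress_vector (singular_space_affine sing M0W) x0 M0x.
  have := singular_affine_dim sing'; rewrite (dim_compress_vector rkF LP dec) => h1.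
  have h2 := limg_ker_dim (lmul 1%:M x : 'Hom('M[K]_k.+2, 'cV[K]_k.+2)) W.
  rewrite -/(annv k.+2 x) -/Wx in h2.
  have h3 := dimvS (subvf (lmul 1%:M x @: W)%VS); rewrite dim_fullM in h3.
  split; first by dnia.
  by apply/eqP; rewrite eqEdim subvf dim_fullM; dnia.
(* The equality case for the compression at x with target line e. *)
have alt (e : 'cV_k.+2) : e != 0 ->
   (exists2 v, v \notin <[x]>%VS & forall M, M \in Wx -> exists c, M *m v = c *: e) \/
   (exists y : 'rV_k.+2, [/\ y != 0, y *m e = 0 & forall M, M \in Wx -> y *m M = 0]).
  move=> e0; have : e \in (lmul 1%:M x @: W)%VS by rewrite full memvf.
  case/memv_imgP => M MW; rewrite lmulE mul1mx => eM.
  have Mx0 : M *m x != 0 by rewrite -eM.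
  have [L [R [[fL _] Le LP [dec inj] sing']]] := compress_vector (singular_space_affine sing MW) x0 Mx0.
  rewrite -eM in Le LP; have k2' : (1 < k)%N by [].
  case: (singular_affine_max k2' sing'); first by rewrite (dim_compress_vector rkF LP dec) -/Wx; dnia.
    case=> v v0 h; left; exists (R *m v).
      apply/negP => /vlineP[c ec]; case/eqP: v0.
      by have [] := inj (- c) v; rewrite // ec scaleNr addNr.
    move=> N NW; have := h _ (memv_img (lmul L R) NW); have := h _ (mem0v _).
    rewrite addr0 mulmxDl => ->; rewrite add0r lmulE => e1.
    have [z ez] : exists z, N *m (R *m v) = e *m z by apply: LP; rewrite !mulmxA.
    by exists (z 0 0); rewrite ez mul_col_scal.
  case=> y y0 h; right; exists (y *m L); split.
  - by apply: contraNneq y0 => /(free_left fL) ->.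
  - by rewrite -mulmxA Le mulmx0.
  move=> N NW; have := h _ (memv_img (lmul L R) NW); have := h _ (mem0v _).
  rewrite addr0 mulmxDr => ->; rewrite add0r lmulE => e1.
  have [_ Nx] := WxP _ NW; apply: eq0_of_mulr => v; have [s [t ->]] := dec v.
  by rewrite mulmxDr -scalemxAr -(mulmxA _ N x) Nx mulmx0 scaler0 add0r !mulmxA -(mulmxA y) -(mulmxA y) e1 mul0mx.
(* Otherwise Wx, inside the space of the matrices annihilating x and v, is too
   large to avoid the matrices q r of that space, for a fixed row r. *)
have F1 v : v \notin <[x]>%VS -> (forall M, M \in Wx -> M *m v = 0) -> False.
  move=> vx h.
  have [r r0 hr] := tall_kernel (row_mx x v) k3.
  have Wsub : (Wx <= lker (lmul (1%:M : 'M_k.+2) (row_mx x v)))%VS.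
    apply/subvP => M MW; have [_ Mx] := WxP _ MW.
    by rewrite memv_lker_lmul mul1mx mul_mx_row Mx (h _ MW) row_mx0.
  have Csub : (right_line k.+2 r <= lker (lmul (1%:M : 'M_k.+2) (row_mx x v)))%VS.
    by apply/subvP => _ /right_lineP[q ->]; rewrite memv_lker_lmul mul1mx -mulmxA hr mulmx0.
  have dl := @dim_lker_lmul k.+2 k.+2 _ _ (1%:M : 'M[K]_k.+2) (row_mx x v) ltac:(by rewrite row_free_unit unitmx1) (free_row_mx x0 vx).
  have := dimv_sum_cap Wx (right_line k.+2 r); rewrite (dim_right_line _ r0) => dsum.
  have dle : (\dim (Wx + right_line k.+2 r) <= \dim (lker (lmul (1%:M : 'M[K]_k.+2) (row_mx x v))))%N.
    by apply: dimvS; rewrite subv_add Wsub.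
  have [M] : exists2 M, M \in (Wx :&: right_line k.+2 r)%VS & M != 0 by apply: vspace_nz; dnia.
  move=> /memv_capP[MW /right_lineP[q eq]]; rewrite eq => /eqP; apply.
  by apply: rkF; rewrite -eq; case: (WxP _ MW).
(* A left kernel vector y of Wx: a target e with y e <> 0 gives a second one, and
   Wx becomes the set of all matrices annihilating x with two given left kernel
   vectors, which contains rank-one matrices. *)
have T2F (y : 'rV_k.+2) : y != 0 -> (forall M, M \in Wx -> y *m M = 0) -> False.
  move=> y0 yW; have [f yf] := neq0_row_ex y0.
  have f0 : f != 0 := neq0_of_mulr1 yf.
  case: (alt f f0) => [[v vx h]|[y2 [y20 y2f h]]].
    apply: (F1 v vx) => M MW; have [c ec] := h _ MW.
    have := congr1 (mulmx y) ec; rewrite mulmxA yW // mul0mx -scalemxAr yf.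
    by move/matrixP/(_ 0 0); rewrite !mxE eqxx mulr1 => c0; rewrite ec -c0 scale0r.
  pose B := col_mx y y2.
  have fB : row_free B.
    rewrite -[B]trmxK tr_col_mx; apply: free_row_mx; rewrite ?trmx_eq0 //.
    apply/negP => /vlineP[c]; move/(congr1 trmx); rewrite linearZ /= !trmxK => ec.
    move: y2f; rewrite ec -scalemxAl yf => /matrixP/(_ 0 0); rewrite !mxE eqxx mulr1 => c0.
    by case/eqP: y20; rewrite ec c0 scale0r.
  have [p p0 Bp] := wide_kernel B k3.
  have [r r0 rx] := tall_kernel x (isT : (1 < k.+2)%N).
  have [C [x' [L [_ _ Lx LC e]]]] := split_col x0.
  have [Y [B' [Y' [_ _ _ YY e']]]] := @split_rows K 2 k B fB.
  have Wsub : (Wx :&: lker (lmul B (1%:M : 'M_k.+2)) <= limg (lmul (Y' : 'M_(k.+2, k)) L))%VS.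
    apply/subvP => M /memv_capP[/WxP[_ Mx]]; rewrite memv_lker_lmul mulmx1 => /eqP BM.
    have -> : M = lmul (Y' : 'M_(k.+2, k)) L ((Y : 'M_(k, k.+2)) *m M *m C).
      rewrite lmulE !mulmxA -(mulmxA _ C L).
      have -> : C *m L = 1%:M - x *m x' by rewrite -e addrC addKr.
      rewrite mulmxBr mulmx1 !mulmxA -(mulmxA _ M x) Mx mulmx0 mul0mx subr0.
      rewrite -[LHS]mul1mx; have -> : (1%:M : 'M[K]_k.+2) = B' *m B + Y' *m Y by rewrite e'.
      by rewrite mulmxDl -(mulmxA B') BM mulmx0 add0r.
    by rewrite memv_img // memvf.
  have Wx2 : (Wx <= Wx :&: lker (lmul B (1%:M : 'M_k.+2)))%VS.
    apply/subvP => M MW; rewrite memv_cap MW memv_lker_lmul mulmx1 /B mul_col_mx.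
    by rewrite yW // h // col_mx0 eqxx.
  have Wsub2 := subv_trans Wx2 Wsub.
  have eW : Wx = limg (lmul (Y' : 'M_(k.+2, k)) L).
    apply/eqP; rewrite eqEdim Wsub2.
    apply: leq_trans (dim_limg_ub _ _) _; rewrite dim_fullM mulnC; exact: dWx.
  have : p *m r \in Wx.
    rewrite eW; have -> : p *m r = lmul (Y' : 'M_(k.+2, k)) L ((Y : 'M_(k, k.+2)) *m (p *m r) *m C).
      rewrite lmulE !mulmxA -(mulmxA _ C L).
      have -> : C *m L = 1%:M - x *m x' by rewrite -e addrC addKr.
      rewrite mulmxBr mulmx1 !mulmxA -(mulmxA _ r x) rx mulmx0 mul0mx subr0.
      rewrite -[in LHS](mul1mx p); have -> : (1%:M : 'M[K]_k.+2) = B' *m B + Y' *m Y by rewrite e'.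
      by rewrite mulmxDl -(mulmxA B') Bp mulmx0 add0r.
    by rewrite memv_img // memvf.
  case/WxP => /rkF /mul_colrow_eq0[] /eqP; first by rewrite (negPf p0).
  by rewrite (negPf r0).
have T1 (e : 'cV_k.+2) : e != 0 -> (exists2 v, v \notin <[x]>%VS & forall M, M \in Wx -> exists c, M *m v = c *: e).
  by move=> /alt[//|[y [y0 _ h]]]; case: (T2F y).
(* Two vectors v1 and v2, sent into distinct lines: Wx loses at most one dimension
   at each, and is then the annihilator of x, v1, v2, which has rank-one matrices. *)
pose e2 : 'cV[K]_k.+2 := delta_mx ord_max 0.
have e20 : e2 != 0 by apply: delta_col_neq0.
have [v1 v1x h1] := T1 x x0; have [v2 v2x h2] := T1 e2 e20.
have ind c d : c *: x = d *: e2 -> d = 0.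
  by move/matrixP/(_ ord_max 0); rewrite !mxE !eqxx /= mulr0 mulr1.
have v10 : v1 != 0 by apply: contraNneq v1x => ->; rewrite mem0v.
have fA : row_free (row_mx (row_mx x v1) v2)^T.
  rewrite tr_row_mx -kermx_eq0; apply/eqP/row_matrixP => i; rewrite row0.
  set z := row i _; have : z *m col_mx (row_mx x v1)^T v2^T = 0 by rewrite -row_mul mulmx_ker row0.
  rewrite -(hsubmxK z) mul_row_col; set s := lsubmx z; set t := rsubmx z => e.
  have t0 : t = 0.
    apply/eqP/negPn/negP => t0.
    have t00 : t 0 0 != 0 by apply: contra t0 => /eqP t00; rewrite [t]mx11_scalar t00 raddf0.
    apply: (F1 v2 v2x) => M MW; have [_ Mx] := WxP _ MW.
    have [c1 e1] := h1 _ MW; have [c2 ee2] := h2 _ MW.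
    have eM : s *m (row_mx x v1)^T *m M^T + t *m v2^T *m M^T = 0 by rewrite -mulmxDl e mul0mx.
    rewrite -!mulmxA -!trmx_mul mul_mx_row Mx e1 ee2 in eM.
    rewrite -[s in s *m _]hsubmxK tr_row_mx mul_row_col trmx0 mulmx0 add0r in eM.
    rewrite !mul_scal_row -!linearZ -raddfD /= in eM.
    have {}eM : (rsubmx s 0 0 * c1) *: x = (- (t 0 0 * c2)) *: e2.
      rewrite scaleNr mulrC [t 0 0 * _]mulrC -!scalerA; apply/eqP; rewrite -addr_eq0.
      by apply/eqP/trmx_inj; rewrite trmx0.
    move/ind/eqP: eM; rewrite oppr_eq0 mulf_eq0 (negPf t00) /= => /eqP c20.
    by rewrite ee2 c20 scale0r.
  rewrite t0 mul0mx addr0 in e.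
  by rewrite t0 (free_left (free_row_mx x0 v1x) e) row_mx0.
pose Y := (Wx :&: annv k.+2 v1 :&: annv k.+2 v2)%VS.
have d1 (U : {vspace 'M[K]_k.+2}) v e : (forall M, M \in U -> exists c, M *m v = c *: e) ->
    (\dim U <= (\dim (U :&: annv k.+2 v)).+1)%N.
  move=> h; rewrite -[X in (_ <= X)%N]addn1; apply: leq_trans (@dim_image_vector K _ _ U v <[e]>%VS _) _.
    by move=> M /h[c ->]; rewrite memvZ ?memv_line.
  by rewrite leq_add2l dim_vline leq_b1.
have dY1 := d1 _ _ _ h1.
have dY2 : (\dim (Wx :&: annv k.+2 v1) <= (\dim Y).+1)%N.
  by apply: (d1 _ _ e2) => M /memv_capP[MW _]; apply: h2.
have Ysub : (Y <= lker (lmul (1%:M : 'M_k.+2) (row_mx (row_mx x v1) v2)))%VS.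
  apply/subvP => M /memv_capP[/memv_capP[/WxP[_ Mx]]].
  rewrite mem_annv => /eqP Mv1; rewrite mem_annv => /eqP Mv2.
  by rewrite memv_lker_lmul mul1mx mul_mx_row mul_mx_row Mx Mv1 Mv2 row_mx0 row_mx0.
have f1 : row_free (1%:M : 'M[K]_k.+2) by rewrite row_free_unit unitmx1.
have dl := dim_lker_lmul f1 fA.
have eY : Y = lker (lmul (1%:M : 'M_k.+2) (row_mx (row_mx x v1) v2)).
  apply/eqP; rewrite eqEdim Ysub /=.
  have {}dl : (\dim (lker (lmul (1%:M : 'M[K]_k.+2) (row_mx (row_mx x v1) v2))) + k.+2 * 3 = k.+2 * k.+2)%N by exact: dl.
  by move: dl dWx dY1 dY2; rewrite !mulSn !mulnS; clear; abstract_dims; lia.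
have [r r0 hr] : exists2 r : 'rV_k.+2, r != 0 & r *m row_mx (row_mx x v1) v2 = 0.
  by apply: tall_kernel; rewrite !addn1 !ltnS.
have : e2 *m r \in Y by rewrite eY memv_lker_lmul mul1mx -mulmxA hr mulmx0.
case/memv_capP => /memv_capP[/WxP[/rkF /mul_colrow_eq0[] /eqP]]; first by rewrite (negPf e20).
by rewrite (negPf r0).
Qed.

End NoRankOne.

(** * Singular spaces that send a vector into a line *)

Section LineImage.
Variable K : fieldType.

(** The three possibilities for a large space of singular matrices: a common right
    kernel vector, a common left kernel vector, or a special space. *)
Definition compression n (W : {vspace 'M[K]_n}) :=
  [\/ has_kernel W, has_kernel (trV W) | special W].

Lemma compression_tr n (W : {vspace 'M[K]_n}) : compression (trV W) -> compression W.
Proof.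
case=> [h|h|h]; [constructor 2| constructor 1| constructor 3] => //; first by rewrite trVK in h.
by have := special_tr h; rewrite trVK.
Qed.

(** A large singular space with a vector v sent into a line is one of the three
    kinds. The compression at v is a singular affine space of maximal dimension;
    a right kernel vector t of it yields, with v, the columns of A in a special
    space, and a left kernel vector of it yields one of W. *)
Lemma line_compression k (W : {vspace 'M[K]_k.+2}) : (1 <= k)%N -> affine_kernel_property K k.+1 ->
  singular_space W -> (k.+2 * k.+2 + 2 <= \dim W + k.+2.*2)%N ->
  has_line W -> compression W.
Proof.
move=> k1 maxk sing large [v [e [v0 line]]].
have [|nker] := classic (forall M, M \in W -> M *m v = 0); first by constructor 1; exists v.
have [M0 [M0W M0v]] : exists M, M \in W /\ M *m v != 0.
  apply: NNPP => h; apply: nker => M MW.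
  by apply/eqP/negPn/negP => e'; apply: h; exists M.
set f := M0 *m v in M0v.
have {line} line M : M \in W -> exists c, M *m v = c *: f.
  move=> MW; have [c ec] := line _ MW; have [d ed] := line _ M0W.
  have d0 : d != 0 by apply: contraNneq M0v => d0; rewrite /f ed d0 scale0r.
  by exists (c / d); rewrite ec /f ed scalerA divfK.
pose Wx := (W :&: annv k.+2 v)%VS.
have WxP M : M \in Wx -> M \in W /\ M *m v = 0 by case/memv_capP => ?; rewrite mem_annv => /eqP.
have decW M : M \in W -> exists c N, N \in Wx /\ M = c *: M0 + N.
  move=> MW; have [c ec] := line _ MW; exists c, (M - c *: M0); split; last by rewrite addrCA subrr addr0.
  by rewrite memv_cap memvB ?memvZ //= mem_annv mulmxBl -scalemxAl ec subrr.
have [L [R [[fL _] Lf LP [dec inj] sing']]] := compress_vector (singular_space_affine sing M0W) v0 M0v.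
rewrite -/f in Lf LP; rewrite -/Wx in sing'.
have [C [v' [B [v'v v'C Bv BC e1]]]] := split_col v0.
have dW1 : (\dim W <= (\dim Wx).+1)%N.
  rewrite -[X in (_ <= X)%N]addn1; apply: leq_trans (@dim_image_vector K _ _ W v <[f]>%VS _) _.
    by move=> M /line[c ->]; rewrite memvZ ?memv_line.
  by rewrite leq_add2l dim_vline leq_b1.
have dN : (\dim Wx <= \dim (lmul L R @: Wx) + k.+1)%N.
  rewrite -(limg_ker_dim (lmul L R) Wx) addnC leq_add2l.
  apply: (leq_trans (n := \dim {:'rV[K]_k.+1})); last by rewrite dim_fullM mul1n.
  apply: (dim_param (f := lmul f B)) => M /memv_capP[/WxP[_ Mv]].
  rewrite memv_lker_lmul => /eqP LMR; have [z ez] := compress_vector_ker LP dec Mv LMR.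
  have zv : z *m v = 0.
    move: Mv; rewrite ez -mulmxA => /mul_colrow_eq0[/eqP|//]; by rewrite (negPf M0v).
  exists (z *m C); rewrite lmulE -[LHS]mulmx1 -e1 ez -!mulmxA; congr (_ *m _).
  by rewrite mulmxDr (mulmxA z v) zv mul0mx add0r.
case: (maxk _ _ sing'); first by dnia.
  case=> t t0 ht.
  have LRt M : M \in W -> L *m M *m R *m t = 0.
    have a0 := ht _ (mem0v _); rewrite addr0 in a0.
    case/decW => c [N [NW ->]]; have := ht _ (memv_img (lmul L R) NW).
    rewrite mulmxDl a0 add0r lmulE => b0.
    by rewrite mulmxDr !mulmxDl b0 addr0 -scalemxAr -!scalemxAl a0 scaler0.
  have tv : R *m t \notin <[v]>%VS.
    apply/negP => /vlineP[c ec]; case/eqP: t0.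
    by have [] := inj (- c) t; rewrite // ec scaleNr addNr.
  have fA := free_row_mx v0 tv.
  constructor 3; exists 2, k.+1, (row_mx v (R *m t)), L; split=> //; first by split=> //; left.
  have dl := dim_lker_lmul fL fA.
  apply/eqP; rewrite eqEdim; apply/andP; split; last by dnia.
  apply/subvP => M MW; rewrite memv_lker_lmul mul_mx_row.
  have [c ec] := line _ MW.
  by rewrite -(mulmxA L M v) ec -scalemxAr Lf scaler0 mulmxA LRt // row_mx0.
case=> y y0 hy; constructor 2; exists (y *m L)^T.
  by rewrite trmx_eq0; apply: contraNneq y0 => /(free_left fL) ->.
move=> M; rewrite mem_trV => MW; apply: trmx_inj; rewrite trmx_mul trmxK trmx0.
have a0 := hy _ (mem0v _); rewrite addr0 in a0.
have [c [N [NW eM]]] := decW _ MW; have := hy _ (memv_img (lmul L R) NW).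
rewrite mulmxDr a0 add0r lmulE => b0.
apply: eq0_of_mulr => w; have [s [t ->]] := dec w; rewrite mulmxDr -scalemxAr.
have -> : y *m L *m M^T *m v = 0.
  by have [d ed] := line _ MW; rewrite -mulmxA ed -scalemxAr -mulmxA Lf mulmx0 scaler0.
rewrite scaler0 add0r eM mulmxDr mulmxDl -scalemxAr -scalemxAl.
have -> : y *m L *m M0 *m (R *m t) = y *m (L *m M0 *m R) *m t by rewrite !mulmxA.
have -> : y *m L *m N *m (R *m t) = y *m (L *m N *m R) *m t by rewrite !mulmxA.
by rewrite a0 b0 mul0mx scaler0 addr0.
Qed.

(** If B M A = 0, M A has independent columns, and B M C is invertible, where the
    columns of A and C span the whole space, then M is invertible. *)
Lemma block_unit a b (A : 'M[K]_(a + b, a)) (B : 'M[K]_(b, a + b)) (C : 'M[K]_(a + b, b)) M :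
  (forall w : 'cV_(a + b), exists s, exists t, w = A *m s + C *m t) ->
  B *m M *m A = 0 -> (forall s : 'cV_a, M *m A *m s = 0 -> s = 0) ->
  B *m M *m C \in unitmx -> M \in unitmx.
Proof.
move=> dec BMA inj uN; apply: unitmx_of_ker => w; have [s [t ->]] := dec w => Mw.
have t0 : t = 0.
  apply: (unitmx_ker0 uN); have := congr1 (mulmx B) Mw.
  by rewrite mulmx0 mulmxDr !mulmxA (mulmxDr B) !mulmxA BMA mul0mx add0r.
move: Mw; rewrite t0 mulmx0 addr0 mulmxA => /inj ->.
by rewrite mulmx0.
Qed.

End LineImage.

(** * Singular spaces that send a vector into a plane *)

Section PlaneImage.
Variable K : fieldType.

Lemma row_free1 n : row_free (1%:M : 'M[K]_n).
Proof. by rewrite row_free_unit unitmx1. Qed.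

Lemma row_free1T n : row_free (1%:M : 'M[K]_n)^T.
Proof. by rewrite trmx1 row_free1. Qed.

(** In a space of singular matrices, if B M0 A = 0 and M0 A has rank two, then the
    matrices vanishing on the columns of A form a small subspace: their blocks
    B M C make up the direction of a singular affine space. *)
Lemma block_compress k (W : {vspace 'M[K]_(2 + k)}) M0 (A : 'M[K]_(2 + k, 2)) (B : 'M[K]_(k, 2 + k)) :
  singular_space W -> M0 \in W -> row_free A^T -> row_free B ->
  B *m M0 *m A = 0 -> (forall s : 'cV_2, M0 *m A *m s = 0 -> s = 0) ->
  (\dim (W :&: lker (lmul (1%:M : 'M_(2 + k)) A)) <= k * k + k)%N.
Proof.
move=> sing M0W fA fB BMA inj.
have [C [A' [D [A'A A'C DA DC e]]]] := split_cols fA.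
set X := (W :&: _)%VS.
have XP M : M \in X -> M \in W /\ M *m A = 0.
  by case/memv_capP => ?; rewrite memv_lker_lmul mul1mx => /eqP.
have dec (w : 'cV_(2 + k)) : exists s, exists t, w = A *m s + C *m t.
  by exists (A' *m w), (D *m w); rewrite !mulmxA -mulmxDl e mul1mx.
have sing' : singular_affine (B *m M0 *m C) (lmul B C @: X)%VS.
  move=> _ /memv_imgP[M /XP[MW MA] ->]; rewrite lmulE -mulmxDl -mulmxDr.
  have MA' : (M0 + M) *m A = M0 *m A by rewrite mulmxDl MA addr0.
  apply: contra (sing _ (memvD M0W MW)); apply: (block_unit dec) => //.
    by rewrite -mulmxA MA' mulmxA.
  by rewrite MA'.
have := singular_affine_dim sing'.
have d1 := dim_lker_lmul fB (row_free1T k).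
have d2 : (\dim (X :&: lker (lmul B C)) <= \dim (lker (lmul B (1%:M : 'M_k))))%N.
  apply: leq_trans (dim_limg_ub (lmul (1%:M : 'M_(2 + k)) D) _).
  apply/dimvS/subvP => M /memv_capP[/XP[_ MA]]; rewrite memv_lker_lmul => BMC.
  have -> : M = lmul (1%:M : 'M_(2 + k)) D (M *m C).
    by rewrite lmulE mul1mx -[LHS]mulmx1 -e mulmxDr mulmxA MA mul0mx add0r mulmxA.
  by rewrite memv_img // memv_lker_lmul mulmx1 mulmxA.
have := limg_ker_dim (lmul B C) X.
move: d1 d2; rewrite mulnDl; dlia.
Qed.

(** If B M A = 0 throughout a large singular space of order at least five, with A
    and B of ranks two and n - 2, then some vector is sent into a line. A matrix
    M0 with M0 A of rank two would contradict [block_compress], so all M A have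
    rank at most one. *)
Lemma plane_line k (W : {vspace 'M[K]_k.+2}) (A : 'M[K]_(k.+2, 2)) (B : 'M[K]_(k, k.+2)) :
  (3 <= k)%N -> singular_space W -> (k.+2 * k.+2 + 2 <= \dim W + k.+2.*2)%N ->
  row_free A^T -> row_free B -> (forall M, M \in W -> B *m M *m A = 0) -> has_line W.
Proof.
move=> k3 sing large fA fB BMA.
have [[M0 [M0W inj]]|ninj] := classic (exists M0, M0 \in W /\ forall s : 'cV_2, M0 *m A *m s = 0 -> s = 0).
  have := @block_compress k W M0 A B sing M0W fA fB (BMA _ M0W) inj.
  have := limg_ker_dim (lmul (1%:M : 'M_k.+2) A) W.
  have d1 : (\dim (lmul (1%:M : 'M_k.+2) A @: W) <= \dim (lker (lmul B (1%:M : 'M_2))))%N.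
    apply/dimvS/subvP => _ /memv_imgP[M MW ->].
    by rewrite memv_lker_lmul lmulE mulmx1 mul1mx mulmxA BMA.
  have d2 := dim_lker_lmul fB (row_free1T 2).
  move: d1 d2 large; clear -k3.
  rewrite !mulSn !mulnS -!muln2; abstract_dims; nia.
have rk M : M \in (lmul (1%:M : 'M_k.+2) A @: W)%VS -> rk1 M.
  case/memv_imgP => N NW ->; rewrite lmulE mul1mx.
  apply: NNPP => nrk; apply: ninj; exists N; split=> // s Ns.
  by apply/eqP/negPn/negP => s0; apply: nrk; apply: rk1_of_ker s0 Ns.
have memA M : M \in W -> M *m A \in (lmul (1%:M : 'M_k.+2) A @: W)%VS.
  by move=> MW; have := memv_img (lmul (1%:M : 'M_k.+2) A) MW; rewrite lmulE mul1mx.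
case: (rk1_space rk) => [[a ha]|[b hb]].
  exists (A *m delta_mx 0 0), a; split=> [|M MW].
    apply/eqP => /(free_right fA)/matrixP/(_ 0 0)/eqP; rewrite !mxE eqxx.
    by rewrite oner_eq0.
  have [r er] := ha _ (memA _ MW); exists ((r *m delta_mx 0 0 : 'M_1) 0 0).
  by rewrite -mul_col_scal !mulmxA er.
have [s s0 bs] := wide_kernel b (isT : 1 < 2)%N; exists (A *m s), 0; split=> [|M MW].
  by apply: contraNneq s0 => /(free_right fA) ->.
have [c ec] := hb _ (memA _ MW); exists 0.
by rewrite scale0r mulmxA ec -mulmxA bs mulmx0.
Qed.

Lemma row_free_of_nrk1 m (N : 'M[K]_(2, m)) : ~ rk1 N -> row_free N.
Proof.
move=> nrk; rewrite -kermx_eq0; apply/negPn/negP => /rowV0Pn[y].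
rewrite sub_kermx => /eqP yN y0; apply: nrk.
have yN' : N^T *m y^T = 0 by rewrite -trmx_mul yN trmx0.
have [||a [r e]] := @rk1_of_ker K m N^T y^T; rewrite ?trmx_eq0 //.
by exists r^T, a^T; apply: trmx_inj; rewrite trmx_mul !trmxK.
Qed.

Lemma det_rk1 (N : 'M[K]_2) : rk1 N -> \det N = 0.
Proof.
by case=> a [r ->]; rewrite det2 !mxE !big_ord1; ring.
Qed.

Lemma rk1_mulr m n p (N : 'M[K]_(m, n)) (C : 'M[K]_(n, p)) : rk1 N -> rk1 (N *m C).
Proof. by case=> a [r ->]; exists a, (r *m C); rewrite mulmxA. Qed.

Lemma dim_span2 (vT : vectType K) (a b : vT) : (\dim (<[a]> + <[b]>)%VS <= 2)%N.
Proof.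
apply: leq_trans (leq_of_leqif (dimv_add_leqif _ _)) _.
by rewrite !dim_vline; case: (a != 0); case: (b != 0).
Qed.

Lemma dim_span3 (vT : vectType K) (a b c : vT) : (\dim (<[a]> + <[b]> + <[c]>)%VS <= 3)%N.
Proof.
apply: leq_trans (leq_of_leqif (dimv_add_leqif _ _)) _.
by apply: (@leq_add _ _ 2 1); rewrite ?dim_span2 // dim_vline leq_b1.
Qed.

(** In order four, let W send u into the plane of M0 u and M2 u. Then a vector is
    sent into a line, by W or its transpose, or else all the matrices M0 u z with
    z u = 0 are in W. The dichotomy is whether the compression at u has dimension
    at least six, or at most five. *)
Lemma plane4_case1 (W : {vspace 'M[K]_4}) (u : 'cV_4) M0 M2 :
  singular_space W -> (10 <= \dim W)%N -> u != 0 -> M0 \in W -> M2 \in W -> M0 *m u != 0 ->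
  M2 *m u \notin <[M0 *m u]>%VS ->
  (forall M, M \in W -> exists c d, M *m u = c *: (M0 *m u) + d *: (M2 *m u)) ->
  has_line W \/ has_line (trV W) \/
  (forall z : 'rV_4, z *m u = 0 -> M0 *m u *m z \in W).
Proof.
move=> sing large u0 M0W M2W; set e := M0 *m u; set e' := M2 *m u => e0 e'e plane.
pose Wx := (W :&: annv 4 u)%VS.
have WxP M : M \in Wx -> M \in W /\ M *m u = 0 by case/memv_capP => ?; rewrite mem_annv => /eqP.
have decW M : M \in W -> exists c d N, N \in Wx /\ M = c *: M0 + d *: M2 + N.
  move=> MW; have [c [d ec]] := plane _ MW.
  exists c, d, (M - (c *: M0 + d *: M2)); split; last by rewrite addrCA subrr addr0.
  apply/memv_capP; split; first by rewrite memvB // memvD ?memvZ.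
  by rewrite mem_annv mulmxBl mulmxDl -!scalemxAl ec subrr.
have [L [R [[fL _] Le LP [dec inj] sing']]] := @compress_vector K 3 M0 W u (singular_space_affine sing M0W) u0 e0.
rewrite -/e in Le LP; rewrite -/Wx in sing'.
have dW : (\dim W <= \dim Wx + 2)%N.
  apply: leq_trans (@dim_image_vector K _ _ W u (<[e]> + <[e']>)%VS _) _.
    by move=> M /plane[c [d ->]]; rewrite memv_add // memvZ ?memv_line.
  by rewrite leq_add2l dim_span2.
have eR M t : M \in Wx -> L *m M *m R *m t = 0 -> exists k, M *m (R *m t) = k *: e.
  move=> _ h; have [z ez] : exists z, M *m (R *m t) = e *m z by apply: LP; rewrite !mulmxA.
  by exists (z 0 0); rewrite ez mul_col_scal.
have [d6|d5] := leqP 6 (\dim (lmul L R @: Wx)).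
  case: (singular_affine_max (isT : (2 <= 2)%N) sing'); first by dlia.
    case=> t t0 ht; left.
    have a0 := ht _ (mem0v _); rewrite addr0 in a0.
    have b0 N : N \in Wx -> L *m N *m R *m t = 0.
      by move=> NW; have := ht _ (memv_img (lmul L R) NW); rewrite mulmxDl a0 add0r lmulE.
    set v := R *m t in eR *.
    have vu : v \notin <[u]>%VS.
      apply/negP => /vlineP[c ec]; case/eqP: t0.
      by have [] := inj (- c) t; rewrite // -/v ec scaleNr addNr.
    have Nv N : N \in Wx -> exists k, N *m v = k *: e by move=> NW; apply: eR; rewrite ?b0.
    have [k0 ek0] : exists k, M0 *m v = k *: e.
      have [z ez] : exists z, M0 *m v = e *m z by apply: LP; rewrite !mulmxA.
      by exists (z 0 0); rewrite ez mul_col_scal.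
    have [[l [mu em]]|nem] := classic (exists l mu, M2 *m v = l *: e' + mu *: e).
      exists (v - l *: u), e; split.
        by apply: contra vu; rewrite subr_eq0 => /eqP ->; rewrite memvZ ?memv_line.
      move=> M MW; have [c [d [N [NW ->]]]] := decW _ MW; have [kN eN] := Nv _ NW.
      have [_ Nu] := WxP _ NW.
      exists (c * (k0 - l) + d * mu + kN); rewrite !mulmxDl -!scalemxAl !mulmxBr -!scalemxAr.
      rewrite ek0 em eN Nu -/e -/e' scaler0 subr0 [l *: e' + _]addrC addrK -scalerBl.
      by rewrite !scalerA -!scalerDl.
    pose A := row_mx u v.
    have fA : row_free A^T := free_row_mx u0 vu.
    (* Here M2 A has rank two and [block_compress] bounds dim W by 6 + 3. *)
    have f2 : row_free (M2 *m A)^T.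
      rewrite mul_mx_row; apply: free_row_mx; first by apply: contraNneq e'e; rewrite -/e' => ->; rewrite mem0v.
      apply/negP => /vlineP[l el]; apply: nem; exists l, 0; by rewrite scale0r addr0.
    have [C2 [A2 [B [_ _ BMA BC _]]]] := @split_cols K 2 2 (M2 *m A) f2.
    have fB : row_free B by apply/row_freeP; eexists; exact: BC.
    have := @block_compress 2 W M2 A B sing M2W fA fB (etrans (esym (mulmxA _ _ _)) BMA) (fun s => free_right f2).
    have := limg_ker_dim (lmul (1%:M : 'M_4) A) W.
    have : (\dim (lmul (1%:M : 'M_4) A @: W) <= 3)%N.
      pose T := (<[row_mx e 0]> + <[row_mx 0 e]> + <[M2 *m A]>)%VS : {vspace 'M[K]_(4, 2)}.
      apply: leq_trans (_ : \dim T <= _)%N.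
        apply/dimvS/subvP => _ /memv_imgP[M MW ->]; rewrite lmulE mul1mx.
        have [c [d [N [NW ->]]]] := decW _ MW; have [kN eN] := Nv _ NW; have [_ Nu] := WxP _ NW.
        have -> : (c *: M0 + d *: M2 + N) *m A =
            (c *: row_mx e 0 + (c * k0 + kN) *: row_mx 0 e) + d *: (M2 *m A).
          rewrite !mulmxDl -!scalemxAl addrAC; congr (_ + _).
          rewrite /A !mul_mx_row -/e ek0 Nu eN !scale_row_mx !add_row_mx !scaler0 !addr0 add0r.
          by rewrite scalerDl scalerA.
        by rewrite !memv_add // memvZ ?memv_line.
      exact: dim_span3.
    by move: large; clear; dlia.
  case=> y y0 hy; right; left.
  have a0 := hy _ (mem0v _); rewrite addr0 in a0.
  have b0 N : N \in Wx -> y *m (L *m N *m R) = 0.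
    by move=> NW; have := hy _ (memv_img (lmul L R) NW); rewrite mulmxDr a0 add0r lmulE.
  have kill M : (exists k, M *m u = k *: e) -> y *m (L *m M *m R) = 0 -> y *m L *m M = 0.
    case=> k ek yM; apply: eq0_of_mulr => w; have [s [t ->]] := dec w; rewrite mulmxDr -scalemxAr.
    rewrite -(mulmxA _ M u) ek -!scalemxAr -(mulmxA y L e) Le mulmx0 !scaler0 add0r.
    by rewrite !mulmxA -(mulmxA y) -(mulmxA y) yM mul0mx.
  exists (y *m L)^T, (y *m L *m M2)^T; split.
    by rewrite trmx_eq0; apply: contraNneq y0 => /(free_left fL) ->.
  move=> M; rewrite mem_trV => MW; have [c [d [N [NW eM]]]] := decW _ MW.
  exists d; apply: trmx_inj; rewrite trmx_mul linearZ /= !trmxK eM !mulmxDr -!scalemxAr.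
  rewrite (kill M0) ?a0 //; last by exists 1; rewrite scale1r.
  rewrite (kill N) ?b0 //; last by exists 0; have [_ ->] := WxP _ NW; rewrite scale0r.
  by rewrite scaler0 add0r addr0.
right; right => z zu.
have [C [u' [B [u'u u'C Bu BC e1]]]] := split_col u0.
pose E := limg (lmul e B : 'Hom('rV[K]_3, 'M[K]_4)).
have sub : (Wx :&: lker (lmul L R) <= E)%VS.
  apply/subvP => M /memv_capP[/WxP[_ Mu]]; rewrite memv_lker_lmul => /eqP LMR.
  have [r er] := compress_vector_ker LP dec Mu LMR.
  have ru : r *m u = 0.
    move: Mu; rewrite er -mulmxA => /mul_colrow_eq0[/eqP|//]; by rewrite (negPf e0).
  have -> : M = lmul e B (r *m C).
    rewrite lmulE -[LHS]mulmx1 -e1 er -!mulmxA; congr (_ *m _).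
    by rewrite mulmxDr (mulmxA r u) ru mul0mx add0r.
  by rewrite memv_img // memvf.
have dE : (\dim E <= 3)%N by apply: leq_trans (dim_limg_ub _ _) _; rewrite dim_fullM.
have eE : (Wx :&: lker (lmul L R))%VS = E.
  apply/eqP; rewrite eqEdim sub /=.
  have := limg_ker_dim (lmul L R) Wx; dlia.
have : e *m z \in E.
  have -> : e *m z = lmul e B (z *m C).
    rewrite lmulE -[LHS]mulmx1 -e1 -!mulmxA; congr (_ *m _).
    by rewrite mulmxDr (mulmxA z u) zu mul0mx add0r.
  by rewrite memv_img // memvf.
by rewrite -eE => /memv_capP[/WxP[]].
Qed.

End PlaneImage.

Section PlaneImage4.
Variable K : fieldType.

Lemma det2_add1 (Y : 'M[K]_2) : \det (Y + 1%:M) = \det Y + \tr Y + 1.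
Proof.
rewrite !det2 /mxtrace big_ord_recl big_ord1 !mxE /=.
have -> : lift ord0 ord0 = ord_max :> 'I_2 by apply: val_inj.
by rewrite !mulr0n !mulr1n; ring.
Qed.

(** Continuation when W contains the rank-one matrices M1 u z and M2 u z with
    z u = 0. With L killing the plane and R complementing u, adding such matrices
    to M shows that L M R has rank at most one as soon as M u <> 0, and then for
    all M in W; hence [rk1_space] applies to these compressions. *)
Lemma plane4_case2 (W : {vspace 'M[K]_4}) (u : 'cV_4) M1 M2 :
  singular_space W -> u != 0 -> M1 \in W -> M2 \in W -> M1 *m u != 0 ->
  M2 *m u \notin <[M1 *m u]>%VS ->
  (forall M, M \in W -> exists c d, M *m u = c *: (M1 *m u) + d *: (M2 *m u)) ->
  (forall z : 'rV_4, z *m u = 0 -> M1 *m u *m z \in W) ->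
  (forall z : 'rV_4, z *m u = 0 -> M2 *m u *m z \in W) ->
  has_line (trV W).
Proof.
move=> sing u0 M1W M2W; set e1 := M1 *m u; set e2 := M2 *m u => e10 e2e1 plane We1 We2.
pose Wx := (W :&: annv 4 u)%VS.
have WxP M : M \in Wx -> M \in W /\ M *m u = 0 by case/memv_capP => ?; rewrite mem_annv => /eqP.
pose P := row_mx e1 e2.
have fP : row_free P^T := free_row_mx e10 e2e1.
have [C2 [P' [L [_ _ LP LC eP]]]] := @split_cols K 2 2 P fP.
have [R [u' [D [u'u u'R Du DR eu]]]] := split_col u0.
have fL : row_free L by apply/row_freeP; exists C2.
have [Le1 Le2] : L *m e1 = 0 /\ L *m e2 = 0.
  have LP' : row_mx (L *m e1) (L *m e2) = 0 by rewrite -mul_mx_row; exact: LP.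
  split.
    by have := congr1 (@lsubmx _ _ 1 1) LP'; rewrite row_mxKl linear0.
  by have := congr1 (@rsubmx _ _ 1 1) LP'; rewrite row_mxKr linear0.
have Lu M : M \in W -> L *m (M *m u) = 0.
  by case/plane => c [d ->]; rewrite mulmxDr -!scalemxAr Le1 Le2 !scaler0 addr0.
have dec (w : 'cV_4) : w = (u' *m w) 0 0 *: u + R *m (D *m w).
  by rewrite -mul_col_scal !mulmxA -mulmxDl eu mul1mx.
have Lker (w : 'cV_4) : L *m w = 0 -> exists c d, w = c *: e1 + d *: e2.
  move=> Lw; exists (@usubmx _ 1 1 1 (P' *m w) 0 0), (@dsubmx _ 1 1 1 (P' *m w) 0 0).
  rewrite -!mul_col_scal -mul_row_col vsubmxK -[LHS]mul1mx -eP mulmxDl -(mulmxA C2).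
  by rewrite Lw mulmx0 addr0 -mulmxA.
(* If L M R had rank two, then M + f z would be invertible for a suitable f in the plane,
   not on the line of M u, and a suitable row z. *)
have small M : M \in W -> M *m u != 0 -> rk1 (L *m M *m R).
  move=> MW Mu; apply: NNPP => nrk.
  have fN := row_free_of_nrk1 nrk.
  have [h [N' [h' [_ _ _ _ eN]]]] := @split_rows K 2 1 (L *m M *m R) fN.
  have [f [Wf Lf nf]] : exists f, [/\ forall z : 'rV_4, z *m u = 0 -> f *m z \in W, L *m f = 0 &
       ~ exists k, f = k *: (M *m u)].
    have [c [d ec]] := plane _ MW.
    have [c0|c0] := eqVneq c 0.
      exists e1; split=> // -[k ek]; case/negP: e2e1; apply/vlineP.
      have e1E : e1 = (k * d) *: e2 by rewrite {1}ek ec c0 scale0r add0r scalerA.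
      have kd : k * d != 0 by apply: contraNneq e10 => kd; rewrite e1E kd scale0r.
      by exists ((k * d)^-1); rewrite e1E scalerA mulVf ?scale1r.
    exists e2; split=> // -[k ek]; case/negP: e2e1; apply/vlineP.
    have [k0|k0] := eqVneq k 0; first by exists 0; rewrite ek k0 !scale0r.
    have [kd|kd] := eqVneq (1 - k * d) 0.
      have : (k * c) *: e1 = 0.
        have : (1 - k * d) *: e2 = (k * c) *: e1.
          by rewrite scalerBl scale1r {1}ek ec scalerDr !scalerA addrK.
        by rewrite kd scale0r.
      by move/eqP; rewrite scaler_eq0 (negPf e10) mulf_eq0 (negPf k0) (negPf c0).
    exists ((1 - k * d)^-1 * (k * c)).
    have : (1 - k * d) *: e2 = (k * c) *: e1.
      by rewrite scalerBl scale1r {1}ek ec scalerDr !scalerA addrK.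
    by move=> ekk; rewrite -scalerA -ekk scalerA mulVf ?scale1r.
  have [y yMu yf] := col_sep nf.
  pose z := (h - y *m M *m R) *m D.
  have zu : z *m u = 0 by rewrite /z -mulmxA Du mulmx0.
  have zR : z *m R = h - y *m M *m R by rewrite /z -mulmxA DR mulmx1.
  have /sing : M + f *m z \in W by apply: memvD => //; apply: Wf.
  case/negP; apply: unitmx_of_ker => w; rewrite (dec w).
  move: ((u' *m w) 0 0) (D *m w) => s t Mw.
  have e : s *: (M *m u) + (M *m (R *m t) + f *m (z *m (R *m t))) = 0.
    rewrite -Mw mulmxDl !mulmxDr -!scalemxAr -(mulmxA f z u) zu mulmx0 scaler0 add0r.
    by rewrite -(mulmxA f z) addrA.
  have Nt : L *m M *m R *m t = 0.
    have := congr1 (mulmx L) e.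
    by rewrite mulmx0 !mulmxDr -scalemxAr Lu // (mulmxA L f) Lf mul0mx scaler0 add0r addr0 !mulmxA.
  have ht : h *m t = 0.
    have := congr1 (mulmx y) e.
    rewrite mulmx0 !mulmxDr -scalemxAr yMu scaler0 add0r (mulmxA y f) yf mul1mx (mulmxA z R) zR.
    by rewrite mulmxBl !mulmxA addrC subrK.
  have t0 : t = 0.
    by rewrite -[t]mul1mx -eN mulmxDl -!mulmxA (mulmxA L) (mulmxA (L *m M)) Nt ht !mulmx0 addr0.
  move: e; rewrite t0 !mulmx0 !addr0 => /eqP; rewrite scaler_eq0 (negPf Mu) orbF => /eqP ->.
  by rewrite scale0r.
have e20 : e2 != 0 by apply: contraNneq e2e1 => ->; rewrite mem0v.
pose X1 := L *m M1 *m R; pose X2 := L *m M2 *m R.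
have NNP M : M \in Wx -> [/\ rk1 (X1 + L *m M *m R), rk1 (X2 + L *m M *m R) & rk1 (X1 + X2 + L *m M *m R)].
  case/WxP => MW Mu; rewrite /X1 /X2 -!mulmxDl -!mulmxDr.
  split; apply: small; rewrite ?memvD // ?mulmxDl Mu ?addr0 ?mulmxDl //.
  by rewrite addr_eq0; apply: contra e2e1 => /eqP e; rewrite -/e2 -[e2]opprK -e memvN memv_line.
(* If L M R had a right inverse C, the trace of X C would be -1 for X = X1, X2 and
   X1 + X2. *)
have NNrk M : M \in Wx -> rk1 (L *m M *m R).
  move=> MW; apply: NNPP => nrk; have /row_freeP[C NC] := row_free_of_nrk1 nrk.
  have [a1 a2 a3] := NNP _ MW; have [b1 b2 b3] := NNP _ (mem0v _).
  rewrite !mulmx0 !mul0mx !addr0 in b1 b2 b3.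
  have d X : rk1 X -> rk1 (X + L *m M *m R) -> \tr (X *m C) = -1.
    move=> /(rk1_mulr C)/det_rk1 h1 /(rk1_mulr C)/det_rk1; rewrite mulmxDl NC.
    by rewrite det2_add1 h1 add0r => /eqP; rewrite addr_eq0 => /eqP.
  have := d _ b3 a3; rewrite mulmxDl mxtraceD (d _ b1 a1) (d _ b2 a2).
  by move/eqP; rewrite -subr_eq0 addrK oppr_eq0 oner_eq0.
have all_rk N : N \in (lmul L R @: W)%VS -> rk1 N.
  case/memv_imgP => M MW ->; rewrite lmulE.
  have [Mu|] := eqVneq (M *m u) 0; last exact: small.
  by apply: NNrk; rewrite memv_cap MW mem_annv Mu eqxx.
have img M : M \in W -> L *m M *m R \in (lmul L R @: W)%VS.
  by move=> MW; rewrite -lmulE memv_img.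
case: (rk1_space all_rk) => [[a ha]|[b hb]].
- have [y y0 ya] := tall_kernel a (isT : 1 < 2)%N; exists (y *m L)^T, 0; split.
    by rewrite trmx_eq0; apply: contraNneq y0 => /(free_left fL) ->.
  move=> M; rewrite mem_trV => MW; exists 0; rewrite scale0r; apply: trmx_inj; rewrite trmx_mul trmxK trmx0.
  have [r er] := ha _ (img _ MW).
  apply: eq0_of_mulr => w; rewrite (dec w) mulmxDr -scalemxAr -!mulmxA Lu // mulmx0 scaler0 add0r.
  by rewrite (mulmxA _ R) (mulmxA L) (mulmxA L) er !mulmxA ya !mul0mx.
pose y : 'rV[K]_2 := delta_mx 0 0.
have y0 : y != 0 by apply/eqP => /matrixP/(_ 0 0)/eqP; rewrite !mxE eqxx oner_eq0.
exists (y *m L)^T, (b *m D)^T; split.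
  by rewrite trmx_eq0; apply: contraNneq y0 => /(free_left fL) ->.
move=> M; rewrite mem_trV => MW; have [c ec] := hb _ (img _ MW).
exists ((y *m c) 0 0); apply: trmx_inj; rewrite trmx_mul linearZ /= !trmxK -mul_scal_row.
apply/subr0_eq/eq0_of_mulr => w; apply/eqP; rewrite mulmxBl subr_eq0; apply/eqP.
rewrite (dec w) !mulmxDr -!scalemxAr -!mulmxA Lu // Du !mulmx0 scaler0 !add0r.
by rewrite (mulmxA _ R) (mulmxA L) (mulmxA L) ec (mulmxA D R) DR mul1mx !mulmxA.
Qed.

(** A large singular space of order four that sends some nonzero vector into a
    plane sends some nonzero vector into a line, up to transposition. *)
Lemma plane4 (W : {vspace 'M[K]_4}) (u : 'cV_4) :
  singular_space W -> (10 <= \dim W)%N -> u != 0 ->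
  (exists e1 e2, forall M, M \in W -> exists c d, M *m u = c *: e1 + d *: e2) ->
  has_line W \/ has_line (trV W).
Proof.
move=> sing large u0 [e1 [e2 h]].
have [[M1 [M1W M1u]]|nM1] := classic (exists M, M \in W /\ M *m u != 0); last first.
  left; exists u, 0; split=> // M MW; exists 0; rewrite scale0r.
  by apply/eqP/negPn/negP => e; apply: nM1; exists M.
have [[M2 [M2W M2u]]|nM2] := classic (exists M, M \in W /\ M *m u \notin <[M1 *m u]>%VS); last first.
  left; exists u, (M1 *m u); split=> // M MW; apply/vlineP/negPn/negP => e.
  by apply: nM2; exists M.
have plane M : M \in W -> exists c d, M *m u = c *: (M1 *m u) + d *: (M2 *m u).
  move=> MW; pose U : {vspace 'cV[K]_4} := (<[e1]> + <[e2]>)%VS.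
  have inU N : N \in W -> N *m u \in U.
    by case/h => c [d ->]; rewrite memv_add // memvZ ?memv_line.
  have : (<[M1 *m u]> + <[M2 *m u]>)%VS = U.
    apply/eqP; rewrite eqEdim subv_add -!memvE !inU //=.
    apply: leq_trans (dim_span2 _ _) _; rewrite dimv_disjoint_sum ?dim_vline.
      rewrite M1u; case: eqP M2u => [->|_ _ //]; by rewrite mem0v.
    apply/eqP; rewrite -subv0; apply/subvP => v /memv_capP[/vlineP[k ->] /vlineP[l el]].
    rewrite memv0 el; case: (eqVneq l 0) => [->|l0]; first by rewrite scale0r.
    case/negP: M2u; apply/vlineP; exists (l^-1 * k); rewrite -scalerA el scalerA mulVf ?scale1r //.
  move=> eU; have := inU _ MW; rewrite -eU => /memv_addP[_ /vlineP[c ->] [_ /vlineP[d ->] ->]].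
  by exists c, d.
have M2u0 : M2 *m u != 0 by apply: contraNneq M2u => ->; rewrite mem0v.
have M1u' : M1 *m u \notin <[M2 *m u]>%VS.
  exact: contra (vline_sym M1u) M2u.
case: (plane4_case1 sing large u0 M1W M2W M1u M2u plane) => [|[|h1]]; [by left|by right|].
have plane' M : M \in W -> exists c d, M *m u = c *: (M2 *m u) + d *: (M1 *m u).
  by case/plane => c [d ->]; exists d, c; rewrite addrC.
case: (plane4_case1 sing large u0 M2W M1W M2u0 M1u' plane') => [|[|h2]]; [by left|by right|].
by right; apply: (plane4_case2 sing u0 M1W M2W M1u M2u plane h1).
Qed.

End PlaneImage4.

(** * Classification of the large singular spaces *)

Section Classification.
Variable K : fieldType.

(** The dimension bound of the classification, dim W >= n^2 - 2n + 2. *)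
Definition large n (W : {vspace 'M[K]_n}) := (n * n + 2 <= \dim W + n.*2)%N.

Lemma trV_cap m n (U V : {vspace 'M[K]_(m, n)}) : trV (U :&: V) = (trV U :&: trV V)%VS.
Proof. by apply/vspaceP => M; rewrite mem_trV !memv_cap !mem_trV. Qed.

Lemma trV_cross n (x : 'cV[K]_n) (z : 'rV[K]_n) : trV (cross x z) = cross z^T x^T.
Proof.
apply/vspaceP => M; rewrite mem_trV; apply/memv_addP/memv_addP.
  case=> _ /left_lineP[r ->] [_ /right_lineP[q ->] e].
  exists (z^T *m q^T); first by apply/left_lineP; exists q^T.
  exists (r^T *m x^T); first by apply/right_lineP; exists r^T.
  by rewrite -[M]trmxK e raddfD /= !trmx_mul addrC.
case=> _ /left_lineP[r ->] [_ /right_lineP[q ->] e].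
exists (x *m q^T); first by apply/left_lineP; exists q^T.
exists (r^T *m z); first by apply/right_lineP; exists r^T.
by rewrite e raddfD /= !trmx_mul !trmxK addrC.
Qed.

(** Some rank-one matrix of a large singular space yields a compression that is
    again large. Otherwise all crosses meet W in codimension at most one, so the
    rank-one matrices spread and dim W >= n^2 - n; but a compression that is not
    large forces dim W <= n^2 - 2n + 3. *)
Lemma large_compress k (W : {vspace 'M[K]_k.+2}) : (2 <= k)%N ->
  singular_space W -> large W ->
  (exists x : 'cV_k.+2, exists z : 'rV_k.+2, [/\ x != 0, z != 0 & x *m z \in W]) ->
  exists x : 'cV_k.+2, exists z : 'rV_k.+2, exists L : 'M[K]_(k.+1, k.+2), exists R : 'M[K]_(k.+2, k.+1),
  [/\ ker_line L x,
      forall p (w : 'M_(p, k.+2)), w *m R = 0 -> exists q, w = q *m z,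
      row_free L /\ row_free R^T,
      singular_space (lmul L R @: W) & large (lmul L R @: W)].
Proof.
move=> k2 sing bigW ex1; apply: NNPP => nex.
have thin (x : 'cV_k.+2) (z : 'rV_k.+2) : x != 0 -> z != 0 -> x *m z \in W ->
    (\dim (cross x z) <= (\dim (W :&: cross x z)).+1)%N /\ ~ (k.+2 * k.+2 <= \dim W + k.+2)%N.
  move=> x0 z0 xzW.
  have [L [R [LP RP f sing' dW]]] := compress_affine (singular_space_affine sing (mem0v W)) x0 z0 xzW.
  rewrite mulmx0 mul0mx in sing'.
  have nbig : ~ large (lmul L R @: W).
    by move=> b; apply: nex; exists x, z, L, R; split=> //; apply: singular_affine0.
  have dC := dim_cross x0 z0; have dS := dimvS (capvSr W (cross x z)).
  move: nbig bigW dC dS dW; rewrite /large => /negP; rewrite -ltnNge.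
  clear -k2; rewrite !mulSn !mulnS; abstract_dims; split; first by lia.
  by move=> h; lia.
have thin1 x z x0 z0 xzW := proj1 (thin x z x0 z0 xzW).
have k2' : (2 < k.+2)%N by rewrite !ltnS; apply: ltnW.
have [x [z [x0 z0 xzW]]] := ex1; have [_ ndim] := thin x z x0 z0 xzW.
apply: ndim; case: (rank_one_spread k2' thin1 ex1) => spr; first exact: spread_dim thin1 spr.
rewrite -(dim_trV W); apply: spread_dim => [x' z' x'0 z'0|x' x'0].
  rewrite mem_trV trmx_mul => h; have := thin1 z'^T x'^T; rewrite !trmx_eq0 => /(_ z'0 x'0 h).
  by rewrite -[X in (X <= _)%N]dim_trV -(dim_trV (W :&: _)) trV_cap !trV_cross !trmxK.
have [w w0 wW] := spr x'^T ltac:(by rewrite trmx_eq0); exists w^T; rewrite ?trmx_eq0 //.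
by rewrite mem_trV trmx_mul trmxK.
Qed.

Lemma large_tr n (W : {vspace 'M[K]_n}) : large W -> large (trV W).
Proof. by rewrite /large dim_trV. Qed.

Lemma lines_compression k (W : {vspace 'M[K]_k.+2}) : (1 <= k)%N -> affine_kernel_property K k.+1 ->
  singular_space W -> large W -> has_line W \/ has_line (trV W) -> compression W.
Proof.
move=> k1 maxk sing bW [h|h]; first exact: line_compression h.
apply: compression_tr; apply: line_compression h => //.
  exact: singular_space_tr.
exact: large_tr.
Qed.

Lemma row_free_mul m n p (A : 'M[K]_(m, n)) (B : 'M[K]_(n, p)) :
  row_free A -> row_free B -> row_free (A *m B).
Proof.
move=> /row_freeP[A' AA'] /row_freeP[B' BB']; apply/row_freeP; exists (B' *m A').
by rewrite mulmxA -(mulmxA A) BB' mulmx1.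
Qed.

(** Classification of the linear spaces of singular n x n matrices of dimension at
    least n^2 - 2n + 2, where n = k + 2 >= 3 and the case n = 3 over the field with
    two elements is excluded. *)
Theorem singular_compression k (W : {vspace 'M[K]_k.+2}) : (1 <= k)%N ->
  (2 <= k)%N \/ (exists a : K, a != 0 /\ a != 1) ->
  singular_space W -> large W -> compression W.
Proof.
elim: k W => // k IH W _ cond sing bW.
have [k0|k0] := posnP k.
  subst k; case: cond => [//|[a [a0 a1]]].
  have maxk : affine_kernel_property K 2 by move=> N0 U sg _; apply: singular_affine_max2 a0 a1 sg.
  apply: lines_compression => //; apply: line3 => //.
  by move: bW; rewrite /large; clear; dlia.
have maxk : affine_kernel_property K k.+2 by move=> N0 U sg d; apply: singular_affine_max.
apply: lines_compression => //.
have [ex1|nex] := rank_one_or_none W; last first.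
  by left; apply/has_kernel_line/no_rank_one_kernel.
have [x [z [L [R [LP RP [fL fR] sing' big']]]]] := @large_compress k.+1 W k0 sing bW ex1.
have [k1|k1] := leqP k 1.
  have {k0 k1} ek : k = 1%N by apply/eqP; rewrite eqn_leq k1 k0.
  subst k.
  have d10 : (10 <= \dim W)%N by move: bW; rewrite /large; clear; dlia.
  have d5 : (5 <= \dim (lmul L R @: W))%N by move: big'; rewrite /large; clear; dlia.
  case: (line3 sing' d5) => h.
    by have [u u0 pl] := lift_line LP fL fR h; apply: plane4 u0 pl.
  have [u u0 pl] := lift_line_tr RP fL fR h.
  have := plane4 (singular_space_tr sing) _ u0 pl; rewrite dim_trV trVK => /(_ d10) [?|?]; [by right|by left].
case: (IH _ k0 (or_introl _) sing' big') => // h.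
- by left; apply: lift_kernel LP fR h.
- by right; apply: lift_kernel_tr RP fL h.
have [p [q [A [B [[fA fB] p1 q1 [pq pq2] eW]]]]] := h.
have BA M : M \in W -> B *m L *m M *m (R *m A) = 0.
  move=> /(lift_mem L R); rewrite eW memv_lker_lmul => /eqP <-.
  by rewrite !mulmxA.
have fRA : row_free (R *m A)^T by rewrite trmx_mul row_free_mul.
have fBL : row_free (B *m L) by rewrite row_free_mul.
case: pq2 => e; subst.
  have eq : q = k.+1 by move: pq; lia.
  by subst q; left; apply: (@plane_line K k.+1 W (R *m A) (B *m L)).
have ep : p = k.+1 by move: pq; lia.
subst p; right; apply: (@plane_line K k.+1 (trV W) (B *m L)^T (R *m A)^T) => //.
- exact: singular_space_tr.
- exact: large_tr.
- by rewrite trmxK.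
move=> M; rewrite mem_trV => /BA e.
by have := congr1 trmx e; rewrite trmx0 => <-; rewrite !trmx_mul trmxK !mulmxA.
Qed.

End Classification.

(** * Linear maps preserving all kernels *)

Section KernelPreserving.
Variable K : fieldType.

(** A linear map h that vanishes on S wherever f does factors on S through f. *)
Lemma lfun_factor (aT rT sT : vectType K) (f : 'Hom(aT, rT)) (h : 'Hom(aT, sT)) (S : {vspace aT}) :
  (forall M, M \in S -> f M = 0 -> h M = 0) ->
  exists G : 'Hom(rT, sT), forall M, M \in S -> G (f M) = h M.
Proof.
(* A preimage under the restriction of f to S, followed by h. *)
move=> fh; pose fS := (f \o projv S)%VF.
exists (h \o projv S \o fS^-1)%VF => M MS; rewrite !comp_lfunE.
set N := projv S _.
have NS : N \in S by apply: memv_proj.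
have fN : f N = f M.
  rewrite /N -[f (projv S _)]comp_lfunE -/fS limg_lfunVK //.
  by apply/memv_imgP; exists M; rewrite ?memvf // comp_lfunE projv_id.
apply/eqP; rewrite -subr_eq0 -raddfB; apply/eqP/fh; first by rewrite memvB.
by rewrite raddfB /= fN subrr.
Qed.

Lemma mx_of_fun m n (F : 'cV[K]_n -> 'cV[K]_m) :
  (forall x x', F (x + x') = F x + F x') -> (forall c x, F (c *: x) = c *: F x) ->
  exists Y : 'M[K]_(m, n), forall x, F x = Y *m x.
Proof.
move=> FD FZ; exists (\matrix_(i, j) F (delta_mx j 0) i 0) => x.
have F0 : F 0 = 0 by rewrite -(scale0r 0) FZ scale0r.
rewrite [x in LHS]matrix_sum_delta (big_morph F FD F0).
apply/matrixP => i k; rewrite summxE mxE; apply: eq_bigr => j _.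
by rewrite big_ord1 FZ !mxE (ord1 k) mulrC.
Qed.

Lemma lfun_col_mx m k (f : 'Hom('cV[K]_m, 'cV[K]_k)) : exists P : 'M[K]_(k, m), forall p, f p = P *m p.
Proof. by apply: mx_of_fun => [x y|c x]; rewrite ?linearD ?linearZ. Qed.

Lemma mx1_sum n : 1%:M = \sum_i delta_mx i i :> 'M[K]_n.
Proof. by rewrite scalar_mx_sum_delta; apply: eq_bigr => i _; rewrite scale1r. Qed.

(** Case of the full space of matrices: g (p d) is a multiple of d for every row
    d, and comparing the rows d_j and d_0 gives a common left factor. *)
Lemma local_full m n k (g : 'Hom('M[K]_(m, n.+1), 'M[K]_(k, n.+1))) :
  (forall M (x : 'cV_n.+1), M *m x = 0 -> g M *m x = 0) ->
  exists P : 'M[K]_(k, m), forall M, g M = P *m M.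
Proof.
move=> loc.
pose d (j : 'I_n.+1) : 'rV[K]_n.+1 := delta_mx 0 j.
pose e (j : 'I_n.+1) : 'cV[K]_n.+1 := delta_mx j 0.
have de j : d j *m e j = 1%:M.
  by rewrite mul_delta_mx; apply/matrixP => a b; rewrite !ord1 !mxE !eqxx.
have de0 i j : i != j -> d i *m e j = 0 by move=> ij; rewrite mul_delta_mx_0.
have [P PE] := lfun_col_mx (lmul (1%:M : 'M_k) (e ord0) \o g \o lmul (1%:M : 'M_m) (d ord0))%VF.
have {}PE p : g (p *m d ord0) *m e ord0 = P *m p.
  by rewrite -PE !comp_lfunE !lmulE !mul1mx.
(* The matrix p d_j annihilates the kernel of d_j. *)
have gE p j : g (p *m d j) = (g (p *m d j) *m e j) *m d j.
  apply/subr0_eq/eq0_of_mulr => x; rewrite mulmxBl -!mulmxA -mulmxBr.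
  apply: loc; rewrite mulmxBr -!mulmxA (mulmxA (d j) (e j)) de mul1mx subrr //.
have gP p j : g (p *m d j) *m e j = P *m p.
  have [->|j0] := eqVneq j ord0; first exact: PE.
  have j0' : ord0 != j by rewrite eq_sym.
  have z : (d j - d ord0) *m (e j + e ord0) = 0.
    by rewrite mulmxBl !mulmxDr !de (de0 j ord0) // (de0 ord0 j) // addr0 add0r subrr.
  have := loc (p *m (d j - d ord0)) (e j + e ord0); rewrite -mulmxA z mulmx0 => /(_ erefl).
  rewrite mulmxBr raddfB /= mulmxBl !mulmxDr gE (gE p ord0) -!mulmxA !de (de0 j ord0) // (de0 ord0 j) //.
  rewrite !mulmx0 !mulmx1 addr0 add0r => /subr0_eq.
  by rewrite -{1}PE.
exists P => M.
have -> : M = \sum_j (M *m e j) *m d j.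
  rewrite -[LHS]mulmx1 mx1_sum mulmx_sumr; apply: eq_bigr => j _.
  by rewrite -mulmxA mul_delta_mx.
rewrite linear_sum /= mulmx_sumr; apply: eq_bigr => j _.
by rewrite gE gP !mulmxA.
Qed.

(** A linear map, defined on a space S of m x n matrices of codimension at most
    n - 2, that sends every M to a matrix whose kernel contains that of M is a left
    multiplication. By induction on n: a row c is good if S does not contain all
    the matrices q c; then g induces a map on S modulo the matrices q c, hence is
    a left multiplication modulo these. Two independent good rows give the claim. *)
Lemma local_linear n m k (S : {vspace 'M[K]_(m, n)}) (g : 'Hom('M[K]_(m, n), 'M[K]_(k, n))) :
  (m * n + 2 <= \dim S + n)%N ->
  (forall M (x : 'cV_n), M \in S -> M *m x = 0 -> g M *m x = 0) ->
  exists P : 'M[K]_(k, m), forall M, M \in S -> g M = P *m M.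
Proof.
elim: n m k S g => [|n IH] m k S g dS loc.
  by move: dS; have := dimvS (subvf S); rewrite dim_fullM; clear; dlia.
have [full|nfull] := boolP (fullv <= S)%VS.
  have [|P PE] := @local_full m n k g; last by exists P => M _; apply: PE.
  by move=> M x; apply: loc; apply: (subvP full); apply: memvf.
have Cmem c p : (right_line m c <= S)%VS -> p *m c \in S.
  by move/subvP; apply; apply/right_lineP; exists p.
(* For a good row c, the induction hypothesis applies to S modulo the matrices q c. *)
have good c : c != 0 -> ~~ (right_line m c <= S)%VS ->
    exists P : 'M[K]_(k, m), forall M, M \in S -> exists q, g M - P *m M = q *m c.
  move=> c0 nc; have [D [c' [R [cc' cR Dc' DR e]]]] := split_row c0.
  have kR p (N : 'M_(p, n.+1)) : N *m R = 0 -> exists q, N = q *m c.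
    move=> NR; exists (N *m c'); rewrite -mulmxA -[LHS]mulmx1 -e mulmxDr (mulmxA N R) NR.
    by rewrite mul0mx addr0.
  pose r p := lmul (1%:M : 'M[K]_p) R.
  have rE p N : r p N = N *m R by rewrite lmulE mul1mx.
  have [|G GE] := @lfun_factor _ _ _ (r m) (r k \o g)%VF S.
    move=> M MS; rewrite rE => MR; rewrite comp_lfunE rE; apply: eq0_of_mulr => x.
    by rewrite -mulmxA; apply: loc => //; rewrite mulmxA MR mul0mx.
  have [||P PE] := IH m k (r m @: S)%VS G.
  - have := limg_ker_dim (r m) S.
    have : (\dim (S :&: lker (r m)) < m)%N.
      apply: (@leq_trans (\dim (right_line m c))); last by rewrite (dim_right_line m c0).
      have sub : (S :&: lker (r m) <= S :&: right_line m c)%VS.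
        apply/subvP => M /memv_capP[MS]; rewrite memv_ker rE => /eqP /kR[q eq].
        by rewrite memv_cap MS; apply/right_lineP; exists q.
      apply: leq_ltn_trans (dimvS sub) _.
      rewrite ltn_neqAle (dimv_leqif_sup (capvSr _ _)) dimvS ?capvSr // andbT.
      by apply: contra nc => /subv_trans; apply; apply: capvSl.
    by move: dS; rewrite mulnS; clear; dlia.
  - move=> _ x /memv_imgP[M MS ->]; rewrite rE => MRx.
    rewrite -(rE _ M) GE // comp_lfunE rE -mulmxA; apply: loc => //.
    by rewrite mulmxA.
  exists P => M MS; apply: kR; rewrite mulmxBl -!rE -comp_lfunE -GE // PE ?memv_img //.
  by rewrite !rE mulmxA subrr.
have [c1 c10 nc1] : exists2 c : 'rV_n.+1, c != 0 & ~~ (right_line m c <= S)%VS.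
  case/subvPn: nfull => M _ MS; apply: NNPP => h; case/negP: MS.
  have -> : M = \sum_j col j M *m delta_mx 0 j.
    rewrite -[LHS]mulmx1 mx1_sum mulmx_sumr; apply: eq_bigr => j _.
    by rewrite colE -mulmxA mul_delta_mx.
  apply: memv_suml => j _; apply: Cmem; apply/negPn/negP => hj; apply: h.
  exists (delta_mx 0 j) => //.
  by apply/eqP => /matrixP/(_ 0 j)/eqP; rewrite !mxE !eqxx oner_eq0.
(* If d is not good and c1 is, then d + c1 is good. *)
have pick (U : {vspace 'rV[K]_n.+1}) : c1 \in U -> (\dim U < n.+1)%N -> exists2 c, c \notin U & ~~ (right_line m c <= S)%VS.
  move=> c1U dU; have /subvPn[d _ dU'] : ~~ (fullv <= U)%VS.
    by apply: contraL dU => /dimvS; rewrite dim_fullM mul1n -leqNgt.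
  have [dS'|?] := boolP (right_line m d <= S)%VS; last by exists d.
  exists (d + c1); first by apply: contra dU' => h; rewrite -(addrK c1 d) memvB.
  apply: contra nc1 => dc; apply/subvP => _ /right_lineP[q ->].
  have -> : q *m c1 = q *m (d + c1) - q *m d by rewrite mulmxDr addrC addKr.
  by rewrite memvB ?Cmem.
have n2 : (2 < n.+1)%N.
  have : (\dim S < m * n.+1)%N.
    apply: (@leq_trans (\dim {:'M[K]_(m, n.+1)})); last by rewrite dim_fullM.
    rewrite ltn_neqAle (dimv_leqif_sup (subvf S)) nfull dimvS ?subvf //.
  by move: dS; clear; dlia.
have [|c2 c2c1 nc2] := pick <[c1]>%VS (memv_line _); first by rewrite dim_vline; case: (_ != _); rewrite // ltnW.
have c20 : c2 != 0 by apply: contraNneq c2c1 => ->; rewrite mem0v.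
have [P1 h1] := good _ c10 nc1; have [P2 h2] := good _ c20 nc2.
(* Two different left factors confine S to the M with z M in the plane of a and b. *)
have conf (A B : 'M[K]_(k, m)) a b : A <> B ->
    (forall M, M \in S -> exists q, g M - A *m M = q *m a) ->
    (forall M, M \in S -> exists q, g M - B *m M = q *m b) ->
    exists2 z : 'rV_m, z != 0 & forall M, M \in S -> z *m M \in (<[a]> + <[b]>)%VS.
  move=> AB hA hB; have [y yAB] : exists y : 'rV_k, y *m (B - A) != 0.
    apply: NNPP => h; apply: AB; apply/esym/subr0_eq/eq0_of_mull => y.
    by apply/eqP/negPn/negP => yy; apply: h; exists y.
  exists (y *m (B - A)) => // M /[dup] /hA[q eq] /hB[q' eq'].
  have -> : y *m (B - A) *m M = y *m (q *m a) - y *m (q' *m b).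
    rewrite -eq -eq' -mulmxBr -mulmxA mulmxBl; congr (_ *m _).
    by rewrite opprB [RHS]addrC addrA subrK.
  rewrite !mulmxA !mul_scal_row -scaleNr.
  by rewrite memv_add // memvZ ?memv_line.
(* By dimension, S is the whole space of such M. *)
have conf_eq a b (z : 'rV_m) : z != 0 ->
    (forall M, M \in S -> z *m M \in (<[a]> + <[b]>)%VS) ->
    forall M, z *m M \in (<[a]> + <[b]>)%VS -> M \in S.
  move=> z0 zS; pose f := lmul z (1%:M : 'M_n.+1); pose U := (f @^-1: (<[a]> + <[b]>))%VS.
  have UP M : (M \in U) = (z *m M \in (<[a]> + <[b]>)%VS) by rewrite -memv_preim lmulE mulmx1.
  suff -> : S = U by move=> M; rewrite UP.
  apply/eqP; rewrite eqEdim; apply/andP; split; first by apply/subvP => M MS; rewrite UP zS.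
  have := limg_ker_dim f U; have := dimvS (capvSr U (lker f)).
  have : (\dim (f @: U) <= 2)%N.
    apply: leq_trans (dim_span2 a b); apply/dimvS/subvP => Y /memv_imgP[M MU ->].
    by move: MU; rewrite UP lmulE mulmx1.
  have fz : row_free z by rewrite row_free_rV.
  have := dim_lker_lmul fz (row_free1T K n.+1); rewrite -/f.
  by move: dS; clear; dlia.
have e12 : P1 = P2.
  apply: NNPP => n12; have [z z0 zS] := conf _ _ _ _ n12 h1 h2.
  have SP := conf_eq _ _ _ z0 zS.
  have S1 (q : 'cV_m) : q *m c1 \in S.
    by apply: SP; rewrite mulmxA mul_scal_row -[_ *: c1]addr0 memv_add ?mem0v ?memvZ ?memv_line.
  by case/negP: nc1; apply/subvP => _ /right_lineP[q ->].
exists P1 => M MS.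
have [q1 eq1] := h1 _ MS; have [q2 eq2] := h2 _ MS; rewrite -e12 in eq2.
apply/subr0_eq; rewrite eq1.
have [E] : exists E : 'cV_n.+1, c1 *m E = 1%:M /\ c2 *m E = 0.
  have [|z zv zw] := @col_sep K n.+1 c2^T c1^T.
    case=> l /(congr1 trmx); rewrite linearZ /= !trmxK => ek.
    have k0 : l != 0 by apply: contraNneq c10 => k0; rewrite ek k0 scale0r.
    by case/negP: c2c1; apply/vlineP; exists l^-1; rewrite ek scalerA mulVf ?scale1r.
  exists z^T; split; apply: trmx_inj; rewrite trmx_mul trmxK ?trmx1 ?trmx0 //.
case=> E1 E2; suff -> : q1 = 0 by rewrite mul0mx.
have : q1 *m c1 *m E = q2 *m c2 *m E by rewrite -eq1 -eq2.
by rewrite -!mulmxA E1 E2 mulmx1 mulmx0.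
Qed.

End KernelPreserving.

(** * The image of the annihilator of a vector *)

Section VectorTypes.
Variable K : fieldType.

Section Tests.
Variables (n : nat) (V : {vspace 'M[K]_n}).
Hypothesis dV : (n * n + 2 <= \dim V + n)%N.

(** V has codimension at most n - 2, so among the rank-one matrices p h with a
    given row h it contains some with one prescribed linear condition on p. *)
Lemma rank_one_col (h y : 'rV[K]_n) : h != 0 ->
  exists p : 'cV_n, [/\ p != 0, p *m h \in V & y *m p = 0].
Proof.
move=> h0; have := dim_lker_lb (lmul y (1%:M : 'M_1)) fullv.
rewrite capfv !dim_fullM !muln1 => d1.
have [||p [p0]] := @meet_img _ _ _ (lmul (1%:M : 'M_n) h) (lker (lmul y (1%:M : 'M_1))) V.
- move=> p _; rewrite lmulE mul1mx => /mul_colrow_eq0[//|/eqP]; by rewrite (negPf h0).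
- by rewrite dim_fullM; move: dV d1; clear; dlia.
rewrite memv_lker_lmul mulmx1 => /eqP yp; rewrite lmulE mul1mx => phV.
by exists p.
Qed.

End Tests.

Lemma rank_one_row n (V : {vspace 'M[K]_n}) (q x : 'cV[K]_n) :
  (n * n + 2 <= \dim V + n)%N -> q != 0 ->
  exists h : 'rV_n, [/\ h != 0, q *m h \in V & h *m x = 0].
Proof.
rewrite -dim_trV => dV q0; have [|p [p0 pV yp]] := rank_one_col dV x^T (h := q^T); first by rewrite trmx_eq0.
exists p^T; split; rewrite ?trmx_eq0 //; first by move: pV; rewrite mem_trV trmx_mul trmxK.
by apply: trmx_inj; rewrite trmx_mul trmxK trmx0.
Qed.

(** The annihilator of x in V determines the line of x. *)
Lemma annv_sub_parallel n (V : {vspace 'M[K]_n}) (x1 x2 : 'cV_n) : (n * n + 2 <= \dim V + n)%N ->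
  (forall M, M \in V -> M *m x1 = 0 -> M *m x2 = 0) -> x2 \in <[x1]>%VS.
Proof.
move=> dV h; apply/vlineP; apply: NNPP => /col_sep[r rx1 rx2].
have r0 : r != 0 := neq0_of_mul1r rx2.
have [p [p0 pV _]] := rank_one_col dV 0 r0.
by case/eqP: p0; have := h _ pV; rewrite -!mulmxA rx1 rx2 mulmx0 mulmx1 => ->.
Qed.

(** Mutually inverse linear maps g and g' between V and V', that preserve
    invertibility in both directions. They are taken as endomorphisms of the full
    space of matrices; only their values on V and V' matter. *)
Definition preserving_pair n (V V' : {vspace 'M[K]_n}) (g g' : 'End('M[K]_n)) :=
  [/\ forall M, M \in V -> g M \in V', forall N, N \in V' -> g' N \in V,
      forall M, M \in V -> g' (g M) = M, forall N, N \in V' -> g (g' N) = N &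
      forall M, M \in V -> (g M \in unitmx) = (M \in unitmx)].

(** The classification of singular spaces holds for the subspaces of codimension at
    most n in V. *)
Definition classified n (V : {vspace 'M[K]_n}) := forall W : {vspace 'M[K]_n},
  (W <= V)%VS -> singular_space W -> (\dim V <= \dim W + n)%N -> compression W.

(** The setting of the rest of the proof: a preserving pair between spaces of
    codimension at most n - 2 for which the classification is available. It is
    stable under exchange of the two sides and under transposition. *)
Definition preserver n (V V' : {vspace 'M[K]_n}) (g g' : 'End('M[K]_n)) :=
  [/\ preserving_pair V V' g g', (n * n + 2 <= \dim V + n)%N, (n * n + 2 <= \dim V' + n)%N,
      classified V & classified V'].

(** Transposition as a linear map. *)
Definition trlf n : 'End('M[K]_n) := linfun (@trmx K n n).
Lemma trlfE n M : trlf n M = M^T. Proof. by rewrite lfunE. Qed.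

Lemma preserver_sym n (V V' : {vspace 'M[K]_n}) g g' : preserver V V' g g' -> preserver V' V g' g.
Proof.
case=> [[h1 h2 h3 h4 h5] d d' c c']; split=> //; split=> // N NV.
by rewrite -(h5 (g' N) (h2 N NV)) h4.
Qed.

Lemma classified_tr n (V : {vspace 'M[K]_n}) : classified V -> classified (trV V).
Proof.
move=> c W WV sing dW; apply: compression_tr; apply: c.
- by apply/subvP => M; rewrite mem_trV => /(subvP WV); rewrite mem_trV trmxK.
- exact: singular_space_tr.
- by rewrite dim_trV -(dim_trV V).
Qed.

Lemma preserver_tr n (V V' : {vspace 'M[K]_n}) g g' : preserver V V' g g' ->
  preserver V (trV V') (trlf n \o g)%VF (g' \o trlf n)%VF.
Proof.
case=> [[h1 h2 h3 h4 h5] d d' c c']; split; rewrite ?dim_trV //; last exact: classified_tr.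
split.
- by move=> M MV; rewrite comp_lfunE trlfE mem_trV trmxK h1.
- by move=> N; rewrite mem_trV comp_lfunE trlfE => /h2.
- by move=> M MV; rewrite !comp_lfunE !trlfE trmxK h3.
- by move=> N; rewrite mem_trV !comp_lfunE !trlfE => NV; rewrite h4 // trmxK.
by move=> M MV; rewrite comp_lfunE trlfE unitmx_tr h5.
Qed.

(** The elements of V annihilating x correspond to those of V' annihilating the
    column y. *)
Definition coltype n (V : {vspace 'M[K]_n}) (g : 'End('M[K]_n)) (x y : 'cV[K]_n) :=
  y != 0 /\ forall M, M \in V -> (M *m x == 0) = (g M *m y == 0).

(** The elements of V annihilating x correspond to those of V' annihilated by the
    row y. *)
Definition rowtype n (V : {vspace 'M[K]_n}) (g : 'End('M[K]_n)) (x : 'cV[K]_n) (y : 'rV[K]_n) :=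
  y != 0 /\ forall M, M \in V -> (M *m x == 0) = (y *m g M == 0).

(** The elements of V annihilating x correspond to a special space
    {N | B N A = 0} contained in V', with A and B of ranks p and q. *)
Definition spectype_at p q n (V V' : {vspace 'M[K]_n}) (g : 'End('M[K]_n)) (x : 'cV[K]_n) :=
  exists (A : 'M[K]_(n, p)) (B : 'M[K]_(q, n)),
  [/\ row_free A^T /\ row_free B, (1 < p)%N /\ (1 < q)%N, (p + q = n.+1)%N /\ (p = 2%N \/ q = 2%N),
      (lker (lmul B A) <= V')%VS &
      forall M, M \in V -> (M *m x == 0) = (B *m g M *m A == 0)].

(** The same, for some ranks p and q. *)
Definition spectype n (V V' : {vspace 'M[K]_n}) (g : 'End('M[K]_n)) (x : 'cV[K]_n) :=
  exists p q, spectype_at p q V V' g x.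

Lemma rowtype_tr n (V : {vspace 'M[K]_n}) g x y : rowtype V g x y -> coltype V (trlf n \o g)%VF x y^T.
Proof.
case=> y0 h; split; first by rewrite trmx_eq0.
by move=> M MV; rewrite comp_lfunE trlfE -trmx_mul trmx_eq0 h.
Qed.

Lemma coltype_tr n (V : {vspace 'M[K]_n}) g x y : coltype V g x y -> rowtype V (trlf n \o g)%VF x y^T.
Proof.
case=> y0 h; split; first by rewrite trmx_eq0.
by move=> M MV; rewrite comp_lfunE trlfE -trmx_mul trmx_eq0 h.
Qed.

Lemma spectype_at_tr p q n (V V' : {vspace 'M[K]_n}) g x :
  spectype_at p q V V' g x -> spectype_at q p V (trV V') (trlf n \o g)%VF x.
Proof.
case=> A [B [[fA fB] [p1 q1] [pq pq2] sub h]].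
exists B^T, A^T; split; rewrite ?trmxK ?(addnC q) //; first by split=> //; case: pq2; auto.
  apply/subvP => M; rewrite memv_lker_lmul mem_trV => e; apply: (subvP sub).
  by rewrite memv_lker_lmul -trmx_eq0 !trmx_mul trmxK mulmxA.
move=> M MV; rewrite h // comp_lfunE trlfE -[LHS]trmx_eq0.
by rewrite !trmx_mul mulmxA.
Qed.

Lemma spectype_tr n (V V' : {vspace 'M[K]_n}) g x :
  spectype V V' g x -> spectype V (trV V') (trlf n \o g)%VF x.
Proof. by case=> p [q /spectype_at_tr h]; exists q, p. Qed.

Lemma special_dim n p q (A : 'M[K]_(n, p)) (B : 'M[K]_(q, n)) : row_free A^T -> row_free B ->
  (p + q = n.+1)%N -> p = 2%N \/ q = 2%N -> (\dim (lker (lmul B A)) + n.*2 = n * n + 2)%N.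
Proof.
move=> fA fB pq h; have := dim_lker_lmul fB fA.
by move: h pq; clear; abstract_dims; case: h => e; nia.
Qed.

Section Preserver.
Variables (n : nat) (V V' : {vspace 'M[K]_n}) (g g' : 'End('M[K]_n)).
Hypothesis cx : preserver V V' g g'.

Let lp : preserving_pair V V' g g'. Proof. by case: cx. Qed.
Let dV : (n * n + 2 <= \dim V + n)%N. Proof. by case: cx. Qed.
Let dV' : (n * n + 2 <= \dim V' + n)%N. Proof. by case: cx. Qed.
Lemma preserver_mem M : M \in V -> g M \in V'. Proof. by case: lp => h *; apply: h. Qed.
Lemma preserver_inv_mem N : N \in V' -> g' N \in V. Proof. by case: lp => ? h *; apply: h. Qed.
Lemma preserver_invK M : M \in V -> g' (g M) = M. Proof. by case: lp => ? ? h *; apply: h. Qed.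
Lemma preserver_imgK N : N \in V' -> g (g' N) = N. Proof. by case: lp => ? ? ? h *; apply: h. Qed.

Lemma preserver_unit M : M \in V -> (g M \in unitmx) = (M \in unitmx).
Proof. by case: lp => ? ? ? ? h *; apply: h. Qed.

Lemma dim_sub_img (U : {vspace 'M[K]_n}) : (U <= V)%VS -> \dim (g @: U) = \dim U.
Proof.
by move=> UV; apply: dim_inj => M /(subvP UV) MV gM; rewrite -(preserver_invK MV) gM linear0.
Qed.

(** The annihilator of x in V is maximal among the singular subspaces of V. *)
Lemma maximal_kernel (x : 'cV_n) (X : {vspace 'M[K]_n}) : x != 0 -> (X <= V)%VS -> singular_space X ->
  (V :&: annv n x <= X)%VS -> (X <= annv n x)%VS.
Proof.
move=> x0 XV sing sub.
have dK : (\dim V <= \dim (V :&: annv n x) + n)%N.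
  by have := dim_lker_lb (lmul 1%:M x : 'Hom('M[K]_n, 'cV[K]_n)) V; rewrite dim_fullM muln1.
have cV : classified V by case: cx.
case: (cV X XV sing); first by apply: leq_trans dK _; rewrite leq_add2r dimvS.
- case=> x' x'0 h.
  have /vlineP[c ec] : x' \in <[x]>%VS.
    apply: (annv_sub_parallel dV) => M MV Mx; apply: h; apply: (subvP sub).
    by rewrite memv_cap MV mem_annv Mx eqxx.
  apply/subvP => M /h; rewrite ec -scalemxAr mem_annv => /eqP; rewrite scaler_eq0 => /orP[/eqP c0|//].
  by move: x'0; rewrite ec c0 scale0r eqxx.
- case=> v v0 h; have [q vq] : exists q, v^T *m q = 1%:M by apply: neq0_row_ex; rewrite trmx_eq0.
  have q0 : q != 0 := neq0_of_mulr1 vq.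
  have [r [r0 qrV rx]] := rank_one_row x dV q0.
  case/eqP: r0; rewrite -[r]mul1mx -vq -mulmxA; apply: trmx_inj; rewrite trmx0 trmx_mul trmxK.
  apply: h; rewrite mem_trV trmxK; apply: (subvP sub).
  by rewrite memv_cap qrV mem_annv -mulmxA rx mulmx0 eqxx.
case=> p [q [A [B [[fA fB] p1 q1 [pq pq2] eX]]]].
have dX := special_dim fA fB pq pq2; rewrite -eX in dX.
suff -> : X = (V :&: annv n x)%VS by apply: capvSr.
apply/eqP; rewrite eq_sym eqEdim sub /=; move: dX dK dV; clear; dlia.
Qed.

(** Each nonzero vector has one of the three types. The image of the annihilator of
    x is contained in one of the three kinds of spaces; equality follows from the
    maximality of the annihilator, applied to the preimage. *)
Lemma classify (x : 'cV_n) : x != 0 ->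
  [\/ exists y, coltype V g x y, exists y, rowtype V g x y | spectype V V' g x].
Proof.
move=> x0; pose W := (g @: (V :&: annv n x))%VS.
have subV : (V :&: annv n x <= V)%VS by apply: capvSl.
have WV : (W <= V')%VS.
  by apply/subvP => _ /memv_imgP[M /memv_capP[MV _] ->]; apply: preserver_mem.
have sW : singular_space W.
  move=> N /memv_imgP[M /memv_capP[MV]]; rewrite mem_annv => /eqP Mx ->.
  by rewrite preserver_unit //; apply: nonunit_of_ker Mx.
have dVV' : \dim V' = \dim V.
  rewrite -(dim_sub_img (subvv V)); congr (\dim _); apply/vspaceP => N.
  apply/idP/memv_imgP => [NV|[M MV ->]]; last exact: preserver_mem.
  by exists (g' N); rewrite ?preserver_inv_mem ?preserver_imgK.
have dK : (\dim V <= \dim (V :&: annv n x) + n)%N.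
  by have := dim_lker_lb (lmul 1%:M x : 'Hom('M[K]_n, 'cV[K]_n)) V; rewrite dim_fullM muln1.
have cV' : classified V' by case: cx.
have memW M : M \in V -> (g M \in W) = (M *m x == 0).
  move=> MV; apply/memv_imgP/idP => [[N /memv_capP[NV Nx] e]|Mx].
    by rewrite -mem_annv -(preserver_invK MV) e (preserver_invK NV).
  by exists M; rewrite // memv_cap MV mem_annv.
(* By maximality, a singular subspace of V' cut out by U and containing W is W. *)
have max (U : {vspace 'M[K]_n}) : singular_space (V' :&: U) -> (W <= U)%VS ->
    forall M, M \in V -> (M *m x == 0) = (g M \in U).
  move=> sU WU M MV; pose X := (g' @: (V' :&: U))%VS.
  have XV : (X <= V)%VS.
    by apply/subvP => _ /memv_imgP[N /memv_capP[NV _] ->]; apply: preserver_inv_mem.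
  have XK : (X <= annv n x)%VS.
    apply: (maximal_kernel x0 XV).
      move=> _ /memv_imgP[N NU ->]; have /memv_capP[NV _] := NU.
      by rewrite -preserver_unit ?preserver_inv_mem // preserver_imgK //; apply: sU.
    apply/subvP => N /memv_capP[NV Nx]; apply/memv_imgP; exists (g N); last by rewrite preserver_invK.
    by rewrite memv_cap preserver_mem //=; apply: (subvP WU); rewrite memW // -mem_annv.
  apply/idP/idP => [Mx|gMU]; first by apply: (subvP WU); rewrite memW.
  rewrite -mem_annv; apply: (subvP XK); apply/memv_imgP; exists (g M); last by rewrite preserver_invK.
  by rewrite memv_cap preserver_mem.
case: (cV' W WV sW); first by rewrite dim_sub_img // dVV'.
- case=> v v0 h; constructor 1; exists v; split=> // M MV.
  rewrite (max (annv n v)) ?mem_annv //.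
    by move=> N /memv_capP[_]; rewrite mem_annv => /eqP; apply: nonunit_of_ker.
  by apply/subvP => N /h; rewrite mem_annv => ->.
- case=> v v0 h; constructor 2; exists v^T; split; first by rewrite trmx_eq0.
  move=> M MV; rewrite (max (lker (lmul v^T (1%:M : 'M_n)))) ?memv_lker_lmul ?mulmx1 //.
    move=> N /memv_capP[_]; rewrite memv_lker_lmul mulmx1 => /eqP e.
    rewrite -unitmx_tr; apply: (nonunit_of_ker v0); apply: trmx_inj.
    by rewrite trmx_mul trmxK trmx0.
  apply/subvP => N NW; rewrite memv_lker_lmul mulmx1; apply/eqP/trmx_inj.
  by rewrite trmx0 trmx_mul trmxK; apply: h; rewrite mem_trV trmxK.
case=> p [q [A [B [fAB p1 q1 pq eW]]]]; constructor 3.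
exists p, q, A, B; split=> //; first by rewrite -eW.
by move=> M MV; rewrite -memv_lker_lmul -eW memW.
Qed.

Lemma coltype_par x1 x2 y1 y2 : coltype V g x1 y1 -> coltype V g x2 y2 -> y2 \in <[y1]>%VS -> x2 \in <[x1]>%VS.
Proof.
move=> [_ h1] [_ h2] /vlineP[c ec]; apply: (annv_sub_parallel dV) => M MV Mx1; apply/eqP.
rewrite h2 // ec -scalemxAr; move/eqP: Mx1; rewrite h1 // => /eqP ->.
by rewrite scaler0.
Qed.

(** Each matrix that annihilates x1 and x2 annihilates x3. *)
Definition dep (x1 x2 x3 : 'cV[K]_n) := forall M : 'M[K]_n, M *m x1 = 0 -> M *m x2 = 0 -> M *m x3 = 0.

Lemma dep_sum x1 x2 x3 : x1 + x2 + x3 = 0 -> [/\ dep x1 x2 x3, dep x1 x3 x2 & dep x2 x3 x1].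
Proof.
move=> e; have eM (M : 'M[K]_n) : M *m x1 + M *m x2 + M *m x3 = 0 by rewrite -!mulmxDr e mulmx0.
split=> M h1 h2; have := eM M; rewrite h1 h2 ?add0r ?addr0 //.
Qed.

(** A dependence between three vectors transfers to the conditions that describe
    their annihilators in V'. It is tested below on rank-one matrices. *)
Lemma dep_img (P1 P2 P3 : 'M[K]_n -> bool) x1 x2 x3 : dep x1 x2 x3 ->
  (forall M, M \in V -> (M *m x1 == 0) = P1 (g M)) ->
  (forall M, M \in V -> (M *m x2 == 0) = P2 (g M)) ->
  (forall M, M \in V -> (M *m x3 == 0) = P3 (g M)) ->
  forall N, N \in V' -> P1 N -> P2 N -> P3 N.
Proof.
move=> d h1 h2 h3 N NV; rewrite -(preserver_imgK NV) -h1 -?h2 -?h3 ?preserver_inv_mem // => /eqP e1 /eqP e2.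
by apply/eqP/d.
Qed.

End Preserver.
End VectorTypes.

(** * All vectors have the same type *)

Section Uniform.
Variable K : fieldType.
Variable n : nat.
Implicit Types (V : {vspace 'M[K]_n}) (g : 'End('M[K]_n)) (x : 'cV[K]_n).

(** The test matrix is p h, where B p = 0 and h separates the columns y1 and y2. *)
Lemma coltype_coltype_spectype V V' g g' x1 x2 x3 y1 y2 : preserver V V' g g' -> x1 + x2 + x3 = 0 ->
  x2 \notin <[x1]>%VS -> coltype V g x1 y1 -> coltype V g x2 y2 -> ~ spectype V V' g x3.
Proof.
move=> cx e ind t1 t2 [p [q [A [B [[fA fB] [p1 q1] [pq _] sub h3]]]]].
have [_ d _] := dep_sum e.
have [p0 p0n Bp0] := @wide_kernel _ _ _ B ltac:(lia).
have /col_sep[h hy1 hy2] : ~ exists c, y2 = c *: y1.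
  move=> yy; move/negP: ind; apply; apply: (coltype_par cx t1 t2); exact/vlineP.
have BNA : B *m (p0 *m h) *m A = 0 by rewrite mulmxA Bp0 !mul0mx.
have := @dep_img _ _ _ _ _ _ cx (fun N => N *m y1 == 0) (fun N => B *m N *m A == 0)
  (fun N => N *m y2 == 0) _ _ _ d t1.2 h3 t2.2 (p0 *m h).
rewrite -!mulmxA hy1 hy2 mulmx0 mulmx1 (mulmxA p0) mulmxA BNA (negPf p0n) !eqxx.
suff -> : p0 *m h \in V' by move/(_ isT isT isT).
by apply: (subvP sub); rewrite memv_lker_lmul BNA.
Qed.

(** The test matrix is p h, where h A = 0; the choice of p depends on whether h
    annihilates y1. *)
Lemma coltype_rowtype_spectype V V' g g' x1 x2 x3 y1 y2 : preserver V V' g g' -> x1 + x2 + x3 = 0 ->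
  coltype V g x1 y1 -> rowtype V g x2 y2 -> ~ spectype V V' g x3.
Proof.
move=> cx e [y10 t1] [y20 t2] [p [q [A [B [[fA fB] [p1 q1] [pq _] sub h3]]]]].
have [_ d132 d231] := dep_sum e.
have [h h0 hA] := @tall_kernel _ _ _ A ltac:(lia).
have BNA p0 : B *m (p0 *m h) *m A = 0 by rewrite -!mulmxA hA !mulmx0.
have NV p0 : p0 *m h \in V' by apply: (subvP sub); rewrite memv_lker_lmul BNA.
have [hy|hy] := eqVneq (h *m y1) 0.
  have [p0 yp0] := neq0_row_ex y20.
  have := @dep_img _ _ _ _ _ _ cx (fun N => N *m y1 == 0) (fun N => B *m N *m A == 0)
    (fun N => y2 *m N == 0) _ _ _ d132 t1 h3 t2 (p0 *m h) (NV p0).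
  rewrite -mulmxA hy mulmx0 BNA !eqxx mulmxA yp0 mul1mx (negPf h0) => H.
  by have := H isT isT.
have [p0 p0n yp0] := @wide_kernel _ _ _ y2 ltac:(lia).
have := @dep_img _ _ _ _ _ _ cx (fun N => y2 *m N == 0) (fun N => B *m N *m A == 0)
    (fun N => N *m y1 == 0) _ _ _ d231 t2 h3 t1 (p0 *m h) (NV p0).
rewrite mulmxA yp0 mul0mx BNA !eqxx => H.
have := H isT isT; rewrite -mulmxA => /eqP/mul_colrow_eq0[] /eqP; by rewrite ?(negPf p0n) ?(negPf hy).
Qed.

(** x is of column type or of row type. *)
Definition nonspecial V g x := (exists y, coltype V g x y) \/ (exists y, rowtype V g x y).

Lemma nonspecial2_spectype V V' g g' x1 x2 x3 : preserver V V' g g' -> x1 + x2 + x3 = 0 ->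
  x2 \notin <[x1]>%VS -> nonspecial V g x1 -> nonspecial V g x2 -> ~ spectype V V' g x3.
Proof.
move=> cx e ind [[y1 t1]|[y1 t1]] [[y2 t2]|[y2 t2]].
- exact: coltype_coltype_spectype cx e ind t1 t2.
- exact: coltype_rowtype_spectype cx e t1 t2.
- by apply: coltype_rowtype_spectype cx _ t2 t1; rewrite (addrC x2).
move/spectype_tr; exact: coltype_coltype_spectype (preserver_tr cx) e ind (rowtype_tr t1) (rowtype_tr t2).
Qed.

(** The kernels of B1 and B2 meet trivially, as the test matrices p h with p in
    both show; then p h with B1 p = 0 and h y = 0 contradicts the condition of the
    second special space. *)
Lemma spectype_spectype_coltype V V' g g' x1 x2 x3 y : preserver V V' g g' -> x1 + x2 + x3 = 0 ->
  spectype V V' g x1 -> spectype V V' g x2 -> ~ coltype V g x3 y.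
Proof.
move=> cx e [p1 [q1 [A1 [B1 [[fA1 fB1] [p1n q1n] [pq1 _] sub1 h1]]]]].
move=> [p2 [q2 [A2 [B2 [[fA2 fB2] [p2n q2n] [pq2 _] sub2 h2]]]]] [y0 t3].
have [d _ _] := dep_sum e; have [_ d132 _] := dep_sum e.
have [p0 p0n Bp0] := @wide_kernel _ _ _ B1 ltac:(lia).
have BN1 h : B1 *m (p0 *m h) *m A1 = 0 by rewrite mulmxA Bp0 !mul0mx.
have NV h : p0 *m h \in V' by apply: (subvP sub1); rewrite memv_lker_lmul BN1.
have B2p0 : B2 *m p0 != 0.
  apply/eqP => B2p; have [h hy] := neq0_col_ex y0.
  have := @dep_img _ _ _ _ _ _ cx (fun N => B1 *m N *m A1 == 0) (fun N => B2 *m N *m A2 == 0)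
    (fun N => N *m y == 0) _ _ _ d h1 h2 t3 (p0 *m h) (NV h).
  rewrite BN1 -(mulmxA p0) hy mulmx1 mulmxA B2p !mul0mx (negPf p0n) !eqxx => H.
  by have := H isT isT.
have [h hy hA] : exists2 h : 'rV_n, h *m y = 0 & h *m A2 != 0.
  apply: NNPP => no; have [z zy] := neq0_col_ex y0.
  have eA : A2 = y *m (z *m A2).
    apply/subr0_eq/eq0_of_mull => h; apply: NNPP => hn.
    case: no; exists (h - h *m y *m z); first by rewrite mulmxBl -!mulmxA zy mulmx1 subrr.
    by move/eqP: hn; rewrite mulmxBl mulmxBr !mulmxA.
  have [t t0 zt] := @wide_kernel _ _ _ (z *m A2) ltac:(lia).
  case/eqP: t0; apply: (free_right fA2).
  by rewrite eA -mulmxA zt mulmx0.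
have := @dep_img _ _ _ _ _ _ cx (fun N => B1 *m N *m A1 == 0) (fun N => N *m y == 0)
    (fun N => B2 *m N *m A2 == 0) _ _ _ d132 h1 t3 h2 (p0 *m h) (NV h).
rewrite BN1 -(mulmxA p0) hy mulmx0 !eqxx mulmxA -mulmxA => H.
have /eqP/mul_colrow_eq0[] := H isT isT; apply/eqP => //.
Qed.

Lemma spectype_spectype_nonspecial V V' g g' x1 x2 x3 : preserver V V' g g' -> x1 + x2 + x3 = 0 ->
  spectype V V' g x1 -> spectype V V' g x2 -> ~ nonspecial V g x3.
Proof.
move=> cx e t1 t2 [[y]|[y]]; first exact: spectype_spectype_coltype cx e t1 t2.
move/rowtype_tr; exact: spectype_spectype_coltype (preserver_tr cx) e (spectype_tr t1) (spectype_tr t2).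
Qed.

Lemma spectype_scale V V' g x (c : K) : c != 0 -> spectype V V' g x -> spectype V V' g (c *: x).
Proof.
move=> c0 [p [q [A [B [f pq1 pq sub h]]]]]; exists p, q, A, B; split=> // M MV.
by rewrite -scalemxAr scaler_eq0 (negPf c0) h.
Qed.

(** If one nonzero vector is special, then so are all. *)
Lemma spectype_all V V' g g' x0 x : preserver V V' g g' -> x0 != 0 -> spectype V V' g x0 -> x != 0 -> spectype V V' g x.
Proof.
move=> cx x0n t0 x_n0.
have [/vlineP[c ex]|ind] := boolP (x \in <[x0]>%VS).
  rewrite ex; apply: spectype_scale => //; apply: contraNneq x_n0 => c0.
  by rewrite ex c0 scale0r.
have x3n : - (x + x0) != 0.
  apply: contraNneq ind => /eqP; rewrite oppr_eq0 addr_eq0 => /eqP ->.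
  by rewrite memvN memv_line.
suff ns : ~ nonspecial V g x.
  by case: (classify cx x_n0) => // h; case: ns; [left|right].
move=> nx.
have ns3 : nonspecial V g (- (x + x0)) -> False.
  move=> n3; apply: (nonspecial2_spectype cx _ _ nx n3 t0).
    by rewrite addrAC subrr.
  rewrite memvN; apply/negP => h; have : x0 \in <[x]>%VS.
    by have := memvB h (memv_line x); rewrite addrAC subrr add0r.
  by move/(vline_sym x0n); apply/negP.
have [[y t1]|[y t2]|t3] := classify cx x3n.
- by apply: ns3; left; exists y.
- by apply: ns3; right; exists y.
apply: (spectype_spectype_nonspecial cx _ t0 t3 nx).
by rewrite opprD (addrC (- x)) addrA subrr add0r addNr.
Qed.

(** Parallel vectors cannot be of column type and of row type. *)
Lemma coltype_rowtype_par V V' g g' x1 x2 y1 y2 : preserver V V' g g' -> x2 != 0 -> x2 \in <[x1]>%VS ->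
  coltype V g x1 y1 -> ~ rowtype V g x2 y2.
Proof.
move=> cx x2n /vlineP[c ex] [y1n t1] [y2n t2].
have c0 : c != 0 by apply: contraNneq x2n => c0; rewrite ex c0 scale0r.
have [q yq] := neq0_row_ex y2n.
have q0 : q != 0 := neq0_of_mulr1 yq.
have [h [h0 NV hy]] := rank_one_row y1 (let: And5 _ _ d _ _ := cx in d) q0.
have e M : M \in V -> (M *m x2 == 0) = (M *m x1 == 0).
  by rewrite ex -scalemxAr scaler_eq0 (negPf c0).
have := e _ (preserver_inv_mem cx NV); rewrite t2 ?t1 ?(preserver_inv_mem cx NV) // (preserver_imgK cx NV) mulmxA yq mul1mx.
by rewrite -mulmxA hy mulmx0 eqxx (negPf h0).
Qed.

Lemma coltype_rowtype_coltype V V' g g' x1 x2 x3 y1 y2 y3 : preserver V V' g g' -> x1 + x2 + x3 = 0 ->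
  x3 \notin <[x1]>%VS -> coltype V g x1 y1 -> rowtype V g x2 y2 -> ~ coltype V g x3 y3.
Proof.
move=> cx e ind t1 [y2n t2] t3; have [d _ _] := dep_sum e.
have /col_sep[h hy1 hy3] : ~ exists c, y3 = c *: y1.
  move=> yy; move/negP: ind; apply; apply: (coltype_par cx t1 t3); exact/vlineP.
have h0 : h != 0 := neq0_of_mul1r hy3.
have [p [p0 NV yp]] := rank_one_col (let: And5 _ _ d _ _ := cx in d) y2 h0.
have := @dep_img _ _ _ _ _ _ cx (fun N => N *m y1 == 0) (fun N => y2 *m N == 0)
    (fun N => N *m y3 == 0) _ _ _ d t1.2 t2 t3.2 (p *m h) NV.
rewrite -!mulmxA hy1 hy3 mulmx0 mulmx1 (mulmxA y2) yp mul0mx !eqxx (negPf p0) => H.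
by have := H isT isT.
Qed.

Lemma coltype_rowtype V V' g g' x1 x2 y1 y2 : preserver V V' g g' ->
  (forall x, x != 0 -> ~ spectype V V' g x) -> x2 != 0 -> x1 != 0 ->
  coltype V g x1 y1 -> ~ rowtype V g x2 y2.
Proof.
move=> cx n3 x2n x1n t1 t2.
have [ind|ind] := boolP (x2 \in <[x1]>%VS); first exact: coltype_rowtype_par cx x2n ind t1 t2.
have i21 : x1 \notin <[x2]>%VS.
  exact: contra (vline_sym x1n) ind.
pose x3 := - (x1 + x2).
have e : x1 + x2 + x3 = 0 by rewrite subrr.
have i1 : x3 \notin <[x1]>%VS.
  apply: contra ind; rewrite memvN => h.
  by have := memvB h (memv_line x1); rewrite addrAC subrr add0r.
have i2 : x3 \notin <[x2]>%VS.
  apply: contra i21; rewrite memvN => h.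
  by have := memvB h (memv_line x2); rewrite addrK.
have x3n : x3 != 0 by apply: contraNneq i1 => ->; apply: mem0v.
case: (classify cx x3n) => [[y t3]|[y t3]|]; last exact: n3.
  exact: coltype_rowtype_coltype cx e i1 t1 t2 t3.
apply: (coltype_rowtype_coltype (preserver_tr cx) _ i2 (rowtype_tr t2) (coltype_tr t1) (rowtype_tr t3)).
by rewrite (addrC x2).
Qed.

(** All the nonzero vectors have the same type. *)
Lemma uniform_type V V' g g' : preserver V V' g g' ->
  [\/ forall x, x != 0 -> spectype V V' g x, forall x, x != 0 -> exists y, coltype V g x y
    | forall x, x != 0 -> exists y, rowtype V g x y].
Proof.
move=> cx.
have [[x0 [x0n t0]]|n3] := classic (exists x0, x0 != 0 /\ spectype V V' g x0).
  by constructor 1 => x; apply: spectype_all cx x0n t0.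
have {}n3 x : x != 0 -> ~ spectype V V' g x by move=> xn t; case: n3; exists x.
have [[x1 [x1n [y1 t1]]]|n1] := classic (exists x, x != 0 /\ exists y, coltype V g x y).
  constructor 2 => x xn; case: (classify cx xn) => // [[y t2]|t3]; last by case: (n3 x xn).
  by case: (coltype_rowtype cx n3 xn x1n t1 t2).
constructor 3 => x xn; case: (classify cx xn) => // [[y t1]|t3]; last by case: (n3 x xn).
by case: n1; exists x; split => //; exists y.
Qed.

End Uniform.

(** * The special type does not occur *)

Section Special.
Variable K : fieldType.
Variable n : nat.
Implicit Types (V : {vspace 'M[K]_n}) (g : 'End('M[K]_n)) (x : 'cV[K]_n).

(** All the nonzero vectors are special. *)
Definition all_spectype V V' g := forall x, x != 0 -> spectype V V' g x.

(** The special type with a matrix A of two columns. *)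
Definition special_plane V V' g x := exists q, spectype_at 2 q V V' g x.

Lemma special_plane_or V V' g x : spectype V V' g x ->
  special_plane V V' g x \/ special_plane V (trV V') (trlf K n \o g)%VF x.
Proof.
case=> p [q h]; have [_ [_ [_ _ [_ [e|e]] _ _]]] := h; first by left; exists q; rewrite -e.
by right; exists p; apply: spectype_at_tr; rewrite -e.
Qed.

(** If x is special with image {N | B N A = 0}, A having two columns, then a
    column a of A, being special for the inverse map, gives a special space
    {M | B' M A' = 0} contained in V. A subspace of codimension at most one of it
    annihilates x, which forces A' to have two columns whose span contains x. *)
Lemma special_cover V V' g g' x : preserver V V' g g' -> all_spectype V' V g' -> x != 0 ->
  special_plane V V' g x ->
  exists A : 'M[K]_(n, 2), [/\ row_free A^T, forall M, M *m A = 0 -> M \in V &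
    forall h : 'rV_n, h *m A = 0 -> h *m x = 0].
Proof.
move=> cx t' xn [q [A [B [[fA fB] [_ q1] [qn _] sub h]]]].
pose d : 'cV[K]_2 := delta_mx 0 0.
have dn : d != 0 by apply: delta_col_neq0.
have an : A *m d != 0 by apply: contraNneq dn => /(free_right fA) ->.
have [p' [q' [A' [B' [[fA' fB'] [p'1 q'1] [pq' pq2'] sub' h']]]]] := t' _ an.
pose L := lker (lmul B A); pose Z := lker (lmul B' A').
have dL : (\dim L + n.*2 = n * n + 2)%N by apply: special_dim fA fB _ _; lia.
have dZ : (\dim Z + n.*2 = n * n + 2)%N by apply: special_dim fA' fB' pq' pq2'.
(* For N in L the column N a lies in the kernel of B, which is a line. *)
have dLa : (\dim L <= \dim (L :&: annv n (A *m d)) + 1)%N.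
  have := limg_ker_dim (lmul (1%:M : 'M_n) (A *m d)) L.
  suff : (\dim (lmul (1%:M : 'M_n) (A *m d) @: L) <= 1)%N by rewrite /annv; clear; dlia.
  have := dim_lker_lmul fB (row_free1T K 1).
  suff : (lmul (1%:M : 'M_n) (A *m d) @: L <= lker (lmul B (1%:M : 'M_1)))%VS.
    by move/dimvS; move: qn; clear; abstract_dims; nia.
  apply/subvP => Y /memv_imgP[N + ->]; rewrite !memv_lker_lmul lmulE mul1mx mulmx1.
  by move=> /eqP BNA; rewrite !mulmxA BNA mul0mx.
have gL N : N \in L -> N \in V' by apply: (subvP sub).
have dZx : (\dim (L :&: annv n (A *m d)) <= \dim (Z :&: annv n x))%N.
  rewrite -(dim_sub_img (preserver_sym cx) (U := (L :&: annv n (A *m d))%VS)); last first.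
    by apply/subvP => N /memv_capP[/gL].
  apply/dimvS/subvP => Y /memv_imgP[N /memv_capP[NL]]; rewrite mem_annv => Na ->.
  have NV := gL _ NL; apply/memv_capP; split.
    by rewrite memv_lker_lmul -(h' _ NV) Na.
  by rewrite mem_annv (h _ (preserver_inv_mem cx NV)) (preserver_imgK cx NV) -memv_lker_lmul.
have dimZx : (\dim (lmul (1%:M : 'M_n) x @: Z) <= 1)%N.
  by have := limg_ker_dim (lmul (1%:M : 'M_n) x) Z; move: dL dZ dLa dZx; clear; rewrite /annv; dlia.
have ex_h : forall h : 'rV_n, h *m A' = 0 -> h *m x = 0.
  move=> h0 hA; apply: NNPP => hx.
  have : (fullv <= lmul (1%:M : 'M_n) x @: Z)%VS.
    apply/subvP => u _; have e : (h0 *m x) 0 0 != 0.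
      by apply: contra_not_neq hx => e; rewrite [_ *m x]mx11_scalar e raddf0.
    apply/memv_imgP; exists (((h0 *m x) 0 0)^-1 *: u *m h0).
      by rewrite memv_lker_lmul -!mulmxA hA !mulmx0.
    rewrite lmulE mul1mx -mulmxA mul_col_scal scalerA mulfV ?scale1r //.
  by move/dimvS; rewrite dim_fullM; move: dimZx q1 qn; clear; dlia.
(* Z x contains the kernel of B', of dimension p' - 1. *)
have p'2 : p' = 2%N.
  have [y yx] := neq0_col_ex xn.
  have : (lker (lmul B' (1%:M : 'M_1)) <= lmul (1%:M : 'M_n) x @: Z)%VS.
    apply/subvP => u; rewrite memv_lker_lmul mulmx1 => /eqP Bu.
    apply/memv_imgP; exists (u *m y); last by rewrite lmulE mul1mx -mulmxA yx mulmx1.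
    by rewrite memv_lker_lmul mulmxA Bu !mul0mx.
  move/dimvS; have := dim_lker_lmul fB' (row_free1T K 1).
  by move: dimZx q1 qn pq' p'1; clear; abstract_dims; nia.
subst p'; exists A'; split=> // M MA; apply: (subvP sub').
by rewrite memv_lker_lmul -mulmxA MA mulmx0.
Qed.

(** Not everything is special. Each x lies in a plane, the span of a matrix A with
    two columns, such that V contains all M with M A = 0. Two such planes produce
    a vector c whose annihilator in V has dimension at least n^2 - n, too large
    for c to be special. *)
Lemma all_spectype_false V V' g g' : preserver V V' g g' -> (0 < n)%N ->
  all_spectype V V' g -> all_spectype V' V g' -> ~ all_spectype (trV V') V (g' \o trlf K n)%VF.
Proof.
move=> cx n0 t t' tt.
have cover x : x != 0 -> exists A : 'M[K]_(n, 2), [/\ row_free A^T, forall M, M *m A = 0 -> M \in V &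
    forall h : 'rV_n, h *m A = 0 -> h *m x = 0].
  move=> xn; case: (special_plane_or (t x xn)).
    exact: special_cover cx t' xn.
  exact: special_cover (preserver_tr cx) tt xn.
have [x0 x0n] : exists x : 'cV[K]_n, x != 0.
  by exists (delta_mx (Ordinal n0) 0); apply: delta_col_neq0.
have n3 : (2 < n)%N by case: (t x0 x0n) => p [q [_ [_ [_ [p1 q1] [e _] _ _]]]]; lia.
have [A0 [fA0 sub0 _]] := cover _ x0n.
have [h h0 hA0] := tall_kernel A0 n3.
have [x1 hx1] := neq0_row_ex h0.
have x1n : x1 != 0 := neq0_of_mulr1 hx1.
have [A1 [fA1 sub1 hA1]] := cover _ x1n.
have [s sn hs] := wide_kernel (h *m A1) (isT : 1 < 2)%N.
pose c := A1 *m s.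
have cn : c != 0 by apply: contraNneq sn => /(free_right fA1) ->.
have [p [q [A [B [[fA fB] [p1 q1] [pq pq2] sub hc]]]]] := t _ cn.
have dL := special_dim fA fB pq pq2.
pose X := lker (lmul (1%:M : 'M_n) A1).
have dX := dim_lker_lmul (row_free1 K n) fA1.
have memX M : (M \in X) = (M *m A1 == 0) by rewrite memv_lker_lmul mul1mx.
have XC : (X :&: right_line n h = 0)%VS.
  apply/eqP; rewrite -subv0; apply/subvP => M /memv_capP[MX /right_lineP[u eM]].
  move: MX; rewrite eM memX -mulmxA memv0 => /eqP/mul_colrow_eq0[->|e]; first by rewrite mul0mx.
  by case/eqP: (matrix_nonzero1 K 0); rewrite -hx1; apply: hA1.
(* The matrices p h are in V because h A0 = 0; they annihilate c = A1 s by the choice of s. *)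
have subV : (X + right_line n h <= V :&: annv n c)%VS.
  rewrite subv_add; apply/andP; split; apply/subvP => M.
    rewrite memX memv_cap mem_annv => /eqP MA; rewrite sub1 //.
    by rewrite mulmxA MA mul0mx eqxx.
  case/right_lineP=> u ->; rewrite memv_cap mem_annv; rewrite (sub0 (u *m h)); last by rewrite -mulmxA hA0 mulmx0.
  by rewrite -mulmxA /c (mulmxA h) hs mulmx0 eqxx.
have : (\dim (V :&: annv n c) <= \dim (lker (lmul B A)))%N.
  rewrite -(dim_sub_img cx (U := (V :&: annv n c)%VS)) ?capvSl //.
  apply/dimvS/subvP => Y /memv_imgP[M /memv_capP[MV]]; rewrite mem_annv => Mc ->.
  by rewrite memv_lker_lmul -hc.
move/(leq_trans (dimvS subV)); rewrite dimv_disjoint_sum // dim_right_line //.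
by move: dX dL n3; rewrite -/X; clear; abstract_dims; nia.
Qed.

End Special.

(** * Reconstruction of the equivalence *)

Section MxOfFun.
Variable K : fieldType.

(** A column annihilated by the left kernel of A is in the column space of A. *)
Lemma col_span m n (A : 'M[K]_(m, n)) (y : 'cV[K]_m) :
  (forall h : 'rV_m, h *m A = 0 -> h *m y = 0) -> exists s, y = A *m s.
Proof.
move=> H; have : (y^T <= A^T)%MS.
  rewrite submxE; apply/eqP/trmx_inj; rewrite trmx_mul trmxK trmx0.
  apply/row_matrixP => i; rewrite row_mul row0; apply: H; rewrite -row_mul.
  apply/row_matrixP => j; rewrite [X in row j (row i X)](_ : _ = 0) ?row0 //.
  by apply: trmx_inj; rewrite trmx_mul trmxK trmx0 mulmx_coker.
by case/submxP => D e; exists D^T; apply: trmx_inj; rewrite e trmx_mul trmxK.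
Qed.

Lemma col_span2 m (y1 y2 y : 'cV[K]_m) :
  (forall h : 'rV_m, h *m y1 = 0 -> h *m y2 = 0 -> h *m y = 0) ->
  exists s t, y = s *: y1 + t *: y2.
Proof.
move=> H; have [h|s ->] := @col_span _ _ (row_mx y1 y2) y.
  by rewrite mul_mx_row => /eqP; rewrite row_mx_eq0 => /andP[/eqP h1 /eqP h2]; apply: H.
exists (usubmx s 0 0), (dsubmx s 0 0); rewrite -!mul_col_scal -mul_row_col.
by rewrite -{1}(vsubmxK s).
Qed.

End MxOfFun.

Section Coordinates.
Variable K : fieldType.
Variables (n : nat) (V V' : {vspace 'M[K]_n}) (g g' : 'End('M[K]_n)).
Hypothesis cx : preserver V V' g g'.
Hypothesis t1 : forall x : 'cV[K]_n, x != 0 -> exists y, coltype V g x y.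

Let dV : (n * n + 2 <= \dim V + n)%N. Proof. by case: cx. Qed.
Let dV' : (n * n + 2 <= \dim V' + n)%N. Proof. by case: cx. Qed.

Lemma coltype_scale x y c : c != 0 -> coltype V g x y -> coltype V g x (c *: y).
Proof.
move=> c0 [y0 h]; split; first by rewrite scaler_eq0 (negPf c0).
by move=> M MV; rewrite -scalemxAr scaler_eq0 (negPf c0) h.
Qed.

Lemma coltype_scalel x y c : c != 0 -> coltype V g x y -> coltype V g (c *: x) y.
Proof.
move=> c0 [y0 h]; split=> // M MV.
by rewrite -scalemxAr scaler_eq0 (negPf c0) h.
Qed.

Lemma coltype_uniq x y y' : coltype V g x y -> coltype V g x y' -> y' \in <[y]>%VS.
Proof.
move=> [_ h] [_ h']; apply: (annv_sub_parallel dV') => N NV Ny; apply/eqP.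
by rewrite -(preserver_imgK cx NV) -h' ?h ?(preserver_inv_mem cx NV) // (preserver_imgK cx NV) Ny eqxx.
Qed.

(** Collinearity is preserved: if x is a combination of x1 and x2, then the vector
    attached to x is a combination of those attached to x1 and x2. *)
Lemma coltype_plane (s t : K) x1 x2 y1 y2 y : coltype V g x1 y1 -> coltype V g x2 y2 ->
  coltype V g (s *: x1 + t *: x2) y -> exists a b, y = a *: y1 + b *: y2.
Proof.
move=> [_ h1] [_ h2] [_ h]; apply: col_span2 => r r1 r2; apply: NNPP => ry.
have r0 : r != 0 by apply/eqP => r0; case: ry; rewrite r0 mul0mx.
have [p [p0 NV _]] := rank_one_col dV' 0 r0.
have gN := preserver_inv_mem cx NV; have eN := preserver_imgK cx NV.
have : g' (p *m r) *m (s *: x1 + t *: x2) == 0.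
  rewrite mulmxDr -!scalemxAr.
  have /eqP -> : g' (p *m r) *m x1 == 0 by rewrite h1 // eN -mulmxA r1 mulmx0.
  have /eqP -> : g' (p *m r) *m x2 == 0 by rewrite h2 // eN -mulmxA r2 mulmx0.
  by rewrite !scaler0 addr0.
rewrite h // eN -mulmxA => /eqP/mul_colrow_eq0[e|//].
by rewrite e eqxx in p0.
Qed.

Variables (w : 'cV[K]_n) (h1 h2 : 'rV[K]_n) (z1 z2 : 'cV[K]_n).
Hypotheses (w0 : w != 0) (Vh1 : w *m h1 \in V) (Vh2 : w *m h2 \in V).
Hypotheses (h11 : h1 *m z1 = 1%:M) (h12 : h1 *m z2 = 0) (h21 : h2 *m z1 = 0) (h22 : h2 *m z2 = 1%:M).

Let a1 (x : 'cV[K]_n) : K := (h1 *m x) 0 0.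
Let a2 (x : 'cV[K]_n) : K := (h2 *m x) 0 0.
Let F1 := g (w *m h1).
Let F2 := g (w *m h2).

Let a1D x y : a1 (x + y) = a1 x + a1 y. Proof. by rewrite /a1 mulmxDr mxE. Qed.
Let a2D x y : a2 (x + y) = a2 x + a2 y. Proof. by rewrite /a2 mulmxDr mxE. Qed.
Let a1Z c x : a1 (c *: x) = c * a1 x. Proof. by rewrite /a1 -scalemxAr mxE. Qed.
Let a2Z c x : a2 (c *: x) = c * a2 x. Proof. by rewrite /a2 -scalemxAr mxE. Qed.
Let a11 : a1 z1 = 1. Proof. by rewrite /a1 h11 mxE eqxx. Qed.
Let a12 : a1 z2 = 0. Proof. by rewrite /a1 h12 mxE. Qed.
Let a21 : a2 z1 = 0. Proof. by rewrite /a2 h21 mxE. Qed.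
Let a22 : a2 z2 = 1. Proof. by rewrite /a2 h22 mxE eqxx. Qed.

(** The image of the matrix s w h1 + t w h2 of V tells whether s a1 x + t a2 x
    vanishes. *)
Let comb (s t : K) x y : coltype V g x y -> (s * a1 x + t * a2 x == 0) = (s *: (F1 *m y) + t *: (F2 *m y) == 0).
Proof.
move=> [_ h]; have MV : s *: (w *m h1) + t *: (w *m h2) \in V by rewrite memvD ?memvZ.
have := h _ MV; rewrite raddfD /= !linearZ /= !mulmxDl -!scalemxAl -!mulmxA !mul_col_scal.
by rewrite !scalerA -scalerDl scaler_eq0 (negPf w0) orbF.
Qed.

Let z0 := z1 + z2.

(** F1 - F2 is the image of a matrix that annihilates z0 = z1 + z2. *)
Let exists_w' : exists w', [/\ w' != 0 & exists y, [/\ coltype V g z0 y, F1 *m y = w' & F2 *m y = w']].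
Proof.
have z0n : z0 != 0.
  by apply: (neq0_of_mulr1 (y := h1)); rewrite mulmxDr h11 h12 addr0.
have [y ty] := t1 z0n; exists (F1 *m y); split.
  have := comb 1 0 ty; rewrite !scale0r scale1r mul0r !addr0 mul1r a1D a11 a12 addr0 => <-.
  exact: oner_neq0.
exists y; split=> //; apply/eqP.
have := comb (-1) 1 ty; rewrite a1D a2D a11 a12 a21 a22 !addr0 add0r !mulr1 addNr eqxx.
by move/esym; rewrite scaleN1r scale1r addrC subr_eq0.
Qed.

Let isw' w' := w' != 0 /\ exists y, [/\ coltype V g z0 y, F1 *m y = w' & F2 *m y = w'].

(** The common value of F1 and F2 on a vector attached to z0. *)
Let w' := epsilon (inhabits 0) isw'.
Let w'P : isw' w'.
Proof. by apply: (epsilon_spec (inhabits 0) isw'); case: exists_w' => x [? ?]; exists x. Qed.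

Let w'0 : w' != 0. Proof. by case: w'P. Qed.

(** h1 x and h2 x are not both zero. *)
Let offN x := (a1 x != 0) || (a2 x != 0).
Let offN_neq0 x : offN x -> x != 0.
Proof. by apply: contraTneq => ->; rewrite /offN /a1 /a2 !mulmx0 !mxE eqxx. Qed.

(** The normalisation: q is attached to x, and F1 q and F2 q are the multiples
    a1 x and a2 x of the fixed column w'. *)
Let Q x q := [/\ coltype V g x q, F1 *m q = a1 x *: w' & F2 *m q = a2 x *: w'].

(** The image of w h, for h = h1 or h = h2, sends all the attached vectors into the
    line of w'. Indeed x is a combination of z0 and of a vector annihilated by h. *)
Let F_line h (F := g (w *m h)) x y : w *m h \in V -> (h *m z0) 0 0 = 1 ->
  (exists y0, coltype V g z0 y0 /\ F *m y0 = w') -> coltype V g x y -> exists s, F *m y = s *: w'.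
Proof.
move=> Vh hz0 [y0 [ty0 e0]] ty.
have ker v u : coltype V g v u -> h *m v = 0 -> F *m u = 0.
  by case=> _ hv v0; apply/eqP; rewrite -hv // -mulmxA v0 mulmx0.
pose a := (h *m x) 0 0; have [u0|u0] := eqVneq (x - a *: z0) 0.
  have ex : x = a *: z0 by apply/eqP; rewrite -subr_eq0 u0.
  have [a0|a0] := eqVneq a 0.
    exists 0; rewrite scale0r; apply: (ker _ _ ty).
    by rewrite [LHS]mx11_scalar -/a a0 raddf0.
  have ty0' := coltype_scalel a0 ty0; rewrite -ex in ty0'.
  have /vlineP[c ->] := coltype_uniq ty0' ty.
  by exists c; rewrite -scalemxAr e0.
have [yu tu] := t1 u0.
have ex : x = a *: z0 + 1 *: (x - a *: z0) by rewrite scale1r addrC subrK.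
rewrite [x in coltype _ _ x _]ex in ty.
have [c [d ->]] := coltype_plane ty0 tu ty; exists c.
rewrite mulmxDr -!scalemxAr e0 (ker _ _ tu) ?scaler0 ?addr0 //.
by rewrite mulmxBr -scalemxAr [h *m x]mx11_scalar [h *m z0]mx11_scalar hz0 scale_scalar_mx mulr1 subrr.
Qed.

Let Q_ex x : offN x -> exists q, Q x q.
Proof.
move=> xN; have [y ty] := t1 (offN_neq0 xN).
have [_ [y0 [ty0 e1 e2]]] := w'P.
have [||s es] := F_line Vh1 _ _ ty; [by rewrite -[LHS]/(a1 z0) a1D a11 a12 addr0 | by exists y0 |].
have [||s' es'] := F_line Vh2 _ _ ty; [by rewrite -[LHS]/(a2 z0) a2D a21 a22 add0r | by exists y0 |].
have zero (a b : K) : (a * a1 x + b * a2 x == 0) = (a * s + b * s' == 0).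
  by rewrite (comb a b ty) es es' !scalerA -scalerDl scaler_eq0 (negPf w'0) orbF.
have e : a2 x * s = a1 x * s'.
  have := zero (a2 x) (- a1 x); rewrite mulNr (mulrC (a2 x)) subrr eqxx mulNr => /esym.
  by rewrite subr_eq0 => /eqP.
have s10 : (a1 x == 0) = (s == 0) by have := zero 1 0; rewrite !mul1r !mul0r !addr0.
have s20 : (a2 x == 0) = (s' == 0) by have := zero 0 1; rewrite !mul1r !mul0r !add0r.
(* (s, s') and (a1 x, a2 x) are proportional and nonzero. *)
have [t [tn et1 et2]] : exists t, [/\ t != 0, a1 x = t * s & a2 x = t * s'].
  have [a0|a0] := eqVneq (a1 x) 0.
    have a20 : a2 x != 0 by move: xN; rewrite /offN a0 eqxx.
    have s'0 : s' != 0 by rewrite -s20.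
    exists (a2 x / s'); rewrite mulf_neq0 ?invr_eq0 // divfK //; split=> //.
    by move: s10; rewrite a0 eqxx => /esym/eqP ->; rewrite mulr0.
  have s0 : s != 0 by rewrite -s10.
  exists (a1 x / s); rewrite mulf_neq0 ?invr_eq0 // divfK //; split=> //.
  by rewrite mulrAC -e mulfK.
exists (t *: y); split; first exact: coltype_scale.
  by rewrite -scalemxAr es scalerA et1.
by rewrite -scalemxAr es' scalerA et2.
Qed.

Let Q_uniq x q r : offN x -> Q x q -> Q x r -> q = r.
Proof.
move=> xN [tq q1 q2] [tr r1 r2]; have /vlineP[c ec] := coltype_uniq tq tr.
suff c1 : c = 1 by rewrite ec c1 scale1r.
have [/eqP a0|a0] := boolP (a1 x == 0).
  have a20 : a2 x != 0 by move: xN; rewrite /offN a0 eqxx.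
  have := r2; rewrite ec -scalemxAr q2 scalerA => /eqP; rewrite -subr_eq0 -scalerBl scaler_eq0.
  rewrite (negPf w'0) orbF subr_eq0 -[X in _ == X]mul1r => /eqP; exact: mulIf.
have := r1; rewrite ec -scalemxAr q1 scalerA => /eqP; rewrite -subr_eq0 -scalerBl scaler_eq0.
rewrite (negPf w'0) orbF subr_eq0 -[X in _ == X]mul1r => /eqP; exact: mulIf.
Qed.

Let Q_scale c x q : c != 0 -> Q x q -> Q (c *: x) (c *: q).
Proof.
move=> c0 [tq e1 e2]; split; first by apply/coltype_scale/coltype_scalel.
  by rewrite -scalemxAr e1 scalerA a1Z.
by rewrite -scalemxAr e2 scalerA a2Z.
Qed.

(** The coordinates (a1, a2) of x and x' are independent. *)
Let indep x x' := a1 x * a2 x' - a2 x * a1 x' != 0.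

Let indep_offN x x' : indep x x' -> [/\ offN x, offN x' & offN (x + x')].
Proof.
rewrite /indep /offN => D; split; rewrite -negb_and; apply: contra D => /andP[/eqP A1 /eqP A2].
- by rewrite A1 A2 !mul0r subrr.
- by rewrite A1 A2 !mulr0 subrr.
have -> : a1 x = - a1 x' by apply/eqP; rewrite -addr_eq0 -a1D A1.
have -> : a2 x = - a2 x' by apply/eqP; rewrite -addr_eq0 -a2D A2.
by apply/eqP; ring.
Qed.

Let Q_indep x x' q q' : indep x x' -> Q x q -> Q x' q' -> Q (x + x') (q + q').
Proof.
move=> D [tq e1 e2] [tq' e1' e2']; have [_ _ xN] := indep_offN D; rewrite /indep in D.
have [r Qr] := Q_ex xN; have [tr r1 r2] := Qr.
have [s [t er]] : exists s t, r = s *: q + t *: q'.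
  by apply: (coltype_plane (s := 1) (t := 1) tq tq'); rewrite !scale1r.
have E1 : s * a1 x + t * a1 x' = a1 x + a1 x'.
  move/eqP: r1; rewrite er mulmxDr -!scalemxAr e1 e1' !scalerA -scalerDl a1D -subr_eq0 -scalerBl.
  by rewrite scaler_eq0 (negPf w'0) orbF subr_eq0 => /eqP.
have E2 : s * a2 x + t * a2 x' = a2 x + a2 x'.
  move/eqP: r2; rewrite er mulmxDr -!scalemxAr e2 e2' !scalerA -scalerDl a2D -subr_eq0 -scalerBl.
  by rewrite scaler_eq0 (negPf w'0) orbF subr_eq0 => /eqP.
have s1 : s = 1.
  apply: (mulIf D); rewrite mul1r.
  have -> : s * (a1 x * a2 x' - a2 x * a1 x') =
    (s * a1 x + t * a1 x') * a2 x' - (s * a2 x + t * a2 x') * a1 x' by ring.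
  by rewrite E1 E2; ring.
have t1' : t = 1.
  apply: (mulIf D); rewrite mul1r.
  have -> : t * (a1 x * a2 x' - a2 x * a1 x') =
    (s * a2 x + t * a2 x') * a1 x - (s * a1 x + t * a1 x') * a2 x by ring.
  by rewrite E1 E2; ring.
suff <- : r = q + q' by [].
by rewrite er s1 t1' !scale1r.
Qed.

(** The normalised vector attached to x; meaningful only when [offN x]. *)
Let q x := epsilon (inhabits 0) (Q x).
Let qP x : offN x -> Q x (q x).
Proof. by move=> xN; apply: (epsilon_spec (inhabits 0) (Q x)); apply: Q_ex. Qed.

Let qE x r : offN x -> Q x r -> q x = r.
Proof. by move=> xN; apply: (Q_uniq xN (qP xN)). Qed.

Let q_indep x x' : indep x x' -> q (x + x') = q x + q x'.
Proof.
move=> D; have [n1 n2 n3] := indep_offN D.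
by apply: qE => //; apply: Q_indep => //; apply: qP.
Qed.

Let indep_trans x x' z : indep x z -> ~~ indep x x' -> offN x' -> indep x' z.
Proof.
rewrite /indep /offN -negb_and => D /negPn; rewrite subr_eq0 => /eqP e; apply: contra.
rewrite subr_eq0 => /eqP e'; apply/andP; split; apply/eqP/(mulIf D); rewrite mul0r.
  have -> : a1 x' * (a1 x * a2 z - a2 x * a1 z) =
    a1 x * (a1 x' * a2 z) - a2 x * a1 x' * a1 z by ring.
  by rewrite e' -e; ring.
have -> : a2 x' * (a1 x * a2 z - a2 x * a1 z) =
    a1 x * a2 x' * a2 z - a2 x * (a2 x' * a1 z) by ring.
by rewrite e -e'; ring.
Qed.

(** When the coordinates of x and x' are proportional, additivity is obtained by
    adding a third vector with independent coordinates. *)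
Let q_add x x' : offN x -> offN x' -> offN (x + x') -> q (x + x') = q x + q x'.
Proof.
move=> xN x'N sN; have [|D] := boolP (indep x x'); first exact: q_indep.
have [z Dz] : exists z, indep x z.
  have [/eqP a0|a0] := boolP (a1 x == 0).
    exists z1; rewrite /indep a11 a21 mulr0 mulr1 sub0r oppr_eq0.
    by move: xN; rewrite /offN a0 eqxx.
  by exists z2; rewrite /indep a12 a22 mulr0 mulr1 subr0.
have Ds : indep (x + x') z.
  apply: indep_trans Dz _ sN; apply: contra D; rewrite /indep a1D a2D.
  by congr (_ != 0); ring.
have D' := indep_trans Dz D x'N.
have D'' : indep x (x' + z).
  apply: contra Dz; move/negPn: D; rewrite subr_eq0 a1D a2D => /eqP e.
  by rewrite !mulrDr e opprD addrACA subrr add0r.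
apply: (addIr (q z)); rewrite -(q_indep Ds) -addrA (q_indep D'') (q_indep D').
by rewrite addrA.
Qed.

(** The normalised vector for all x; on the common kernel of h1 and h2 it is the
    difference of two normalised vectors. *)
Let F x := if offN x then q x else q (x + z1) - q z1.

Let on0 x : ~~ offN x -> a1 x = 0 /\ a2 x = 0.
Proof. by rewrite /offN -negb_and negbK => /andP[/eqP ? /eqP ?]. Qed.

(** On the common kernel of h1 and h2, the difference defining F does not depend
    on the shift. *)
Let shift2 x s s' : ~~ offN x -> indep s s' -> q (x + s) - q s = q (x + s') - q s'.
Proof.
move=> /on0[A1 A2] D.
have Dx : indep (x + s) s' by rewrite /indep a1D a2D A1 A2 !add0r.
have Dx' : indep s (x + s') by rewrite /indep a1D a2D A1 A2 !add0r.
apply/eqP; rewrite subr_eq addrAC -subr_eq opprK -(q_indep Dx) (addrC (q _)) -(q_indep Dx').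
by rewrite addrCA addrA.
Qed.

Let F_shift x s : offN s -> offN (x + s) -> q (x + s) = F x + q s.
Proof.
move=> sN xsN; rewrite /F; case: ifPn => xN; first exact: q_add.
suff <- : q (x + s) - q s = q (x + z1) - q z1 by rewrite subrK.
have D12 : indep z2 z1 by rewrite /indep a11 a12 a21 a22 mulr0 mulr1 sub0r oppr_eq0 oner_neq0.
have [D|D] := boolP (indep s z1); first exact: shift2.
rewrite (shift2 xN (s' := z2)); first exact: shift2.
move: D sN; rewrite /indep /offN a11 a21 a12 a22 !mulr0 !mulr1 sub0r subr0 oppr_eq0.
by rewrite negbK => /eqP ->; rewrite eqxx orbF.
Qed.

(** Each of u and v excludes at most one of the shifts z1, z2 and z1 + z2. *)
Let exists_shift u v : exists s, [/\ offN s, offN (u + s) & offN (v + s)].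
Proof.
have aux x y : ~~ offN (x + z1) -> exists s, [/\ offN s, offN (x + s) & offN (y + s)].
  move/on0; rewrite a1D a2D a11 a21 addr0 => -[/eqP]; rewrite addr_eq0 => /eqP x1 x2.
  have [yN|] := boolP (offN (y + z2)).
    exists z2; split=> //; first by rewrite /offN a22 oner_neq0 orbT.
    by rewrite /offN a1D a12 x1 addr0 oppr_eq0 oner_neq0.
  move/on0; rewrite a1D a2D a12 a22 addr0 => -[y1 _].
  exists z0; rewrite /offN !a1D !a2D a11 a12 a21 a22 x1 x2 y1 !addr0 !add0r.
  by rewrite oner_neq0 !orbT.
have [uN|] := boolP (offN (u + z1)); last exact: aux.
have [vN|/(aux v u)[s [*]]] := boolP (offN (v + z1)); last by exists s.
by exists z1; split=> //; rewrite /offN a11 oner_neq0.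
Qed.

Let F_add x x' : F (x + x') = F x + F x'.
Proof.
have [s [sN x'N xN]] := exists_shift x' (x + x').
apply: (addIr (q s)); rewrite -F_shift // -addrA -[RHS]addrA -F_shift //.
by apply: F_shift; rewrite // addrA.
Qed.

Let q_scale c x : c != 0 -> offN x -> q (c *: x) = c *: q x.
Proof.
move=> c0 xN; apply: qE; last by apply: Q_scale => //; apply: qP.
by move: xN; rewrite /offN a1Z a2Z !mulf_eq0 (negPf c0).
Qed.

Let z1N : offN z1. Proof. by rewrite /offN a11 oner_neq0. Qed.

Let F_scale c x : F (c *: x) = c *: F x.
Proof.
have [->|c0] := eqVneq c 0.
  rewrite !scale0r /F; have -> : offN 0 = false by rewrite /offN /a1 /a2 !mulmx0 !mxE eqxx.
  by rewrite add0r subrr.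
have eN y : offN (c *: y) = offN y by rewrite /offN a1Z a2Z !mulf_eq0 (negPf c0).
rewrite /F eN; case: ifPn => xN; first exact: q_scale.
have xzN : offN (x + z1) by case/on0: xN => A1 A2; rewrite /offN a1D A1 a11 add0r oner_neq0.
have sh : q (c *: x + c *: z1) = F (c *: x) + q (c *: z1).
  by apply: F_shift; rewrite ?eN // -scalerDr eN.
move: sh; rewrite -scalerDr !q_scale // /F eN (negPf xN) => sh.
by rewrite scalerBr sh addrK.
Qed.

Let F_coltype x : x != 0 -> coltype V g x (F x).
Proof.
move=> x0; rewrite /F; case: ifPn => xN; first by case: (qP xN).
have [A1 A2] := on0 xN.
have xzN : offN (x + z1) by rewrite /offN a1D A1 a11 add0r oner_neq0.
have [ts f1 _] := qP xzN; have [tz f2 _] := qP z1N.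
have [y ty] := t1 x0.
have [a [b ey]] : exists a b, y = a *: q (x + z1) + b *: q z1.
  by apply: (coltype_plane (s := 1) (t := -1) ts tz); rewrite scale1r scaleN1r addrK.
have F1y : F1 *m y = 0.
  by apply/eqP; have := comb 1 0 ty; rewrite A1 mulr0 mul0r scale1r scale0r !addr0 eqxx => /esym.
have ab : b = - a.
  move/eqP: F1y; rewrite ey mulmxDr -!scalemxAr f1 f2 a1D A1 a11 add0r scale1r -scalerDl.
  by rewrite scaler_eq0 (negPf w'0) orbF addrC addr_eq0 => /eqP.
have {}ey : y = a *: (q (x + z1) - q z1) by rewrite ey ab scaleNr scalerBr.
have a0 : a != 0.
  by have [y0 _] := ty; apply: contraNneq y0 => a0; rewrite ey a0 scale0r.
have -> : q (x + z1) - q z1 = a^-1 *: y by rewrite ey scalerA mulVf ?scale1r.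
by apply: coltype_scale; rewrite ?invr_eq0.
Qed.

Lemma coltype_matrix_coord : exists Y : 'M[K]_n, forall x, x != 0 -> coltype V g x (Y *m x).
Proof.
have [Y YE] := mx_of_fun F_add F_scale; exists Y => x x0.
by rewrite -YE; apply: F_coltype.
Qed.

End Coordinates.

Section Frobenius.
Variable K : fieldType.

(** If all the vectors are of column type, then g is an equivalence. *)
Lemma coltype_equivalence n (V V' : {vspace 'M[K]_n}) g g' : preserver V V' g g' -> (0 < n)%N ->
  (forall x : 'cV[K]_n, x != 0 -> exists y, coltype V g x y) ->
  exists P R : 'M[K]_n, [/\ P \in unitmx, R \in unitmx & forall M, M \in V -> g M = P *m M *m R].
Proof.
move=> cx n0 t1; have dV : (n * n + 2 <= \dim V + n)%N by case: cx.
have [w w0] : exists x : 'cV[K]_n, x != 0.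
  by exists (delta_mx (Ordinal n0) 0); apply: delta_col_neq0.
have [h1 [h10 Vh1 _]] := rank_one_row 0 dV w0; have [z1 h11] := neq0_row_ex h10.
have [h2 [h20 Vh2 h21]] := rank_one_row z1 dV w0; have [z2 h22] := neq0_row_ex h20.
(* z2 is corrected by a multiple of z1, so that h1 z2 = 0. *)
have [Y tY] : exists Y : 'M[K]_n, forall x, x != 0 -> coltype V g x (Y *m x).
  apply: (coltype_matrix_coord cx t1 w0 Vh1 Vh2 h11 (z2 := z2 - z1 *m (h1 *m z2)) _ h21).
    by rewrite mulmxBr (mulmxA h1) h11 mul1mx subrr.
  by rewrite mulmxBr (mulmxA h2) h21 mul0mx subr0.
have uY : Y \in unitmx.
  apply: unitmx_of_ker => x Yx; apply/eqP; apply: contraT => /tY[].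
  by rewrite Yx eqxx.
have [|P PE] := local_linear (g := (lmul (1%:M : 'M_n) Y \o g)%VF) dV.
  move=> M x MV Mx; rewrite comp_lfunE lmulE mul1mx -mulmxA.
  have [->|x0] := eqVneq x 0; first by rewrite !mulmx0.
  by apply/eqP; have [_ <-] := tY _ x0; rewrite // Mx.
have gE M : M \in V -> g M = P *m M *m invmx Y.
  by move=> MV; rewrite -PE // comp_lfunE lmulE mul1mx mulmxK.
exists P, (invmx Y); split; rewrite ?unitmx_inv //.
(* By the dimension bound V contains an invertible matrix, and so P is invertible. *)
have [M MV uM] : exists2 M, M \in V & M \in unitmx.
  apply: NNPP => no; have /singular_affine_dim : singular_affine 0 V.
    by move=> M MV; rewrite add0r; apply/negP => uM; apply: no; exists M.
  by move: dV; clear; dlia.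
by move: uM; rewrite -(preserver_unit cx MV) gE // !unitmx_mul => /andP[/andP[]].
Qed.

End Frobenius.

(** * Extension to a Frobenius automorphism *)

Section Final.
Variable K : fieldType.

(** A field whose only elements are 0 and 1 is isomorphic to the field with two
    elements. *)
Lemma two_elements : (forall a : K, a = 0 \/ a = 1) -> field_isomorphic K 'F_2.
Proof.
move=> all2; pose phi (x : K) : 'F_2 := (x != 0)%:R.
have p0 : phi 0 = 0 by rewrite /phi eqxx.
have p1 : phi 1 = 1 by rewrite /phi oner_neq0.
have e2 : 1 + 1 = 0 :> K.
  by case: (all2 (1 + 1)) => // /eqP; rewrite -subr_eq0 addrK oner_eq0.
have phiB : zmod_morphism phi.
  move=> x y; case: (all2 x) => ->; case: (all2 y) => ->; rewrite ?subrr ?subr0 ?sub0r ?p0 ?p1 ?subrr ?subr0 ?sub0r //.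
  have -> : - 1 = 1 :> K by apply/eqP; rewrite eq_sym -addr_eq0 e2.
  by rewrite p1; apply/eqP.
have phiM : monoid_morphism phi.
  split=> // x y; case: (all2 x) => ->; case: (all2 y) => ->; by rewrite ?mul0r ?mulr0 ?mul1r ?p0 ?p1 ?mul0r ?mulr0 ?mul1r.
pose aM := GRing.isZmodMorphism.Build K 'F_2 phi phiB.
pose mM := GRing.isMonoidMorphism.Build K 'F_2 phi phiM.
pose Phi : {rmorphism K -> 'F_2} := HB.pack phi aM mM.
exists Phi; exists (fun y : 'F_2 => (y != 0)%:R) => x /=.
  by case: (all2 x) => ->; rewrite /Phi /= ?p0 ?p1 ?eqxx ?oner_neq0.
rewrite /Phi /= /phi; have [->|y0] := eqVneq x 0; first by rewrite eqxx.
rewrite oner_neq0; apply: val_inj; case: x y0 => -[|[|m]] //=.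
Qed.

(** The classification is available under the hypotheses of the theorem: by the
    equality cases with M0 = 0 if V is the whole space, and by
    [singular_compression] otherwise. *)
Lemma classified_small_codim n (V : {vspace 'M[K]_n}) : (n * n + 2 <= \dim V + n)%N ->
  ~ [/\ n = 3%N, (\dim V + 1 = n * n)%N & field_isomorphic K 'F_2] -> classified V.
Proof.
move=> dV exc W WV sing dW.
have dVn : (\dim V <= n * n)%N by rewrite -(@dim_fullM K) dimvS // subvf.
have n2 : (1 < n)%N by move: dV dVn; clear; dnia.
case: n => [|[|k]] // in V exc W WV sing dW dV dVn n2 *.
have [dVe|dVe] := eqVneq (\dim V) (k.+2 * k.+2)%N.
  have [k0|k0] := posnP k.
    by subst k; case: (singular2 sing) => [h|/has_kernel_trV h]; [constructor 1|constructor 2].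
  have sW : singular_affine 0 W by move=> M MW; rewrite add0r; apply: sing.
  have dWn : (k.+2 * k.+2 <= \dim W + k.+2)%N by rewrite -dVe.
  case: (singular_affine_max _ sW dWn) => [//|[v v0 h]|[y y0 h]].
    by constructor 1; exists v => // M /h; rewrite add0r.
  by constructor 2; apply: has_kernel_trV; exists y => // M /h; rewrite add0r.
(* If V is not the whole space, its codimension is at least 1, and n >= 3. *)
have k1 : (1 <= k)%N.
  move: dV dVn dVe; clear; case: k V => // V; dlia.
apply: singular_compression => //; last by rewrite /large; move: dV dW; clear; dlia.
have [k2|k2] := leqP 2 k; [by left|right].
apply: NNPP => no; apply: exc; split.
- by lia.
- have ek : k = 1%N by lia.
  by subst k; move: dV dVn dVe; clear; dlia.
apply: two_elements => a; have [->|a0] := eqVneq a 0; first by left.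
right; apply/eqP/negPn/negP => a1; apply: no; by exists a.
Qed.

(** g coincides on V with a map M |-> P M R or M |-> P M^T R, with P and R
    invertible. *)
Definition equivalence n (V : {vspace 'M[K]_n}) (g : 'End('M[K]_n)) := exists P R : 'M[K]_n,
  [/\ P \in unitmx, R \in unitmx & (forall M, M \in V -> g M = P *m M *m R) \/
    (forall M, M \in V -> g M = P *m M^T *m R)].

Lemma equivalence_trt n (V : {vspace 'M[K]_n}) g : equivalence V (trlf K n \o g)%VF -> equivalence V g.
Proof.
case=> P [R [uP uR h]]; exists R^T, P^T; split; rewrite ?unitmx_tr //.
have e M : g M = ((trlf K n \o g)%VF M)^T by rewrite comp_lfunE trlfE trmxK.
by case: h => h; [right|left] => M MV; rewrite e h // !trmx_mul ?trmxK mulmxA.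
Qed.

Lemma equivalence_inv n (V V' : {vspace 'M[K]_n}) g g' : preserver V V' g g' ->
  equivalence V' g' -> equivalence V g.
Proof.
move=> cx [P [R [uP uR [h|h]]]].
  exists (invmx P), (invmx R); split; rewrite ?unitmx_inv //; left=> M MV.
  have e : M = P *m g M *m R by rewrite -h ?(preserver_mem cx MV) // (preserver_invK cx MV).
  by rewrite [in RHS]e !mulmxA mulVmx // mul1mx mulmxK.
exists (invmx R)^T, (invmx P)^T; split; rewrite ?unitmx_tr ?unitmx_inv //; right=> M MV.
have e : M = P *m (g M)^T *m R by rewrite -h ?(preserver_mem cx MV) // (preserver_invK cx MV).
have {}e : (g M)^T = invmx P *m M *m invmx R.
  by rewrite [in RHS]e !mulmxA mulVmx // mul1mx mulmxK.
by rewrite -[LHS]trmxK e !trmx_mul mulmxA.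
Qed.

Lemma uniform_equivalence n (V V' : {vspace 'M[K]_n}) g g' : preserver V V' g g' -> (0 < n)%N ->
  equivalence V g \/ all_spectype V V' g.
Proof.
move=> cx n0; case: (uniform_type cx) => [|t1|t2]; first by right.
  left; have [P [R [uP uR h]]] := coltype_equivalence cx n0 t1.
  by exists P, R; split=> //; left.
left; apply: equivalence_trt.
have [|P [R [uP uR h]]] := coltype_equivalence (preserver_tr cx) n0.
  by move=> x /t2[y ty]; exists y^T; apply: rowtype_tr.
by exists P, R; split=> //; left.
Qed.

Lemma preserver_equivalence n (V V' : {vspace 'M[K]_n}) g g' : preserver V V' g g' -> (0 < n)%N ->
  equivalence V g.
Proof.
move=> cx n0; have [//|t] := uniform_equivalence cx n0.
have [|t'] := uniform_equivalence (preserver_sym cx) n0; first exact: equivalence_inv cx.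
have [h|tt] := uniform_equivalence (preserver_sym (preserver_tr cx)) n0.
  by apply: equivalence_trt; apply: equivalence_inv (preserver_tr cx) h.
by case: (all_spectype_false cx n0 t t' tt).
Qed.

End Final.

Theorem theorem1 (K : fieldType) (n : nat) (V : {vspace 'M[K]_n})
    (f : {linear subvs_of V -> 'M[K]_n}) :
  (0 < n)%N ->
  (codim V < n - 1)%N ->
  injective f ->
  (forall M : subvs_of V, f M \in unitmx <-> vsval M \in unitmx) ->
  ~ [/\ n = 3%N, codim V = 1%N & field_isomorphic K 'F_2] ->
  exists u : 'M[K]_n -> 'M[K]_n,
    Frobenius_automorphism u /\ forall M : subvs_of V, u (vsval M) = f M.
Proof.
move=> n0 cV finj funit exc.
pose g : 'End('M[K]_n) := linfun (f \o vsproj V).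
have gE M : g M = f (vsproj V M) by rewrite lfunE.
have g0 M : M \in V -> g M = 0 -> M = 0.
  move=> MV; rewrite gE -(linear0 f) => /finj e.
  by rewrite -(vsprojK MV) e linear0.
pose V' := (g @: V)%VS.
have dV' : \dim V' = \dim V by apply: dim_inj.
have [g' g'K] := lfun_factor (f := g) (h := \1%VF) (S := V) (fun M MV e => etrans (id_lfunE M) (g0 M MV e)).
have {}g'K M : M \in V -> g' (g M) = M by move=> /g'K; rewrite id_lfunE.
have dVn : (\dim V <= n * n)%N by rewrite -(@dim_fullM K) dimvS // subvf.
have dV : (n * n + 2 <= \dim V + n)%N.
  by move: cV dVn; rewrite /codim dim_fullM; clear -n0; dlia.
have excV : ~ [/\ n = 3%N, (\dim V + 1 = n * n)%N & field_isomorphic K 'F_2].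
  case=> e1 e2 e3; apply: exc; split=> //.
  by rewrite /codim dim_fullM -e2 addnC addnK.
have cx : preserver V V' g g'.
  split; rewrite ?dV' //; try by apply: classified_small_codim; rewrite ?dV'.
  split=> //.
  - by move=> M MV; apply: memv_img.
  - by move=> N /memv_imgP[M MV ->]; rewrite g'K.
  - by move=> N /memv_imgP[M MV ->]; rewrite g'K.
  move=> M MV; rewrite gE; apply/idP/idP; first by move/funit; rewrite vsprojK.
  by move=> uM; apply/funit; rewrite vsprojK.
have [P [R [uP uR h]]] := preserver_equivalence cx n0.
have fE (M : subvs_of V) : f M = g (vsval M) by rewrite gE vsvalK.
case: h => h.
  exists (fun M => P *m M *m R); split; first by exists P, R; split=> //; left.
  by move=> M; rewrite fE h // subvsP.
exists (fun M => P *m M^T *m R); split; first by exists P, R; split=> //; right.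
by move=> M; rewrite fE h // subvsP.
Qed.
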